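(* Let $m\ge2$, and let $v:[0,1)\to(0,\infty)$ be a positive increasing continuous function with $\lim_{r\to1}v(r)=+\infty$. Assume that $\lambda(t)=t^{m-1}v(1-t)$ (for $0<t\le1$), $\lambda(0)=0$, is an increasing continuous function. (a) For any positive harmonic function $u$ in the unit ball of $\mathbf R^m$, the set $$F_v^+(u)=\Big\{y\in S:\limsup_{r\to1}\frac{u(ry)}{v(r)}>0\Big\}$$ is a countable union of sets of finite $\mathcal H_\lambda$-measure. (b) There exists a positive function $u\in\Psi_v^m$ such that $\mathcal H_\lambda(E^+(u))>0$.
   Context: $\mathbf B$ is the open unit ball of $\mathbf R^m$ and $S$ is the unit sphere. $\Psi_v^m$ is the class of harmonic functions $u:\mathbf B\to\mathbf R$ such that $|u(x)|\le Kv(|x|)$ for all $x\in\mathbf B$, for some constant $K$. For such $u$, $E^+(u)=\{y\in S:\liminf_{r\to1-}u(ry)/v(r)>0\}$. $\mathcal H_\lambda$ is the Hausdorff measure with gauge $\lambda$: $\mathcal H_\lambda(E)=\lim_{\delta\to0}\inf\{\sum_j\lambda(\operatorname{diam}F_j):E\subset\bigcup_jF_j,\ \operatorname{diam}F_j<\delta\}$, the infimum being over countable covers (only values of $\lambda$ near $0$ matter). *)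

(* Defs.v *)
From mathcomp Require Export all_boot all_order all_algebra.
From mathcomp Require Export all_classical all_reals all_analysis.

Set Implicit Arguments.
Unset Strict Implicit.
Unset Printing Implicit Defensive.

Export Order.TTheory GRing.Theory Num.Theory.
Export numFieldNormedType.Exports.

Local Open Scope classical_set_scope.
Local Open Scope ring_scope.

(* The library norm on row vectors is the sup norm. It induces the Euclidean
   topology, but balls, spheres and diameters below need the Euclidean norm. *)
Definition enorm (R : realType) (m : nat) (x : 'rV[R]_m) : R :=
  Num.sqrt (\sum_(i < m) x ord0 i ^+ 2).

Definition unit_ball (R : realType) (m : nat) : set 'rV[R]_m :=
  [set x | enorm x < 1].

Definition unit_sphere (R : realType) (m : nat) : set 'rV[R]_m :=
  [set x | enorm x = 1].

Definition partial (R : realType) (m : nat) (i : 'I_m) (u : 'rV[R]_m -> R)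
    (x : 'rV[R]_m) : R :=
  'D_(delta_mx ord0 i) u x.

(* C1_on, C2_on and harmonic_on are meant for open D: derivatives and
   continuity are those of the ambient space, so for open D they do not depend
   on the values of u outside D. *)
Definition C1_on (R : realType) (m : nat) (D : set 'rV[R]_m)
    (u : 'rV[R]_m -> R) : Prop :=
  (forall x, D x -> {for x, continuous u}) /\
  (forall i x, D x ->
     derivable u x (delta_mx ord0 i) /\ {for x, continuous (partial i u)}).

Definition C2_on (R : realType) (m : nat) (D : set 'rV[R]_m)
    (u : 'rV[R]_m -> R) : Prop :=
  C1_on D u /\ forall i, C1_on D (partial i u).

Definition harmonic_on (R : realType) (m : nat) (D : set 'rV[R]_m)
    (u : 'rV[R]_m -> R) : Prop :=
  C2_on D u /\
  forall x, D x -> \sum_(i < m) partial i (partial i u) x = 0.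

Definition positive_on (R : realType) (m : nat) (D : set 'rV[R]_m)
    (u : 'rV[R]_m -> R) : Prop :=
  forall x, D x -> 0 < u x.

Definition growth_class (R : realType) (m : nat) (v : R -> R)
    (u : 'rV[R]_m -> R) : Prop :=
  harmonic_on (@unit_ball R m) u /\
  exists K : R, forall x, unit_ball x -> `|u x| <= K * v (enorm x).

Definition E_plus (R : realType) (m : nat) (v : R -> R)
    (u : 'rV[R]_m -> R) : set 'rV[R]_m :=
  [set y | unit_sphere y /\
     (0 < limf_einf (fun r : R => (u (r *: y) / v r)%:E) (1 : R)^'-)%E].

Definition F_plus (R : realType) (m : nat) (v : R -> R)
    (u : 'rV[R]_m -> R) : set 'rV[R]_m :=
  [set y | unit_sphere y /\
     (0 < limf_esup (fun r : R => (u (r *: y) / v r)%:E) (1 : R)^'-)%E].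

(* The added 0 only affects the empty set, whose diameter is thus 0. *)
Definition ediam (R : realType) (m : nat) (A : set 'rV[R]_m) : \bar R :=
  ereal_sup [set d | d = 0%E \/
    exists x y, [/\ A x, A y & d = (enorm (x - y))%:E]].

(* Finite covers are included: some of the F j may be empty. *)
Definition hausdorff_pre (R : realType) (m : nat) (lambda : R -> R)
    (A : set 'rV[R]_m) (delta : R) : \bar R :=
  ereal_inf [set s | exists F : nat -> set 'rV[R]_m,
    [/\ A `<=` \bigcup_j F j,
        (forall j, (ediam (F j) < delta%:E)%E) &
        s = (\sum_(0 <= j <oo) (lambda (fine (ediam (F j))))%:E)%E]].

Definition hausdorff_measure (R : realType) (m : nat) (lambda : R -> R)
    (A : set 'rV[R]_m) : \bar R :=
  lim (hausdorff_pre lambda A delta @[delta --> (0 : R)^'+]).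

(* Only the values for 0 <= t <= 1 are meaningful; the value of
   hausdorff_measure depends only on the gauge near 0. *)
Definition gauge (R : realType) (m : nat) (v : R -> R) (t : R) : R :=
  if t == 0 then 0 else t ^+ (m - 1) * v (1 - t).

(* Main.v *)
(** (a) If [u ((1 - t) y) >= kappa v(1 - t)] with [t] small, Harnack's inequality
    gives [u >= c v(1 - t)] on a ball around [x = (1 - t) y]. Give the dyadic cells
    around such points [y_j] weights [w_j], chosen greedily so that a cell of side
    [s] carries at most [lambda(s)] (a Frostman measure). By dyadic summation,
    [sum_j w_j P_j] is at most [C v(1 - t_i)] near [x_i], where [P_j] is (a multiple of) the Poisson
    kernel of the ball of radius [1 - t_j] with pole [x_j]. Each [P_j] is
    nonpositive outside that ball, so the maximum principle gives
    [sum_j w_j P_j <= C u] away from the poles, and at the origin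
    [sum_j w_j <= C u(0)]. The maximal saturated cells cover the set, and their
    gauges add up to at most [sum_j w_j]. This replaces the representing measure of
    [u] and a Vitali covering. Harnack's inequality follows from the mean value
    property with weight [(1 - |x|^2)_+], proved with Riemann sums.

    (b) Choose scales with [lambda(rho_k) = 2^(- k (m - 1)) lambda(rho_0)]. The
    [(m - 1)]-fold product of the Cantor set with digit weights [rho_k], lifted to
    the sphere, carries a measure whose mass in a ball of radius [s] is comparable
    to [lambda(s)]. Its Poisson integral, obtained as an ultrafilter limit of
    averages of Poisson kernels, is [u]. *)

Require Import Defs.
From mathcomp Require Import ring lra zify.

Set Implicit Arguments.
Unset Strict Implicit.
Unset Printing Implicit Defensive.

Local Open Scope classical_set_scope.
Local Open Scope ring_scope.

(** * The Euclidean norm *)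

(** No surface measure or integral is set up: measures are replaced by finite sums, with estimates
    uniform in the pole. In (a) the poles lie inside the ball and only finitely many enter at a
    time, so boundary values of [u] never occur: on a sphere beyond all poles each kernel is
    nonpositive while [u] is positive. The bound must not depend on the fineness of the cover, and
    it involves only [m], [kappa] and [u 0]. The hypotheses enter at separate places. Since [v]
    increases, [lam (c * t) <= c ^ p * lam t] for [c >= 1] and [p = m - 1], which makes the dyadic
    sums geometric and forces the scales of (b) to at least halve. Monotonicity of [lam] passes from
    diameters to sides of cells and to neighbouring scales. The divergence of [v] lets its values at
    small heights absorb the total capacity of the coarsest cells in (a). Continuity of [lam] yields
    the scales of (b) and allows covering sets to be enlarged to open balls. The averages over
    generations in (b) are not shown to converge; along an ultrafilter they still define a linear
    functional that inherits the two-sided bounds. *)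

Lemma cauchy_schwarz_sum (R : realType) (m : nat) (x y : 'I_m -> R) :
  (\sum_i x i * y i) ^+ 2 <= (\sum_i x i ^+ 2) * (\sum_i y i ^+ 2).
Proof.
(* Lagrange's identity: this double sum is twice the defect of the inequality. *)
have : 0 <= \sum_i \sum_j (x i * y j - x j * y i) ^+ 2.
  by apply: sumr_ge0 => i _; apply: sumr_ge0 => j _; rewrite sqr_ge0.
have -> : \sum_i \sum_j (x i * y j - x j * y i) ^+ 2 =
   ((\sum_i x i ^+ 2) * (\sum_i y i ^+ 2) - (\sum_i x i * y i) ^+ 2) *+ 2.
  transitivity (\sum_i \sum_j (x i ^+ 2 * y j ^+ 2
     + y i ^+ 2 * x j ^+ 2 - (x i * y i * (x j * y j)) *+ 2)).
    by apply: eq_bigr => i _; apply: eq_bigr => j _; rewrite mulr2n; ring.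
  have dist (a b : 'I_m -> R) :
      \sum_i \sum_j a i * b j = (\sum_i a i) * (\sum_j b j).
    by rewrite big_distrl; apply: eq_bigr => i _; rewrite -big_distrr.
  under eq_bigr do rewrite !big_split /= sumrN sumrMnl.
  rewrite !big_split /= sumrN !dist sumrMnl dist.
  by rewrite expr2 !mulr2n; ring.
by rewrite pmulrn_lge0// subr_ge0.
Qed.

Section enorm_theory.
Variables (R : realType) (m : nat).
Implicit Types x y z : 'rV[R]_m.

Lemma enorm_ge0 x : 0 <= enorm x.
Proof. exact: sqrtr_ge0. Qed.

Lemma sqr_enorm x : enorm x ^+ 2 = \sum_(i < m) x ord0 i ^+ 2.
Proof. by rewrite sqr_sqrtr// sumr_ge0// => i _; rewrite sqr_ge0. Qed.

Lemma enorm0 : enorm (0 : 'rV[R]_m) = 0.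
Proof.
by rewrite /enorm big1 ?sqrtr0// => i _; rewrite mxE expr0n.
Qed.

Lemma enormZ (c : R) x : enorm (c *: x) = `|c| * enorm x.
Proof.
rewrite /enorm -sqrtr_sqr -sqrtrM ?sqr_ge0//; congr Num.sqrt.
by rewrite big_distrr/=; apply: eq_bigr => i _; rewrite mxE exprMn.
Qed.

Lemma enormN x : enorm (- x) = enorm x.
Proof. by rewrite -scaleN1r enormZ normrN1 mul1r. Qed.

Lemma enormB x y : enorm (x - y) = enorm (y - x).
Proof. by rewrite -enormN opprB. Qed.

Lemma enorm_triangle x y : enorm (x + y) <= enorm x + enorm y.
Proof.
rewrite -(@ler_pXn2r _ 2)// ?nnegrE ?addr_ge0 ?enorm_ge0//.
rewrite sqrrD !sqr_enorm.
have -> : \sum_(i < m) (x + y) ord0 i ^+ 2 = \sum_(i < m) x ord0 i ^+ 2 +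
   (\sum_(i < m) x ord0 i * y ord0 i) *+ 2 + \sum_(i < m) y ord0 i ^+ 2.
  rewrite -sumrMnl -!big_split/=; apply: eq_bigr => i _.
  by rewrite mxE sqrrD.
rewrite lerD2r lerD2l lerMn2r/=.
apply: (le_trans (ler_norm _)).
rewrite -(@ler_pXn2r _ 2)// ?nnegrE ?mulr_ge0 ?enorm_ge0//.
by rewrite real_normK ?num_real// exprMn !sqr_enorm; exact: cauchy_schwarz_sum.
Qed.

Lemma enorm_triangleB x y z : enorm (x - z) <= enorm (x - y) + enorm (y - z).
Proof. by have := enorm_triangle (x - y) (y - z); rewrite addrA subrK. Qed.

Lemma enorm_dist x y : `|enorm x - enorm y| <= enorm (x - y).
Proof.
have A (a b : 'rV[R]_m) : enorm a - enorm b <= enorm (a - b).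
  by have := enorm_triangle (a - b) b; rewrite subrK lerBlDr.
by rewrite ler_norml A andbT lerNl opprB enormB A.
Qed.

Lemma coord_le_enorm x (i : 'I_m) : `|x ord0 i| <= enorm x.
Proof.
rewrite -(@ler_pXn2r _ 2)// ?nnegrE ?enorm_ge0// real_normK ?num_real//.
rewrite sqr_enorm (bigD1 i)//= lerDl sumr_ge0// => j _; exact: sqr_ge0.
Qed.

Lemma enorm_le_coord x (c : R) : 0 <= c -> (forall i, `|x ord0 i| <= c) ->
  enorm x <= m%:R * c.
Proof.
move=> c0 xc; rewrite -(@ler_pXn2r _ 2)// ?nnegrE ?enorm_ge0// ?mulr_ge0//.
rewrite sqr_enorm (@le_trans _ _ (\sum_(i < m) c ^+ 2))//.
  apply: ler_sum => i _; rewrite -real_normK ?num_real//.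
  by rewrite lerXn2r ?nnegrE.
rewrite sumr_const card_ord -(mulr_natl (c ^+ 2)) exprMn ler_wpM2r ?sqr_ge0//.
by rewrite expr2 -natrM ler_nat; case: (m) => // n; rewrite leq_pmull.
Qed.

Lemma enorm_eq0 x : enorm x = 0 -> x = 0.
Proof.
move=> x0; apply/rowP => i; rewrite mxE; apply/eqP; rewrite -normr_le0.
by rewrite -x0 coord_le_enorm.
Qed.

Lemma norm_le_enorm x : `|x| <= enorm x.
Proof.
rewrite [leLHS]/Num.norm/= mx_normrE; apply/bigmax_leP; split => [|[i j] _].
  exact: enorm_ge0.
by rewrite (ord1 i) coord_le_enorm.
Qed.

Lemma coord_le_norm x i : `|x ord0 i| <= `|x|.
Proof.
rewrite [leRHS]/Num.norm/= mx_normrE.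
by apply: (le_trans _ (le_bigmax _ _ (ord0, i))).
Qed.

Lemma enorm_le_norm x : enorm x <= m%:R * `|x|.
Proof. by apply: enorm_le_coord => // i; exact: coord_le_norm. Qed.

Lemma enorm_continuous : continuous (@enorm R m).
Proof.
move=> x; apply/(@cvgrPdist_le _ _ _ _ (nbhs_filter x)) => /= e e0.
have m1 : 0 < m%:R + 1 :> R by rewrite ltr_wpDl.
apply/nbhs_ballP; exists (e / (m%:R + 1)); first exact: divr_gt0.
move=> y; rewrite -ball_normE/= ltr_pdivlMr// => /ltW xy.
rewrite (le_trans (enorm_dist _ _))// (le_trans (enorm_le_norm _))//.
by apply: le_trans xy; rewrite mulrC ler_wpM2l// lerDl.
Qed.

Lemma enorm_ball_nbhs x (r : R) : 0 < r -> \forall y \near x, enorm (x - y) < r.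
Proof.
move=> r0.
have m1 : 0 < m%:R + 1 :> R by rewrite ltr_wpDl.
apply/nbhs_ballP; exists (r / (m%:R + 1)); first exact: divr_gt0.
move=> y; rewrite -ball_normE/= ltr_pdivlMr//; apply: le_lt_trans.
by rewrite (le_trans (enorm_le_norm _))// mulrC ler_wpM2l// lerDl.
Qed.

Lemma near_enorm x (P : set 'rV[R]_m) : (\forall y \near x, P y) ->
  exists2 d : R, 0 < d & forall y, enorm (x - y) < d -> P y.
Proof.
move=> /nbhs_ballP[d /= d0 dP]; exists d => // y xy; apply: dP.
by rewrite -ball_normE/=; apply: le_lt_trans xy; exact: norm_le_enorm.
Qed.

Lemma open_enorm_lt x (r : R) : open [set y | enorm (x - y) < r].
Proof.
rewrite openE => y /= xy; rewrite /interior.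
apply: filterS (@enorm_ball_nbhs y (r - enorm (x - y)) _) => [z /= yz|].
  by have := enorm_triangleB x y z; lra.
by rewrite subr_gt0.
Qed.

Lemma closed_enorm_le x (r : R) : closed [set y | enorm (x - y) <= r].
Proof.
rewrite -[X in closed X]setCK; apply: open_closedC.
rewrite openE => y /= /negP; rewrite -ltNge => xy; rewrite /interior.
apply: filterS (@enorm_ball_nbhs y (enorm (x - y) - r) _) => [z /= yz|].
  by apply/negP; rewrite -ltNge; have := enorm_triangleB x z y;
     rewrite (enormB z y); lra.
by rewrite subr_gt0.
Qed.

Lemma compact_enorm_le x (r : R) (A : set 'rV[R]_m) :
  closed A -> A `<=` [set y | enorm (x - y) <= r] -> compact A.
Proof.
move=> cA Ar; apply: bounded_closed_compact => //.
exists (enorm x + r); split; first exact: num_real.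
move=> M rM y Ay; apply/ltW/(le_lt_trans (norm_le_enorm _))/le_lt_trans/rM.
have := enorm_dist x y; have := Ar _ Ay => /=.
by move=> h1 /ler_normlP[h2 _]; lra.
Qed.

Lemma unit_ballE : @unit_ball R m = [set y | enorm (0 - y) < 1].
Proof. by apply/seteqP; split => y; rewrite /unit_ball /= sub0r enormN. Qed.

Lemma open_unit_ball : open (@unit_ball R m).
Proof. by rewrite unit_ballE; exact: open_enorm_lt. Qed.

End enorm_theory.

Lemma enorm_delta (R : realType) (m : nat) (i : 'I_m) :
  enorm (delta_mx ord0 i : 'rV[R]_m) = 1.
Proof.
rewrite /enorm (bigD1 i)//= big1 ?addr0 => [|j ji].
  by rewrite mxE !eqxx expr1n sqrtr1.
by rewrite mxE eqxx (negbTE ji) expr0n.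
Qed.

Lemma sqr_enorm_shift (R : realType) (m : nat) (x : 'rV[R]_m) (i : 'I_m) (h : R) :
  enorm (x + h *: delta_mx ord0 i) ^+ 2 =
  enorm x ^+ 2 + 2 * h * x ord0 i + h ^+ 2.
Proof.
rewrite !sqr_enorm (bigD1 i)//= [in RHS](bigD1 i)//= !mxE !eqxx/=.
under eq_bigr => j ji do rewrite !mxE (negbTE ji) andbF mulr0 addr0.
by ring.
Qed.

(** * Dyadic summation of a kernel against weights *)

Section dyadic_kernel_sum.
Variables (R : realType) (I : finType).

(* Split the sum over the dyadic shells [2 ^ (l - 1) * t < d <= 2 ^ l * t]. *)
Lemma kernel_sum_le (w d : I -> R) (t A : R) (p : nat) :
  0 < t -> (forall i, 0 <= w i) -> (forall i, t <= d i) ->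
  (forall l : nat,
     \sum_(i | d i <= 2 ^+ l * t) w i <= A * 2 ^+ (l * p)) ->
  \sum_i w i / d i ^+ p.+1 <= A * 2 ^+ p.+2 / t ^+ p.+1.
Proof.
move=> t0 w0 td wA.
have A0 : 0 <= A.
  by have := wA 0; rewrite mul0n expr0 mulr1; apply: le_trans; exact: sumr_ge0.
have [L HL] : exists L : nat, forall i, d i <= 2 ^+ L * t.
  pose D := \sum_i d i; have D0 i : d i <= D.
    rewrite /D (bigD1 i)//= lerDl sumr_ge0// => j _.
    exact: le_trans (ltW t0) (td j).
  exists (Num.bound `|D / t|) => i; apply: (le_trans (D0 i)).
  rewrite -ler_pdivrMr//; apply: (le_trans (ler_norm _)).
  apply: (le_trans (ltW (archi_boundP _))) => //.
  by rewrite -natrX ler_nat ltnW// ltn_expl.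
(* [a l] dominates [1 / d ^ (p + 1)] when [l] is the least index with [d <= 2 ^ l * t]: then
   [d > 2 ^ (l - 1) * t], or [d >= t] if [l = 0]. Keeping every larger [l] as well is wasteful but
   matches the hypothesis on the weights. *)
pose a l : R := 2 ^+ p.+1 / (2 ^+ l * t) ^+ p.+1.
have a0 l : 0 <= a l by rewrite divr_ge0 ?exprn_ge0// mulr_ge0// ltW.
have key i : w i / d i ^+ p.+1 <=
    \sum_(l < L.+1 | d i <= 2 ^+ l * t) w i * a l.
  have ex : exists l, d i <= 2 ^+ l * t by exists L.
  have [l dl lmin] := ex_minnP ex.
  have lL : (l < L.+1)%N by rewrite ltnS lmin.
  rewrite (bigD1 (Ordinal lL))//= (@le_trans _ _ (w i * a l))//; last first.
    by rewrite lerDl sumr_ge0// => j _; rewrite mulr_ge0.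
  rewrite ler_wpM2l// /a -expr_div_n -exprVn lerXn2r ?nnegrE//.
  - by rewrite invr_ge0 (le_trans (ltW t0)).
  - by rewrite divr_ge0// mulr_ge0// ltW.
  - have di0 : 0 < d i by exact: lt_le_trans t0 _.
    rewrite ler_pdivlMr ?mulr_gt0 ?exprn_gt0// mulrC ler_pdivrMr//.
    case: l dl lmin lL => [|l] dl lmin lL.
      by rewrite expr0 mul1r; have := td i; lra.
    rewrite exprS -mulrA ler_wpM2l// ltW// ltNge; apply/negP => /lmin.
    by rewrite ltnn.
apply: (le_trans (ler_sum _ (fun i _ => key i))).
rewrite (exchange_big_dep xpredT)//=.
(* Mass growth [2 ^ (l p)] against kernel decay [2 ^ (- l (p + 1))] leaves [2 ^ (- l)]. The
   geometric sum, at most 2, turns [2 ^ (p + 1)] into [2 ^ (p + 2)]. *)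
have bound (l : 'I_L.+1) : \sum_(i | d i <= 2 ^+ l * t) w i * a l <=
    A * 2 ^+ p.+1 / t ^+ p.+1 * (2^-1) ^+ l.
  rewrite -big_distrl/= (le_trans (ler_wpM2r _ (wA l)))//.
  rewrite le_eqVlt; apply/orP; left; apply/eqP.
  rewrite /a exprMn -exprM mulnS exprD exprVn.
  field; rewrite ?expf_neq0 ?lt0r_neq0//.
apply: (le_trans (ler_sum _ (fun l _ => bound l))).
rewrite -big_distrr/=.
have geo : \sum_(l < L.+1) (2^-1 : R) ^+ l <= 2.
  have := subrX1 (2^-1 : R) L.+1.
  have : 0 <= (2^-1 : R) ^+ L.+1 by rewrite exprn_ge0.
  lra.
have -> : A * 2 ^+ p.+2 / t ^+ p.+1 = A * 2 ^+ p.+1 / t ^+ p.+1 * 2.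
  by rewrite [in LHS]exprSr; ring.
by rewrite ler_wpM2l// divr_ge0 ?exprn_ge0 ?mulr_ge0 ?exprn_ge0// ltW.
Qed.

End dyadic_kernel_sum.

Section slices.
Variables (R : realType) (V : normedModType R).
Implicit Types (f : V -> R) (x v : V).

Lemma is_derive_slice f x v (h d : R) : is_derive (x + h *: v) v f d ->
  is_derive h 1 (fun t : R => f (x + t *: v)) d.
Proof.
move=> [df dE].
have E : (fun k : R => k^-1 *: (f (x + (k *: 1 + h) *: v) - f (x + h *: v))) =
         (fun k : R => k^-1 *: (f (k *: v + (x + h *: v)) - f (x + h *: v))).
  apply/funext => k; congr (_ *: (f _ - _)).
  by rewrite [k *: 1]mulr1 scalerDl addrCA.
by apply: DeriveDef; [rewrite /derivable E | rewrite /derive E].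
Qed.

(* The symmetric second difference has derivative [f' h - f' (- h)]. *)
Lemma second_difference_le (g g' : R -> R) (r d c : R) : 0 < r ->
  (forall h : R, `|h| < r -> is_derive h 1 g (g' h)) ->
  is_derive (0 : R) 1 g' d ->
  (forall h : R, 0 <= h < r -> g h + g (- h) - 2 * g 0 <= - c * h ^+ 2) ->
  d <= - c.
Proof.
move=> r0 dg [dg' dg'E] gc; rewrite leNgt; apply/negP => cd.
have : (fun h : R => h^-1 *: ((g' \o shift 0) (h *: 1) - g' 0)) @ 0^' --> d.
  by rewrite -dg'E; exact: dg'.
have e0 : 0 < (d + c) / 2 by lra.
move=> /cvgrPdist_lt /(_ _ e0) /nbhs_ballP[r1 /= r10 Hr1].
have Hg (h : R) : h != 0 -> `|h| < r1 -> `|d - h^-1 * (g' h - g' 0)| < (d + c) / 2.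
  move=> h0 hr; have := Hr1 h.
  rewrite /ball/= sub0r normrN => /(_ hr h0).
  by rewrite /shift/= addr0 [h *: 1]mulr1.
have [s s0 [sr sr1]] : exists2 s : R, 0 < s & s < r /\ s < r1.
  exists (Num.min r r1 / 2); first by rewrite divr_gt0// lt_min r0.
  have m0 : 0 < Num.min r r1 by rewrite lt_min r0.
  have : Num.min r r1 <= r by rewrite ge_min lexx.
  have : Num.min r r1 <= r1 by rewrite ge_min lexx orbT.
  by lra.
(* The hypothesis says [G s <= G 0]. But if [d > - c], then [G'] is close to [2 * h * (d + c) > 0]
   for small [h > 0], so [G s > G 0]. *)
pose G (h : R) : R := g h + g (- h) + c * h ^+ 2.
have dG (h : R) : `|h| < r -> is_derive h 1 G (g' h - g' (- h) + c * (2 * h)).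
  move=> hr; have d1 := dg h hr.
  have d2 : is_derive (- h) 1 g (g' (- h)) by apply: dg; rewrite normrN.
  have -> : G = (g \+ (g \o -%R)) \+ c \*: (id ^+ 2).
    by apply/funext => k; rewrite /G/=.
  have d3 : is_derive h 1 (g \o -%R) (g' (- h) * - 1).
    exact: is_derive1_comp.
  apply: is_derive_eq.
  by rewrite /= mulrN1 expr1 [_%:A]mulr1 -mulr_natl.
have [||x xs] := @MVT _ G (fun h => g' h - g' (- h) + c * (2 * h)) 0 s s0.
- move=> h; rewrite in_itv/= => /andP[h0 hs]; apply: dG.
  by rewrite gtr0_norm// (lt_trans hs).
- apply: derivable_within_continuous => h; rewrite in_itv/= => /andP[h0 hs].
  have hr : `|h| < r by rewrite ger0_norm// (le_lt_trans hs).
  by have [] := dG h hr.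
move: xs; rewrite in_itv/= => /andP[x0 xs].
have := gc s; rewrite (ltW s0) sr => /(_ isT) Gs.
rewrite /G oppr0 expr0n/= mulr0 !addr0 => Gx.
have : 0 < (g' x - g' (- x) + c * (2 * x)) * s.
  rewrite mulr_gt0//.
  have xr1 : x < r1 by exact: lt_trans sr1.
  have := Hg x; rewrite gt_eqF// gtr0_norm// => /(_ isT xr1).
  rewrite ltr_norml => /andP[_ ]; rewrite ltrBlDr => h1.
  have := Hg (- x); rewrite oppr_eq0 gt_eqF// normrN gtr0_norm// => /(_ isT xr1).
  rewrite ltr_norml => /andP[_ ]; rewrite ltrBlDr => h2.
  have xV : 0 < x^-1 by rewrite invr_gt0.
  rewrite -(pmulr_rgt0 _ xV).
  have ax : x^-1 * x = 1 by rewrite mulVf// gt_eqF.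
  move: h1 h2; rewrite invrN mulNr; move: (x^-1) ax => a ax.
  have -> : a * (g' x - g' (- x) + c * (2 * x)) =
    a * (g' x - g' 0) - a * (g' (- x) - g' 0) + c * 2 * (a * x) by ring.
  by rewrite ax; lra.
by rewrite -Gx; lra.
Qed.

End slices.

(** * Harmonic functions and the maximum principle *)

Lemma near_eq_continuous_at (T : topologicalType) (U : topologicalType)
    (f g : T -> U) (x : T) : (\near x, f x = g x) ->
  {for x, continuous f} -> {for x, continuous g}.
Proof.
move=> fg cf; rewrite /prop_for /continuous_at -(nbhs_singleton fg).
by apply: cvg_trans cf; apply: near_eq_cvg; apply: filterS fg.
Qed.

(* [f1 i] and [f2 i j] are candidates for the first and second partial
   derivatives, which makes linear combinations immediate. *)
Definition harmonic_data (R : realType) (m : nat) (O : set 'rV[R]_m)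
    (f : 'rV[R]_m -> R) (f1 : 'I_m -> 'rV[R]_m -> R)
    (f2 : 'I_m -> 'I_m -> 'rV[R]_m -> R) : Prop :=
  forall x, O x -> [/\ {for x, continuous f},
    forall i, is_derive x (delta_mx ord0 i) f (f1 i x) /\
              {for x, continuous (f1 i)},
    forall i j, is_derive x (delta_mx ord0 j) (f1 i) (f2 i j x) /\
                {for x, continuous (f2 i j)} &
    \sum_i f2 i i x = 0].

Section harmonic_data_theory.
Variables (R : realType) (m : nat) (O : set 'rV[R]_m).
Hypothesis openO : open O.
Implicit Types f g : 'rV[R]_m -> R.

Lemma harmonic_on_data f : harmonic_on O f ->
  harmonic_data O f (fun i => partial i f) (fun i j => partial j (partial i f)).
Proof.
move=> [[[cf df] d2f] lap] x Ox; split.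
- exact: cf.
- move=> i; have [dfx cfx] := df i x Ox; split=> //.
- move=> i j; have [_ /(_ j x Ox)[dfx cfx]] := d2f i; split=> //.
- exact: lap.
Qed.

Lemma harmonic_data_on f (f1 : 'I_m -> 'rV[R]_m -> R)
  (f2 : 'I_m -> 'I_m -> 'rV[R]_m -> R) : harmonic_data O f f1 f2 -> harmonic_on O f.
Proof.
move=> H.
have near_O x : O x -> \forall y \near x, O y by move: openO; rewrite openE; exact.
have p1 i x : O x -> partial i f x = f1 i x.
  by move=> Ox; have [_ /(_ i)[df _] _ _] := H x Ox; rewrite /partial derive_val.
have p1n i x : O x -> \forall y \near x, f1 i y = partial i f y.
  by move=> Ox; apply: (@filterS _ _ (nbhs_filter x) _ _ _ (near_O x Ox)) => y /(p1 i).
have d2 i j x : O x -> is_derive x (delta_mx ord0 j) (partial i f) (f2 i j x).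
  move=> Ox; have [_ _ /(_ i j)[df _] _] := H x Ox.
  exact: near_eq_is_derive (p1n i x Ox) df.
have p2n i j x : O x -> \forall y \near x, f2 i j y = partial j (partial i f) y.
  move=> Ox; apply: (@filterS _ _ (nbhs_filter x) _ _ _ (near_O x Ox)) => y Oy.
  by have dd := d2 i j y Oy; rewrite {1}/partial derive_val.
split; first split; first split.
- by move=> x Ox; have [] := H x Ox.
- move=> i x Ox; have [_ /(_ i)[df cf] _ _] := H x Ox; split.
    by have [] := df.
  exact: near_eq_continuous_at (p1n i x Ox) cf.
- move=> i; split.
    move=> x Ox; have [_ /(_ i)[df cf] _ _] := H x Ox.
    exact: near_eq_continuous_at (p1n i x Ox) cf.
  move=> j x Ox; have [_ _ /(_ i j)[df cf] _] := H x Ox; split.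
    by have [] := d2 i j x Ox.
  exact: near_eq_continuous_at (p2n i j x Ox) cf.
- move=> x Ox; have [_ _ _ lap] := H x Ox; rewrite -[RHS]lap; apply: eq_bigr => i _.
  by have dd := d2 i i x Ox; rewrite {1}/partial derive_val.
Qed.

Lemma harmonic_dataD f g (f1 g1 : 'I_m -> 'rV[R]_m -> R)
  (f2 g2 : 'I_m -> 'I_m -> 'rV[R]_m -> R) : harmonic_data O f f1 f2 ->
  harmonic_data O g g1 g2 -> harmonic_data O (fun x => f x + g x)
   (fun i x => f1 i x + g1 i x) (fun i j x => f2 i j x + g2 i j x).
Proof.
move=> Hf Hg x Ox; have [cf df d2f lf] := Hf x Ox; have [cg dg d2g lg] := Hg x Ox.
split.
- exact: continuousD.
- move=> i; have [? ?] := df i; have [? ?] := dg i; split; last exact: continuousD.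
  exact: is_deriveD.
- move=> i j; have [? ?] := d2f i j; have [? ?] := d2g i j.
  by split; [exact: is_deriveD|exact: continuousD].
- by rewrite big_split/= lf lg addr0.
Qed.

Lemma harmonic_dataZ (c : R) f (f1 : 'I_m -> 'rV[R]_m -> R)
  (f2 : 'I_m -> 'I_m -> 'rV[R]_m -> R) : harmonic_data O f f1 f2 ->
  harmonic_data O (fun x => c * f x)
   (fun i x => c * f1 i x) (fun i j x => c * f2 i j x).
Proof.
move=> Hf x Ox; have [cf df d2f lf] := Hf x Ox.
have cM h : {for x, continuous h} -> {for x, continuous (fun y => c * h y)}.
  move=> ch; apply: (@continuousM _ _ (fun=> c) h x) => //. exact: cst_continuous.
split.
- exact: cM.
- move=> i; have [dfi ?] := df i; split; last exact: cM.
  exact: (@is_deriveZ _ _ _ f c x _ _ dfi).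
- move=> i j; have [dfi ?] := d2f i j; split; last exact: cM.
  exact: (@is_deriveZ _ _ _ (f1 i) c x _ _ dfi).
- by rewrite -big_distrr/= lf mulr0.
Qed.

Lemma harmonic_data0 : harmonic_data O (fun=> 0) (fun _ _ => 0) (fun _ _ _ => 0).
Proof.
move=> x Ox; split.
- exact: cst_continuous.
- by move=> i; split; [exact: is_derive_cst|exact: cst_continuous].
- by move=> i j; split; [exact: is_derive_cst|exact: cst_continuous].
- by rewrite big1.
Qed.

Lemma harmonic_onD f g : harmonic_on O f -> harmonic_on O g ->
  harmonic_on O (fun x => f x + g x).
Proof.
move=> /harmonic_on_data Hf /harmonic_on_data Hg.
exact: harmonic_data_on (harmonic_dataD Hf Hg).
Qed.

Lemma harmonic_onZ (c : R) f : harmonic_on O f -> harmonic_on O (fun x => c * f x).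
Proof.
by move=> /harmonic_on_data Hf; exact: harmonic_data_on (harmonic_dataZ c Hf).
Qed.

Lemma harmonic_on_sum (I : eqType) (s : seq I) (F : I -> 'rV[R]_m -> R) :
  (forall i, i \in s -> harmonic_on O (F i)) ->
  harmonic_on O (fun x => \sum_(i <- s) F i x).
Proof.
elim: s => [_|a s IH H].
  rewrite (_ : (fun _ => _) = (fun=> 0)).
    exact: harmonic_data_on harmonic_data0.
  by apply/funext => x; rewrite big_nil.
rewrite (_ : (fun _ => _) = (fun x => F a x + \sum_(i <- s) F i x)).
  apply: harmonic_onD; first by apply: H; rewrite mem_head.
  by apply: IH => i si; apply: H; rewrite in_cons si orbT.
by apply/funext => x; rewrite big_cons.
Qed.

End harmonic_data_theory.

Lemma harmonic_on_subset (R : realType) (m : nat) (O O' : set 'rV[R]_m) f :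
  O' `<=` O -> harmonic_on O f -> harmonic_on O' f.
Proof.
move=> OO [[[cf df] d2f] lap]; split; last by move=> x /OO; exact: lap.
split; first by split=> [x /OO|i x /OO]; [exact: cf|exact: df].
move=> i; have [c1 d1] := d2f i.
by split=> [x /OO|j x /OO]; [exact: c1|exact: d1].
Qed.

(* At an interior maximum of [f + e * |x| ^ 2] every pure second derivative of
   [f] would be at most [- 2 * e]. *)
Lemma maximum_principle (R : realType) (m : nat) (O K : set 'rV[R]_m)
    (f : 'rV[R]_m -> R) :
  (0 < m)%N -> open O -> K `<=` O -> compact K -> harmonic_on O f ->
  (forall x, K x -> f x <= 0 \/ \forall y \near x, K y) ->
  forall x, K x -> f x <= 0.
Proof.
move=> m0 oO KO cK hf bd x0 Kx0; rewrite leNgt; apply/negP => fx0.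
have Hf := harmonic_on_data hf.
have [B B0 KB] : exists2 B : R, 0 < B & forall x, K x -> enorm x ^+ 2 <= B.
  have cn : {within K, continuous (@enorm R m)}.
    by apply: continuous_subspaceT; exact: enorm_continuous.
  have [b bK bmax] := EVT_max_rV (ex_intro _ _ Kx0) cK cn.
  exists (enorm b ^+ 2 + 1); first by rewrite ltr_wpDl// sqr_ge0.
  move=> x Kx; rewrite ler_wpDr// lerXn2r ?nnegrE ?enorm_ge0//.
  by apply: bmax; rewrite inE.
(* So small that the perturbation changes [f] by at most [f x0 / 2] on [K]: the maximum point of [g]
   still has [f > 0], hence is interior to [K]. *)
pose e := f x0 / (2 * B).
have e0 : 0 < e by rewrite divr_gt0// mulr_gt0.
pose g x := f x + e * enorm x ^+ 2.
have cg : {within K, continuous g}.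
  apply: continuous_in_subspaceT => x; rewrite inE => Kx.
  have [cf _ _ _] := Hf x (KO x Kx).
  apply: (@continuousD _ _ _ f) => //.
  apply: (@continuousM _ _ (fun=> e)); first exact: cst_continuous.
  by apply: (@continuousM _ _ (@enorm R m) (@enorm R m)); exact: enorm_continuous.
have [c cK' cmax] := EVT_max_rV (ex_intro _ _ Kx0) cK cg.
have Kc : K c by rewrite inE in cK'.
have fc : 0 < f c.
  have := cmax x0; rewrite inE => /(_ Kx0); rewrite /g.
  have : e * enorm c ^+ 2 <= e * B by rewrite ler_pM2l// KB.
  have -> : e * B = f x0 / 2 by rewrite /e; field; rewrite gt_eqF.
  have : 0 <= e * enorm x0 ^+ 2 by rewrite mulr_ge0 ?sqr_ge0 ?(ltW e0).
  by lra.
have [|nK] := bd c Kc; first by lra.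
have Kd : \forall y \near c, K y /\ O y.
  by apply: (@filterI _ _ (nbhs_filter c)) => //; move: oO; rewrite openE; apply; apply: KO.
have [d d0 dK] := near_enorm Kd.
have bound i : partial i (partial i f) c <= - (2 * e).
  pose v : 'rV[R]_m := delta_mx ord0 i.
  have dv (h : R) : enorm (c - (c + h *: v)) = `|h|.
    by rewrite opprD addNKr enormN enormZ enorm_delta mulr1.
  have [_ _ /(_ i i)[d2 _] _] := Hf c (KO c Kc).
  have sd := @second_difference_le R (fun h => f (c + h *: v))
     (fun h => partial i f (c + h *: v)) d (partial i (partial i f) c) (2 * e) d0.
  apply: sd.
  - move=> h hd; apply: is_derive_slice.
    have [_ Oh] := dK (c + h *: v) ltac:(by rewrite dv).
    by have [_ /(_ i)[]] := Hf _ Oh.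
  - by apply: is_derive_slice; rewrite scale0r addr0.
  - move=> h /andP[h0 hd].
    have [K1 _] := dK (c + h *: v) ltac:(by rewrite dv ger0_norm).
    have [K2 _] := dK (c + (- h) *: v) ltac:(by rewrite dv normrN ger0_norm).
    have := cmax _ (mem_set K1); have := cmax _ (mem_set K2).
    by rewrite /g scale0r addr0 !sqr_enorm_shift; lra.
have [_ _ _ lap] := Hf c (KO c Kc).
have : \sum_(i < m) partial i (partial i f) c <= \sum_(i < m) - (2 * e).
  by apply: ler_sum => i _; exact: bound.
rewrite lap sumr_const card_ord leNgt => /negP; apply.
by rewrite pmulrn_llt0// oppr_lt0 mulr_gt0.
Qed.

(** * The Poisson kernel *)

Lemma is_derive_of_slice (R : realType) (V : normedModType R) (f : V -> R)
    (x v : V) (d : R) :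
  is_derive (0 : R) 1 (fun t : R => f (x + t *: v)) d -> is_derive x v f d.
Proof.
move=> [df dE].
have E : (fun k : R => k^-1 *: (f (x + (k *: (1 : R) + 0 : R) *: v) - f (x + (0 : R) *: v))) =
         (fun k : R => k^-1 *: (f (k *: v + x) - f x)).
  apply/funext => k; congr (_ *: (f _ - f _)); last by rewrite scale0r addr0.
  by rewrite addr0 [k *: 1]mulr1 addrC.
move: df dE; rewrite /derivable /derive /= E => df dE.
by apply: DeriveDef.
Qed.

Lemma scale_mulE (R : realType) (a b : R) : a *: b = a * b.
Proof. by []. Qed.

Section poisson_kernel.
Variables (R : realType) (m : nat) (z : 'rV[R]_m).

Definition invdist (x : 'rV[R]_m) : R := (enorm (x - z))^-1.

(* For [z] inside the unit ball this is, up to a constant, the Poisson kernel of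
   the ball of radius [enorm z], harmonic off [z] and nonpositive outside that ball. *)
Definition poisson (x : 'rV[R]_m) : R :=
  (enorm z ^+ 2 - enorm x ^+ 2) * invdist x ^+ m.

Lemma enorm_sub_gt0 (x y : 'rV[R]_m) : x != y -> 0 < enorm (x - y).
Proof.
move=> xy; rewrite lt_def enorm_ge0 andbT; apply: contraNneq xy => /enorm_eq0/eqP.
by rewrite subr_eq0.
Qed.

Lemma is_derive_coord (x : 'rV[R]_m) (i k : 'I_m) :
  is_derive x (delta_mx ord0 i) (fun y : 'rV[R]_m => y ord0 k) (k == i)%:R.
Proof.
apply: is_derive_of_slice.
have -> : (fun t : R => (x + t *: delta_mx ord0 i) ord0 k) =
  (fun=> x ord0 k) \+ ((k == i)%:R : R) \*: id.
  by apply/funext => t; rewrite !mxE eqxx/= mulrC.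
by apply: is_derive_eq; rewrite add0r [LHS]mulr1.
Qed.

Lemma is_derive_sqr_enorm (x : 'rV[R]_m) (i : 'I_m) :
  is_derive x (delta_mx ord0 i) (fun y : 'rV[R]_m => enorm y ^+ 2) (2 * x ord0 i).
Proof.
apply: is_derive_of_slice.
have -> : (fun t : R => enorm (x + t *: delta_mx ord0 i) ^+ 2) =
  ((fun=> enorm x ^+ 2) \+ (2 * x ord0 i) \*: id) \+ id ^+ 2.
  by apply/funext => t; rewrite sqr_enorm_shift/=; congr (_ + _ + _); rewrite mulrAC.
apply: is_derive_eq.
by rewrite add0r /= expr1 mulr0 scale0r addr0 [LHS]mulr1.
Qed.

Lemma is_derive_dist (x : 'rV[R]_m) (i : 'I_m) : x != z ->
  is_derive x (delta_mx ord0 i) (fun y => enorm (y - z))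
    ((x ord0 i - z ord0 i) / enorm (x - z)).
Proof.
move=> xz; apply: is_derive_of_slice.
have n0 := enorm_sub_gt0 xz.
have -> : (fun t : R => enorm (x + t *: delta_mx ord0 i - z)) =
  Num.sqrt \o (fun t : R => enorm ((x - z) + t *: delta_mx ord0 i) ^+ 2).
  apply/funext => t /=; rewrite sqrtr_sqr ger0_norm ?enorm_ge0//.
  by rewrite addrAC.
have d1 : is_derive (0 : R) 1 (fun t : R => enorm (x - z + t *: delta_mx ord0 i) ^+ 2)
    (2 * (x - z) ord0 i).
  apply: (@is_derive_slice _ _ (fun y => enorm y ^+ 2)).
  rewrite scale0r addr0; exact: is_derive_sqr_enorm.
have q0 : 0 < enorm (x - z + 0 *: delta_mx ord0 i) ^+ 2.
  by rewrite scale0r addr0 exprn_gt0.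
have d2 := is_derive1_sqrt q0.
have d3 := @is_derive1_comp R _ (fun t : R => enorm (x - z + t *: delta_mx ord0 i) ^+ 2) 0 _ _
  d2 d1.
apply: (is_derive_eq d3).
rewrite scale0r addr0 sqrtr_sqr ger0_norm ?enorm_ge0// !mxE.
by field; rewrite gt_eqF.
Qed.

Lemma is_derive_invdist (x : 'rV[R]_m) (i : 'I_m) : x != z ->
  is_derive x (delta_mx ord0 i) invdist
    (- (x ord0 i - z ord0 i) * invdist x ^+ 3).
Proof.
move=> xz; have [d1 d1E] := is_derive_dist i xz.
have n0 := enorm_sub_gt0 xz.
apply: DeriveDef; first by apply: derivableV => //; rewrite gt_eqF.
rewrite /invdist deriveV ?gt_eqF// d1E /invdist.
by rewrite [LHS]/GRing.scale/=; field; rewrite gt_eqF.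
Qed.

Let X (i : 'I_m) (x : 'rV[R]_m) : R := x ord0 i.
Let Y (i : 'I_m) (x : 'rV[R]_m) : R := x ord0 i - z ord0 i.
Let A (x : 'rV[R]_m) : R := enorm z ^+ 2 - enorm x ^+ 2.

Definition dpoisson (i : 'I_m) : 'rV[R]_m -> R := fun x =>
  - 2 * X i x * invdist x ^+ m - m%:R * (A x * Y i x * invdist x ^+ m.+2).

Definition d2poisson (i j : 'I_m) : 'rV[R]_m -> R := fun x =>
  - 2 * (i == j)%:R * invdist x ^+ m
  + 2 * m%:R * (X i x * Y j x + X j x * Y i x) * invdist x ^+ m.+2
  - m%:R * (A x * (i == j)%:R) * invdist x ^+ m.+2
  + m%:R * (m%:R + 2) * (A x * Y i x * Y j x) * invdist x ^+ m.+4.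

Let dX i j x : is_derive x (delta_mx ord0 j) (X i) (i == j)%:R.
Proof. exact: is_derive_coord. Qed.

Let dY i j x : is_derive x (delta_mx ord0 j) (Y i) (i == j)%:R.
Proof.
have d := dX i j x.
rewrite (_ : Y i = X i - cst (z ord0 i)); first by apply: is_derive_eq; rewrite subr0.
by [].
Qed.

Let dA i x : is_derive x (delta_mx ord0 i) A (- (2 * x ord0 i)).
Proof.
have d := is_derive_sqr_enorm x i.
rewrite (_ : A = cst (enorm z ^+ 2) - (fun y => enorm y ^+ 2)); last by [].
by apply: is_derive_eq; rewrite add0r.
Qed.

Let powE k i x : x != z ->
  is_derive x (delta_mx ord0 i) (invdist ^+ k)
    (- (k%:R * Y i x * invdist x ^+ k.+2)).
Proof.
move=> xz; have dE := is_derive_invdist i xz; apply: is_derive_eq.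
rewrite scale_mulE /Y; case: k => [|k].
by rewrite !mul0r oppr0.
by rewrite /= -mulr_natl !exprS; ring.
Qed.

Lemma is_derive_poisson (x : 'rV[R]_m) (i : 'I_m) : x != z ->
  is_derive x (delta_mx ord0 i) poisson (dpoisson i x).
Proof.
move=> xz; have dE := powE m i xz; have dAx := dA i x.
rewrite (_ : poisson = A * invdist ^+ m); last first.
  by apply/funext => y; rewrite mulrfctE exprfctE.
apply: is_derive_eq; rewrite /dpoisson exprfctE !scale_mulE /X.
by ring.
Qed.

Lemma is_derive_dpoisson (x : 'rV[R]_m) (i j : 'I_m) : x != z ->
  is_derive x (delta_mx ord0 j) (dpoisson i) (d2poisson i j x).
Proof.
move=> xz; have dE := powE m j xz; have dE2 := powE m.+2 j xz.
have dAx := dA j x; have dXx := dX i j x; have dYx := dY i j x.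
rewrite (_ : dpoisson i = (-2) *: (X i * invdist ^+ m) -
    m%:R *: (A * Y i * invdist ^+ m.+2)); last first.
  apply/funext => y; rewrite /dpoisson !fctE !scale_mulE.
  by rewrite !mulrA.
apply: is_derive_eq; rewrite /d2poisson !fctE !scale_mulE /X.
have -> : m.+2%:R = m%:R + 2 :> R by rewrite -addn2 natrD.
by ring.
Qed.

(** With [Y = x - z], one has [|z|^2 - |x|^2 = |Y|^2 - 2 x.Y] and [|Y|^2 * invdist ^ 2 = 1].
    Everything becomes [invdist ^ (m + 2)] times a combination of [|Y|^2] and [x.Y], and the
    coefficients cancel. *)
Lemma lap_poisson (x : 'rV[R]_m) : x != z -> \sum_i d2poisson i i x = 0.
Proof.
move=> xz; have n0 := enorm_sub_gt0 xz.
have E2 : (\sum_i Y i x ^+ 2) * invdist x ^+ 2 = 1.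
  have -> : \sum_i Y i x ^+ 2 = enorm (x - z) ^+ 2.
    by rewrite sqr_enorm; apply: eq_bigr => i _; rewrite !mxE.
  by rewrite /invdist -exprMn mulfV ?expr1n// gt_eqF.
transitivity (\sum_i (- 2 * invdist x ^+ m
  + 4 * m%:R * invdist x ^+ m.+2 * (X i x * Y i x)
  - m%:R * A x * invdist x ^+ m.+2
  + m%:R * (m%:R + 2) * A x * invdist x ^+ m.+4 * Y i x ^+ 2)).
  by apply: eq_bigr => i _; rewrite /d2poisson eqxx/=; ring.
have sc (a : R) : \sum_(i < m) a = m%:R * a.
  by rewrite sumr_const card_ord mulr_natl.
rewrite !big_split/= !sc -!big_distrr/=.
have E4 k : invdist x ^+ k = invdist x ^+ k.+2 * \sum_i Y i x ^+ 2.
  by rewrite -addn2 exprD -mulrA [_ * \sum_i _]mulrC E2 mulr1.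
rewrite (E4 m) -[_ * _ ^+ m.+4 * _]mulrA -(E4 m.+2).
have -> : A x = \sum_i Y i x ^+ 2 - 2 * \sum_i X i x * Y i x.
  rewrite /A !sqr_enorm -sumrB big_distrr/= -sumrB.
  by apply: eq_bigr => i _; rewrite /X /Y; ring.
by ring.
Qed.

End poisson_kernel.

(** * Continuity at a point, uniform in the pole *)

Section uniform_continuity_at.
Variables (R : realType) (m : nat) (Z : set 'rV[R]_m) (x : 'rV[R]_m).
Implicit Types F G : 'rV[R]_m -> 'rV[R]_m -> R.

(** The continuity that survives a bounded linear functional in the pole [z]. Boundedness at [x] is
    included so that products stay in the class. With one pole it reduces to ordinary continuity. *)
Definition ucont F : Prop :=
  (exists M : R, forall z, Z z -> `|F z x| <= M) /\
  (forall e : R, 0 < e -> \forall y \near x, forall z, Z z -> `|F z y - F z x| <= e).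

Lemma ucontD F G : ucont F -> ucont G -> ucont (fun z y => F z y + G z y).
Proof.
move=> [[M FM] cF] [[N GN] cG]; split.
  exists (M + N) => z Zz; apply: (le_trans (ler_normD _ _)).
  by apply: lerD; [exact: FM|exact: GN].
move=> e e0; have e20 : 0 < e / 2 by rewrite divr_gt0.
have H := @filterI _ _ (nbhs_filter x) _ _ (cF _ e20) (cG _ e20).
apply: (@filterS _ _ (nbhs_filter x) _ _ _ H) => y [hF hG] z Zz.
rewrite opprD addrACA (le_trans (ler_normD _ _))//.
have := hF z Zz; have := hG z Zz; lra.
Qed.

Lemma ucont_cst (c : 'rV[R]_m -> R) (M : R) : (forall z, Z z -> `|c z| <= M) ->
  ucont (fun z _ => c z).
Proof.
move=> cM; split; first by exists M.
move=> e e0; apply: (@filterS _ _ (nbhs_filter x) setT) => [y _ z Zz|].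
  by rewrite subrr normr0 ltW.
exact: (@filterT _ _ (nbhs_filter x)).
Qed.

Lemma ucontM F G : ucont F -> ucont G -> ucont (fun z y => F z y * G z y).
Proof.
move=> [[M FM] cF] [[N GN] cG]; split.
  exists (M * N) => z Zz; rewrite normrM.
  by apply: ler_pM => //; [exact: FM|exact: GN].
move=> e e0.
pose B : R := `|M| + `|N| + 1.
have B0 : 0 < B by rewrite ltr_wpDl// addr_ge0.
pose d := Num.min 1 (e / B).
have d0 : 0 < d by rewrite lt_min ltr01 divr_gt0.
have H := @filterI _ _ (nbhs_filter x) _ _ (cF _ d0) (cG _ d0).
apply: (@filterS _ _ (nbhs_filter x) _ _ _ H) => y [hF hG] z Zz.
have -> : F z y * G z y - F z x * G z x =
  (F z y - F z x) * (G z y - G z x) + F z x * (G z y - G z x)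
   + G z x * (F z y - F z x) by ring.
have h1 := hF z Zz; have h2 := hG z Zz.
have h3 : `|F z x| <= `|M| := le_trans (FM z Zz) (ler_norm M).
have h4 : `|G z x| <= `|N| := le_trans (GN z Zz) (ler_norm N).
have dB : d * B <= e by rewrite -ler_pdivlMr// ge_min lexx orbT.
apply: le_trans dB; rewrite (le_trans (ler_normD _ _))//.
have -> : d * B = d + d * `|M| + d * `|N| by rewrite /B; ring.
apply: lerD; last by rewrite normrM mulrC ler_pM.
rewrite (le_trans (ler_normD _ _))//; apply: lerD.
  rewrite normrM -[leRHS]mulr1 ler_pM//.
  by apply: (le_trans h2); rewrite ge_min lexx.
by rewrite normrM mulrC ler_pM.
Qed.

Lemma ucontX F n : ucont F -> ucont (fun z y => F z y ^+ n).
Proof.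
move=> cF; elim: n => [|n IH].
  by apply: (@ucont_cst _ 1) => z _; rewrite normr1.
rewrite (_ : (fun _ _ => _) = fun z y => F z y * F z y ^+ n); first exact: ucontM.
by apply/funext => z; apply/funext => y; rewrite exprS.
Qed.

Lemma ucont_coord i : ucont (fun _ y => y ord0 i).
Proof.
split; first by exists `|x ord0 i|.
move=> e e0; apply: (@filterS _ _ (nbhs_filter x) _ _ _ (enorm_ball_nbhs x e0)).
move=> y xy z _; apply: le_trans (ltW xy).
by rewrite (le_trans _ (coord_le_enorm _ i))// !mxE distrC.
Qed.

Lemma ucont_sqr_enorm : ucont (fun _ y => enorm y ^+ 2).
Proof.
apply: ucontX; split; first by exists (enorm x) => z _; rewrite ger0_norm ?enorm_ge0.
move=> e e0; apply: (@filterS _ _ (nbhs_filter x) _ _ _ (enorm_ball_nbhs x e0)).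
by move=> y xy z _; rewrite distrC (le_trans (enorm_dist _ _))// ltW.
Qed.

Lemma ucont_invdist (d : R) : 0 < d -> (forall z, Z z -> d <= enorm (x - z)) ->
  ucont (@invdist R m).
Proof.
move=> d0 dZ; have xz0 z : Z z -> 0 < enorm (x - z) by move/dZ; exact: lt_le_trans.
split.
  exists d^-1 => z Zz; rewrite /invdist ger0_norm ?invr_ge0 ?enorm_ge0//.
  by rewrite lef_pV2 ?posrE ?dZ ?xz0.
(* The first bound keeps [y] at distance at least [d / 2] from the poles; the second controls
   [|1/a - 1/b| = |a - b| / (a b)] with [a >= d] and [b >= d / 2]. *)
move=> e e0; pose r := Num.min (d / 2) (e * (d * (d / 2))).
have r0 : 0 < r by rewrite lt_min !mulr_gt0.
apply: (@filterS _ _ (nbhs_filter x) _ _ _ (enorm_ball_nbhs x r0)) => y xy z Zz.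
have xyd : enorm (x - y) < d / 2 by apply: (lt_le_trans xy); rewrite ge_min lexx.
have yz : d / 2 <= enorm (y - z).
  by have := enorm_triangleB x y z; have := dZ z Zz; lra.
have yz0 : 0 < enorm (y - z) by apply: lt_le_trans yz; rewrite divr_gt0.
have -> : invdist z y - invdist z x =
    (enorm (x - z) - enorm (y - z)) / (enorm (x - z) * enorm (y - z)).
  by rewrite /invdist; field; rewrite !gt_eqF// xz0.
have ab0 : 0 < enorm (x - z) * enorm (y - z) by rewrite mulr_gt0// xz0.
rewrite normrM normfV (gtr0_norm ab0) ler_pdivrMr//.
apply: (le_trans (enorm_dist _ _)); rewrite opprB addrA subrK.
apply: (le_trans (ltW xy)); apply: (@le_trans _ _ (e * (d * (d / 2)))).
  by rewrite ge_min lexx orbT.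
by rewrite ler_pM2l// ler_pM ?divr_ge0 ?(ltW d0)// dZ.
Qed.

Variable B : R.
Hypothesis ZB : forall z, Z z -> enorm z <= B.
Variable d : R.
Hypotheses (d0 : 0 < d) (dZ : forall z, Z z -> d <= enorm (x - z)).

Let uA : ucont (fun z y => enorm z ^+ 2 - enorm y ^+ 2).
Proof.
apply: ucontD.
  apply: (@ucont_cst _ (B ^+ 2)) => z Zz; rewrite ger0_norm ?sqr_ge0//.
  by rewrite lerXn2r ?nnegrE ?enorm_ge0 ?ZB// (le_trans (enorm_ge0 z))// ZB.
rewrite (_ : (fun _ _ => _) = fun z y => (-1) * enorm y ^+ 2).
  apply: ucontM ucont_sqr_enorm; exact: (@ucont_cst _ `|-1|).
by apply/funext => z; apply/funext => y; rewrite mulN1r.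
Qed.

Let uY i : ucont (fun z y => y ord0 i - z ord0 i).
Proof.
apply: ucontD; first exact: ucont_coord.
apply: (@ucont_cst _ B) => z Zz.
by rewrite normrN (le_trans (coord_le_enorm _ _))// ZB.
Qed.

Let uc (c : R) : ucont (fun _ _ => c).
Proof. exact: (@ucont_cst _ `|c|). Qed.

Let uE n := ucontX n (ucont_invdist d0 dZ).

Lemma ucont_poisson : ucont (@poisson R m).
Proof. exact: ucontM uA (uE m). Qed.

Lemma ucont_dpoisson i : ucont (fun z => @dpoisson R m z i).
Proof.
rewrite (_ : (fun _ => _) = fun z y : 'rV[R]_m => (-2) * y ord0 i * invdist z y ^+ m +
   - m%:R * ((enorm z ^+ 2 - enorm y ^+ 2) * (y ord0 i - z ord0 i) * invdist z y ^+ m.+2)).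
  apply: ucontD; apply: ucontM => //.
  - by apply: ucontM => //; exact: ucont_coord.
  - by apply: ucontM => //; exact: ucontM.
by apply/funext => z; apply/funext => y; rewrite /dpoisson !mulNr.
Qed.

Lemma ucont_d2poisson i j : ucont (fun z => @d2poisson R m z i j).
Proof.
rewrite (_ : (fun _ => _) = fun z y : 'rV[R]_m => (-2) * (i == j)%:R * invdist z y ^+ m
  + 2 * m%:R * (y ord0 i * (y ord0 j - z ord0 j) + y ord0 j * (y ord0 i - z ord0 i))
     * invdist z y ^+ m.+2
  + (- m%:R) * ((enorm z ^+ 2 - enorm y ^+ 2) * (i == j)%:R) * invdist z y ^+ m.+2
  + m%:R * (m%:R + 2) * ((enorm z ^+ 2 - enorm y ^+ 2) * (y ord0 i - z ord0 i)
     * (y ord0 j - z ord0 j)) * invdist z y ^+ m.+4).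
  have uX k := ucont_coord k.
  by do ![exact: uc | exact: uX | exact: uY | exact: uA | exact: uE
         | apply: ucontD | apply: ucontM].
by apply/funext => z; apply/funext => y; rewrite /d2poisson !mulNr.
Qed.

End uniform_continuity_at.

Lemma ucont_set1 (R : realType) (m : nat) (F : 'rV[R]_m -> 'rV[R]_m -> R)
    (z x : 'rV[R]_m) : ucont [set z] x F -> {for x, continuous (F z)}.
Proof.
move=> [_ cF]; apply/(@cvgrPdist_le _ _ _ _ (nbhs_filter x)) => e e0.
apply: (@filterS _ _ (nbhs_filter x) _ _ _ (cF e e0)) => y /(_ z erefl).
by rewrite distrC.
Qed.

Lemma harmonic_poisson (R : realType) (m : nat) (z : 'rV[R]_m) :
  harmonic_on [set x | x != z] (poisson z).
Proof.
have oz : open [set x : 'rV[R]_m | x != z].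
  rewrite openE => x /= xz; rewrite /interior.
  have n0 := enorm_sub_gt0 xz.
  apply: (@filterS _ _ (nbhs_filter x) _ _ _ (enorm_ball_nbhs x n0)) => y /= xy.
  by apply: contraTneq xy => ->; rewrite ltxx.
apply: (@harmonic_data_on _ _ _ oz _ (dpoisson z) (d2poisson z)) => x /= xz.
have n0 := enorm_sub_gt0 xz.
have H1 y : [set z] y -> enorm y <= enorm z by move=> ->.
have H2 y : [set z] y -> enorm (x - z) <= enorm (x - y) by move=> ->.
split.
- exact: ucont_set1 (ucont_poisson H1 n0 H2).
- move=> i; split; first exact: is_derive_poisson.
  exact: ucont_set1 (ucont_dpoisson H1 n0 H2 i).
- move=> i j; split; first exact: is_derive_dpoisson.
  exact: ucont_set1 (ucont_d2poisson H1 n0 H2 i j).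
- exact: lap_poisson.
Qed.

(** * Harnack's inequality *)

(** Induction step for deriving all directional derivatives from continuous partial ones: the
    increment along [h * c *: w] is [h * c] times [g] at an intermediate point by the mean value
    theorem, and [g] is continuous at [x]. *)
Lemma is_derive_addZ (R : realType) (V : normedModType R) (f g : V -> R)
    (x v w : V) (c dv : R) : is_derive x v f dv ->
  (\forall y \near x, is_derive y w f (g y)) -> {for x, continuous g} ->
  is_derive x (v + c *: w) f (dv + c * g x).
Proof.
move=> [df dfE] dg cg.
have A : (fun h : R => h^-1 *: (f (h *: v + x) - f x)) @ 0^' --> dv.
  by rewrite -dfE; exact: df.
have B : (fun h : R => h^-1 *: (f (h *: (v + c *: w) + x) - f (h *: v + x)))
    @ 0^' --> c * g x.
  apply/cvgrPdist_le => e e0.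
  have e1 : 0 < e / (`|c| + 1) by rewrite divr_gt0// ltr_wpDl.
  have /nbhs_ballP[r /= r0 Hr] := @filterI _ _ (nbhs_filter x) _ _ dg
     (proj1 (@cvgrPdist_le _ _ _ _ (nbhs_filter x) _ _) cg _ e1).
  pose S := `|v| + `|c| * `|w| + 1.
  have S0 : 0 < S by rewrite ltr_wpDl// addr_ge0// mulr_ge0.
  apply/nbhs_ballP; exists (r / S); first exact: divr_gt0.
  move=> h; rewrite /ball/= sub0r normrN => hS h0.
  pose phi (t : R) := f (h *: v + x + (t * (h * c)) *: w).
  have near_t (t : R) : 0 <= t <= 1 -> is_derive (h *: v + x + (t * (h * c)) *: w) w f
      (g (h *: v + x + (t * (h * c)) *: w)) /\
      `|g x - g (h *: v + x + (t * (h * c)) *: w)| <= e / (`|c| + 1).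
    move=> /andP[t0 t1]; apply: Hr; rewrite -ball_normE/=.
    rewrite opprD opprD [- _ + - x]addrC !addrA subrr add0r -opprD normrN.

    apply: le_lt_trans (ler_normD _ _) _; rewrite 2!normrZ !normrM (ger0_norm t0).
    apply: (@le_lt_trans _ _ (`|h| * S)); last by rewrite -ltr_pdivlMr.
    have tw : t * (`|h| * `|c|) * `|w| <= `|h| * `|c| * `|w|.
      by rewrite -mulrA ler_piMl// !mulr_ge0.
    by have := normr_ge0 h; rewrite /S !mulrDr mulr1 [`|h| * (_ * _)]mulrA; lra.
  have dphi (t : R) : 0 <= t <= 1 -> is_derive t 1 phi
      (g (h *: v + x + (t * (h * c)) *: w) * (h * c)).
    move=> t01; have [d1 _] := near_t t t01.
    have d2 := is_derive_slice d1.
    have d3 : is_derive t 1 (fun s : R => s * (h * c)) (h * c).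
      rewrite (_ : (fun _ => _) = (h * c) \*: id); last first.
        by apply/funext => s; rewrite /= mulrC.
      by apply: is_derive_eq; rewrite [LHS]mulr1.
    exact: (@is_derive1_comp R _ (fun s : R => s * (h * c)) t _ _ d2 d3).
  have [||t t01 E] := @MVT R phi
      (fun t => g (h *: v + x + (t * (h * c)) *: w) * (h * c)) 0 1 ltr01.
  - by move=> t; rewrite in_itv/= => /andP[t0 t1]; apply: dphi; rewrite !ltW.
  - apply: derivable_within_continuous => t; rewrite in_itv/= => t01.
    by have [] := dphi t t01.
  have -> : f (h *: (v + c *: w) + x) - f (h *: v + x) = phi 1 - phi 0.
    rewrite /phi mul0r scale0r addr0 mul1r scalerDr scalerA.
    by rewrite addrAC.
  rewrite E subr0 mulr1 /GRing.scale/=.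
  have {}t01 : 0 <= t <= 1 by move: t01; rewrite in_itv/= => /andP[? ?]; rewrite !ltW.
  have [_ gt] := near_t t t01.
  rewrite mulrCA mulKf// [X in `|_ - X|]mulrC -mulrBr normrM.
  apply: (@le_trans _ _ (`|c| * (e / (`|c| + 1)))); first by rewrite ler_wpM2l.
  by rewrite mulrCA ler_piMr ?(ltW e0)// ler_pdivrMr ?mul1r ?lerDl// ltr_wpDl.
have E : (fun h : R => h^-1 *: (f (h *: (v + c *: w) + x) - f x)) =
   (fun h : R => h^-1 *: (f (h *: v + x) - f x)) \+
   (fun h : R => h^-1 *: (f (h *: (v + c *: w) + x) - f (h *: v + x))).
  by apply/funext => h; rewrite /= -scalerDr; congr (_ *: _); rewrite [RHS]addrC addrA subrK.
have C : (fun h : R => h^-1 *: (f (h *: (v + c *: w) + x) - f x)) @ 0^'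
   --> dv + c * g x by rewrite E; exact: cvgD.
by apply: DeriveDef; [exact: cvgP C | exact: cvg_lim C].
Qed.

Lemma is_derive_dir (R : realType) (m : nat) (O : set 'rV[R]_m)
    (f : 'rV[R]_m -> R) (f1 : 'I_m -> 'rV[R]_m -> R) : open O ->
  (forall i x, O x -> is_derive x (delta_mx ord0 i) f (f1 i x) /\
    {for x, continuous (f1 i)}) ->
  forall x v : 'rV[R]_m, O x ->
  is_derive x v f (\sum_i v ord0 i * f1 i x).
Proof.
move=> oO H x v Ox; rewrite [X in is_derive _ X](row_sum_delta v).
elim: (index_enum _) => [|i s IH]; first by rewrite !big_nil; exact: is_derive0.
rewrite !big_cons addrC [X in is_derive _ _ _ X]addrC.
apply: is_derive_addZ => //; last by have [] := H i x Ox.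
have nO : \forall y \near x, O y by move: oO; rewrite openE; exact.
apply: (@filterS _ _ (nbhs_filter x) _ _ _ nO) => y Oy.
by have [] := H i y Oy.
Qed.

(** Only [x] is confined to [K]. Halving the local radius leaves room for the triangle inequality,
    and compactness as near covering makes the choice of [d] uniform. *)
Lemma heine_cantor (R : realType) (T : pseudoMetricType R) (K : set T)
    (f : T -> R) : compact K -> (forall x, K x -> {for x, continuous f}) ->
  forall e : R, 0 < e -> exists2 d : R, 0 < d &
    forall x y, K x -> ball x d y -> `|f x - f y| <= e.
Proof.
move=> cK cf e e0.
pose P (d : R) (x : T) := forall y, ball x d y -> `|f x - f y| <= e.
have : \forall d \near (0 : R)^'+, K `<=` P d.
  move: cK => /compact_near_coveringP; apply => x Kx.
  have e20 : 0 < e / 2 by rewrite divr_gt0.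
  have /nbhs_ballP[r /= r0 Hr] :=
    proj1 (@cvgrPdist_le _ _ _ _ (nbhs_filter x) _ _) (cf x Kx) _ e20.
  have r20 : 0 < r / 2 by rewrite divr_gt0.
  exists (ball x (r / 2), [set d : R | d < r / 2]).
    split; first exact: nbhsx_ballx.
    exact: nbhs_right_lt.
  move=> [x' d]/= [xx' dr] y x'y.
  have h1 : ball x r x' by apply: (@le_ball _ _ _ (r / 2)) xx'; lra.
  have h2 : ball x r y.
    rewrite [r]splitr; apply: ball_triangle xx' _.
    by apply: (@le_ball _ _ _ d) x'y; exact: ltW.
  have := Hr _ h1; have := Hr _ h2.
  rewrite !ler_norml; lra.
move=> near_P; have near0 : \forall d \near (0 : R)^'+, 0 < d by exact: nbhs_right_gt.
have [d [d0 dP]] := filter_ex (filterI near0 near_P).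
by exists d => // x y Kx xy; exact: dP.
Qed.

(** * The weight and its Riemann sums on a grid *)

Section bump.
Variable R : realType.

Lemma is_derive_quadratic (f : R -> R) (x d C : R) :
  (forall h, `|f (x + h) - f x - d * h| <= C * h ^+ 2) -> is_derive x 1 f d.
Proof.
move=> H.
have C0 : 0 <= C.
  by have := H 1; rewrite expr1n !mulr1; apply: le_trans.
have L : (fun h : R => h^-1 *: (f (h *: 1 + x) - f x)) @ 0^' --> d.
  apply/cvgrPdist_le => e e0; apply/nbhs_ballP.
  exists (e / (C + 1)) => /=; first by rewrite divr_gt0// ltr_wpDl.
  move=> h; rewrite /ball/= sub0r normrN => he h0.
  have -> : d - h^-1 *: (f (h *: 1 + x) - f x) = - h^-1 * (f (x + h) - f x - d * h).
    rewrite [h *: 1]mulr1 [h + x]addrC /GRing.scale/=; field => //.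
  rewrite normrM normrN normfV mulrC ler_pdivrMr ?normr_gt0//.
  apply: (le_trans (H h)); rewrite -real_normK ?num_real// expr2 mulrA.
  rewrite ler_wpM2r//; apply: (@le_trans _ _ (C * (e / (C + 1)))).
    by rewrite ler_wpM2l// ltW.
  by rewrite mulrCA ler_piMr ?(ltW e0)// ler_pdivrMr ?mul1r ?lerDl// ltr_wpDl.
by apply: DeriveDef; [exact: cvgP L | exact: cvg_lim L].
Qed.

(** Squaring removes the kink of the positive part: the linearization error is at most [h ^ 2].
    Hence the square of [bump] has partial derivatives everywhere. *)
Lemma is_derive_sqr_max0 (x : R) :
  is_derive x 1 (fun q : R => Num.max 0 q ^+ 2) (2 * Num.max 0 x).
Proof.
apply: (@is_derive_quadratic _ _ _ 1) => h; rewrite mul1r.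
rewrite /Order.max/= ler_norml; case: ifPn => [x0|]; case: ifPn => [xh|]; rewrite -?leNgt => *;
  apply/andP; split; nra.
Qed.

End bump.

Section grid.
Variables (R : realType) (m : nat).
Implicit Types x y b : 'rV[R]_m.

Definition bump x : R := Num.max 0 (1 - enorm x ^+ 2).

Lemma bump_ge0 x : 0 <= bump x.
Proof. by rewrite le_max lexx. Qed.

Lemma bump_le1 x : bump x <= 1.
Proof. by rewrite ge_max ler01/= gerBl sqr_ge0. Qed.

Lemma bump_eq0 x : 1 <= enorm x -> bump x = 0.
Proof.
by move=> x1; apply/max_idPl; rewrite subr_le0 expr_ge1 ?enorm_ge0.
Qed.

Lemma bump_continuous : continuous bump.
Proof.
move=> x; apply: (@continuous_max _ _ (fun=> 0) (fun x => 1 - enorm x ^+ 2)).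
  exact: cst_continuous.
apply: continuousB; first exact: cst_continuous.
by apply: (@continuousM _ _ (@enorm R m) (@enorm R m)); exact: enorm_continuous.
Qed.

Lemma is_derive_sqr_bump x (i : 'I_m) :
  is_derive x (delta_mx ord0 i) (fun y => bump y ^+ 2)
    (- 4 * bump x * x ord0 i).
Proof.
apply: is_derive_of_slice.
have d1 : is_derive (0 : R) 1
    (fun t : R => 1 - enorm (x + t *: delta_mx ord0 i) ^+ 2) (- (2 * x ord0 i)).
  have d0 : is_derive (0 : R) 1
      (fun t : R => enorm (x + t *: delta_mx ord0 i) ^+ 2) (2 * x ord0 i).
    apply: (@is_derive_slice _ _ (fun y => enorm y ^+ 2)).
    by rewrite scale0r addr0; exact: is_derive_sqr_enorm.
  rewrite (_ : (fun _ => _) = cst 1 -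
    (fun t : R => enorm (x + t *: delta_mx ord0 i) ^+ 2)); last by [].
  by apply: is_derive_eq; rewrite add0r.
have d2 := is_derive_sqr_max0 (1 - enorm (x + 0 *: delta_mx ord0 i) ^+ 2).
have d3 := @is_derive1_comp R _
  (fun t : R => 1 - enorm (x + t *: delta_mx ord0 i) ^+ 2) 0 _ _ d2 d1.
apply: (is_derive_eq d3).
by rewrite scale0r addr0 /bump; ring.
Qed.

Definition gpt (n : nat) b (eta : R) (k : {ffun 'I_m -> 'I_n}) : 'rV[R]_m :=
  \row_i (b ord0 i + (k i)%:R * eta).

(** The shift is a cyclic permutation of the nodes in direction [i], except that the last layer
    leaves the grid where the first should reappear. Both layers have [i]-th coordinate of modulus
    at least 1, where [G] vanishes. *)
Lemma sum_grid_shift (n : nat) b (eta : R) (G : 'rV[R]_m -> R) (i : 'I_m) :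
  (forall x, 1 <= `|x ord0 i| -> G x = 0) ->
  b ord0 i <= - 1 -> 1 <= b ord0 i + n%:R * eta ->
  \sum_(k : {ffun 'I_m -> 'I_n}) G (gpt b eta k + eta *: delta_mx ord0 i) =
  \sum_(k : {ffun 'I_m -> 'I_n}) G (gpt b eta k).
Proof.
move=> G0 b1 bn.
pose sh (k : {ffun 'I_m -> 'I_n}) : {ffun 'I_m -> 'I_n} :=
  [ffun j => if j == i then ordS (k j) else k j].
pose sh' (k : {ffun 'I_m -> 'I_n}) : {ffun 'I_m -> 'I_n} :=
  [ffun j => if j == i then ord_pred (k j) else k j].
have shK : cancel sh sh'.
  by move=> k; apply/ffunP => j; rewrite !ffunE; case: eqVneq => [->|]; rewrite ?eqxx ?ordSK.
rewrite [RHS](reindex_inj (can_inj shK))/=; apply: eq_bigr => k _.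
have [kl|kl] := ltnP (k i).+1 n.
  congr G; apply/rowP => j; rewrite !mxE eqxx/= ffunE.
  have [->|ji] := eqVneq j i; last by rewrite mulr0 addr0.
  by rewrite /= modn_small// -addrA mulr1 -natr1 mulrDl mul1r.
have kn : (k i).+1 = n by apply/eqP; rewrite eqn_leq kl ltn_ord.
rewrite [LHS]G0 ?[RHS]G0//.
  rewrite !mxE ffunE eqxx/= kn modnn mul0r addr0 ler0_norm; lra.
rewrite !mxE !eqxx/= mulr1 -addrA -[X in _ + (_ + X)]mul1r -mulrDl natr1 kn.
by rewrite ger0_norm; lra.
Qed.

(* A Riemann sum of a derivative telescopes, up to the modulus of continuity. *)
Lemma sum_grid_derivative (n : nat) b (eta e : R) (G D : 'rV[R]_m -> R) (i : 'I_m) :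
  0 < eta ->
  (forall x, is_derive x (delta_mx ord0 i) G (D x)) ->
  (forall x y, enorm (x - y) <= eta -> `|D x - D y| <= e) ->
  (forall x, 1 <= `|x ord0 i| -> G x = 0) ->
  b ord0 i <= - 1 -> 1 <= b ord0 i + n%:R * eta ->
  `|\sum_(k : {ffun 'I_m -> 'I_n}) D (gpt b eta k)| <= e * n%:R ^+ m.
Proof.
move=> eta0 dG De G0 b1 bn.
have -> : \sum_(k : {ffun 'I_m -> 'I_n}) D (gpt b eta k) =
  \sum_(k : {ffun 'I_m -> 'I_n}) (D (gpt b eta k) -
     eta^-1 * (G (gpt b eta k + eta *: delta_mx ord0 i) - G (gpt b eta k))).
  by rewrite sumrB -big_distrr/= sumrB sum_grid_shift// subrr mulr0 subr0.
apply: (le_trans (ler_norm_sum _ _ _)).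
rewrite (@le_trans _ _ (\sum_(k : {ffun 'I_m -> 'I_n}) e))//; last first.
  by rewrite sumr_const card_ffun !card_ord -(mulr_natr e) natrX.
apply: ler_sum => k _; set x := gpt b eta k.
have dphi (t : R) : is_derive t 1 (fun t : R => G (x + t *: delta_mx ord0 i))
    (D (x + t *: delta_mx ord0 i)).
  by apply: is_derive_slice; exact: dG.
have [|t tin ME] := @MVT R (fun t : R => G (x + t *: delta_mx ord0 i))
   (fun t : R => D (x + t *: delta_mx ord0 i)) 0 eta eta0.
  by apply: derivable_within_continuous => t _; have [] := dphi t.
move: tin ME; rewrite in_itv/= => /andP[t0 te]; rewrite scale0r addr0 subr0 => ->.
rewrite mulrCA mulVf ?gt_eqF// mulr1; apply: De.
by rewrite opprD addNKr enormN enormZ enorm_delta mulr1 gtr0_norm// ltW.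
Qed.

End grid.

Section mean_value.
Variables (R : realType) (m : nat) (u : 'rV[R]_m -> R) (a : 'rV[R]_m) (r s : R).
Hypotheses (s0 : 0 < s) (sr : s < r).
Hypothesis hu : harmonic_on [set y | enorm (a - y) < r] u.

Let u1 i := partial i u.
Let u2 i j := partial j (partial i u).
Let hd := harmonic_on_data hu.

Let G (i : 'I_m) (t : R) (x : 'rV[R]_m) : R :=
  u1 i (a + t *: x) * (- 4^-1 * bump x ^+ 2).
Let D (i : 'I_m) (t : R) (x : 'rV[R]_m) : R :=
  t * u2 i i (a + t *: x) * (- 4^-1 * bump x ^+ 2)
  + u1 i (a + t *: x) * (bump x * x ord0 i).

Let inO (t : R) (x : 'rV[R]_m) : 0 <= t <= s -> enorm x <= 1 ->
  enorm (a - (a + t *: x)) < r.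
Proof.
move=> /andP[t0 ts] x1; rewrite opprD addNKr enormN enormZ ger0_norm//.
apply: le_lt_trans sr; apply: le_trans ts.
by rewrite ler_piMr.
Qed.

Let near_bump0 (x : 'rV[R]_m) : 1 < enorm x -> \forall y \near x, bump y = 0.
Proof.
move=> x1; have x10 : 0 < enorm x - 1 by rewrite subr_gt0.
apply: (@filterS _ _ (nbhs_filter x) _ _ _ (enorm_ball_nbhs x x10)) => y xy.
apply: bump_eq0; have := enorm_dist x y; rewrite ler_norml; lra.
Qed.

Let dG (i : 'I_m) (t : R) (x : 'rV[R]_m) : 0 <= t <= s ->
  is_derive x (delta_mx ord0 i) (G i t) (D i t x).
Proof.
move=> t0s; have [x1|x1] := lerP (enorm x) 1; last first.
  have -> : D i t x = 0.
    by rewrite /D bump_eq0 ?ltW// expr0n/= mulr0 mulr0 mul0r mulr0 addr0.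
  apply: (@near_eq_is_derive _ _ _ (cst 0)).
  apply: (@filterS _ _ (nbhs_filter x) _ _ _ (near_bump0 x1)) => y y0.
  by rewrite /G y0 expr0n/= !mulr0.
have [_ _ /(_ i i)[d2 _] _] := hd (inO t0s x1).
have d1 : is_derive x (delta_mx ord0 i) (fun y => u1 i (a + t *: y))
    (t * u2 i i (a + t *: x)).
  apply: is_derive_of_slice.
  have d3 : is_derive (0 : R) 1 (fun h : R => u1 i (a + t *: x + h *: delta_mx ord0 i))
      (u2 i i (a + t *: x)).
    by apply: is_derive_slice; rewrite scale0r addr0.
  rewrite (_ : (fun _ => _) = (fun h : R => u1 i (a + t *: x + h *: delta_mx ord0 i))
     \o (t \*: id)); last first.
    by apply/funext => h; rewrite /= scalerDr scalerA addrA.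
  rewrite mulrC; apply: is_derive1_comp.
    by rewrite /= scaler0.
  by apply: is_derive_eq; rewrite [LHS]mulr1.
have dB := is_derive_sqr_bump x i.
rewrite (_ : G i t = (fun y => u1 i (a + t *: y)) * (- 4^-1 *: (fun y => bump y ^+ 2))); last by [].
apply: is_derive_eq; rewrite !scale_mulE /D.
have -> : (- 4^-1 *: (fun y => bump y ^+ 2)) x = - 4^-1 * bump x ^+ 2 by [].
by field.
Qed.

(** If [|x| <= 1], the point [a + t *: x] stays within [s < r] of [a], where [u] is smooth. If
    [|x| > 1], it may leave the domain, but [bump] and so [D] vanish near [x]. *)
Let cD (i : 'I_m) (p : R * 'rV[R]_m) : 0 <= p.1 <= s ->
  {for p, continuous (fun q : R * 'rV[R]_m => D i q.1 q.2)}.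
Proof.
case: p => t x /= t0s; have [x1|x1] := lerP (enorm x) 1; last first.
  apply: (@near_eq_continuous_at _ _ (fun=> 0)); last exact: cst_continuous.
  exists (setT, [set y | bump y = 0]).
    by split; [exact: filterT|exact: near_bump0].
  by move=> [t' y]/= [_ y0]; rewrite /D y0 expr0n/= mulr0 mulr0 mul0r mulr0 addr0.
have [_ /(_ i)[_ c1] /(_ i i)[_ c2] _] := hd (inO t0s x1).
have f1 : {for (t, x), continuous (fun q : R * 'rV[R]_m => q.1)} by exact: cvg_fst.
have f2 : {for (t, x), continuous (fun q : R * 'rV[R]_m => q.2)} by exact: cvg_snd.
have cc : {for (t, x), continuous (fun q : R * 'rV[R]_m => a + q.1 *: q.2)}.
  apply: (@continuousD _ _ _ (fun=> a)); first exact: cst_continuous.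
  exact: continuousZ.
have cu1 : {for (t, x), continuous (fun q : R * 'rV[R]_m => u1 i (a + q.1 *: q.2))}.
  exact: (@continuous_comp _ _ _ (fun q : R * 'rV[R]_m => a + q.1 *: q.2)).
have cu2 : {for (t, x), continuous (fun q : R * 'rV[R]_m => u2 i i (a + q.1 *: q.2))}.
  exact: (@continuous_comp _ _ _ (fun q : R * 'rV[R]_m => a + q.1 *: q.2)).
have cb : {for (t, x), continuous (fun q : R * 'rV[R]_m => bump q.2)}.
  apply: (@continuous_comp _ _ _ snd) => //; exact: bump_continuous.
have ci : {for (t, x), continuous (fun q : R * 'rV[R]_m => q.2 ord0 i)}.
  apply: (@continuous_comp _ _ _ snd (fun y : 'rV[R]_m => y ord0 i)) => //; exact: coord_continuous.
apply: continuousD; apply: continuousM.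
- exact: continuousM.
- apply: (@continuousM _ _ (fun=> - 4^-1)); first exact: cst_continuous.
  exact: (@continuousM _ _ (fun q : R * 'rV[R]_m => bump q.2)).
- exact: cu1.
- exact: continuousM.
Qed.

(** Heine-Cantor on [[0, s]] times the ball of radius 2. Beyond radius 2 a step shorter than 1 stays
    outside the unit ball, where [D] is zero. *)
Let unifD (e : R) : 0 < e -> \forall d \near (0 : R)^'+, forall i t x y,
  0 <= t <= s -> enorm (x - y) <= d -> `|D i t x - D i t y| <= e.
Proof.
move=> e0; apply: filter_forall => i.
pose K := `[0, s]%classic `*` [set x : 'rV[R]_m | enorm (0 - x) <= 2].
have cK : compact K.
  apply: compact_setX; first exact: segment_compact.
  by apply: (@compact_enorm_le _ _ 0 2) => //; exact: closed_enorm_le.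
have cDK p : K p -> {for p, continuous (fun q : R * 'rV[R]_m => D i q.1 q.2)}.
  by case: p => t x [/= + _]; rewrite in_itv/= => ts; exact: cD.
have [d d0 dP] := heine_cantor cK cDK e0.
have : \forall d' \near (0 : R)^'+, d' < Num.min d 1.
  by apply: nbhs_right_lt; rewrite lt_min d0 ltr01.
apply: filterS => d'; rewrite lt_min => /andP[d'd d'1] t x y ts xy.
have D0 z : 1 < enorm z -> D i t z = 0.
  by move=> z1; rewrite /D bump_eq0 ?ltW// expr0n/= mulr0 mulr0 mul0r mulr0 addr0.
have [x2|x2] := lerP (enorm x) 2.
  apply: (dP (t, x) (t, y)).
    by split => /=; rewrite ?in_itv//= sub0r enormN.
  split => /=; first exact: ballxx.
  rewrite -ball_normE/=; apply: le_lt_trans (norm_le_enorm _) _.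
  exact: le_lt_trans xy d'd.
rewrite D0 ?D0 ?subrr ?normr0 ?ltW//; last by apply: lt_trans x2; rewrite ltrDl.
by have := enorm_dist x y; rewrite ler_norml; lra.
Qed.

(* The derivative in [s] of the sum of [u (a + s *: x) * bump x] is a Riemann sum
   of the divergence of [- 4^-1 * bump x ^+ 2] times the gradient of [u] at
   [a + s *: x], because [- 4^-1 * bump x ^+ 2] has gradient [bump x *: x]. *)
Lemma grid_mean_value (e : R) : 0 < e -> \forall eta \near (0 : R)^'+,
  forall (n : nat) (b : 'rV[R]_m), (forall i, b ord0 i <= - 1) ->
  (forall i, 1 <= b ord0 i + n%:R * eta) ->
  `|\sum_(k : {ffun 'I_m -> 'I_n})
      (u (a + s *: gpt b eta k) - u a) * bump (gpt b eta k)| <= e * n%:R ^+ m.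
Proof.
(* The error is multiplied by [s] in the mean value theorem in [t] and by the number [m] of
   directions. *)
move=> e0; have e1 : 0 < e / (s * (m%:R + 1)).
  by rewrite divr_gt0// mulr_gt0// ltr_wpDl.
have eta0 : \forall eta \near (0 : R)^'+, 0 < eta by exact: nbhs_right_gt.
apply: filterS (filterI eta0 (unifD e1)) => eta [{}eta0 Deta] n b b1 bn.
pose h' (t : R) := \sum_(k : {ffun 'I_m -> 'I_n}) \sum_i D i t (gpt b eta k).
pose h (t : R) := \sum_(k : {ffun 'I_m -> 'I_n})
   u (a + t *: gpt b eta k) * bump (gpt b eta k).
have dh (t : R) : 0 <= t <= s -> is_derive t 1 h (h' t).
  move=> ts.
  have -> : h = \sum_(k : {ffun 'I_m -> 'I_n})
     (fun t : R => u (a + t *: gpt b eta k) * bump (gpt b eta k)).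
    by apply/funext => t'; rewrite fct_sumE.
  rewrite /h'.
  elim: (index_enum _) => [|k ks IH]; first by rewrite !big_nil; exact: is_derive_cst.
  rewrite !big_cons; apply: is_deriveD => {IH}.
  set x := gpt b eta k.
  have [x1|x1] := lerP (enorm x) 1; last first.
    have b0 : bump x = 0 by rewrite bump_eq0// ltW.
    rewrite b0 (_ : (fun _ => _) = cst 0); last first.
      by apply/funext => ?; rewrite mulr0.
    rewrite big1 => [|i _]; first exact: is_derive_cst.
    by rewrite /D b0 expr0n/= mulr0 mulr0 mul0r mulr0 addr0.
  have Ox := inO ts x1.
  have [_ _ _ lap] := hd Ox.
  (* The second-order terms add up to the Laplacian of [u], which is zero; what remains is the
     derivative of [u (a + t *: x)] in [t], weighted by [bump x]. *)
  have -> : \sum_i D i t x = bump x * \sum_i x ord0 i * u1 i (a + t *: x).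
    rewrite /D big_split/= -big_distrl/= -big_distrr/= lap mulr0 mul0r add0r.
    by rewrite big_distrr/=; apply: eq_bigr => i _; ring.
  have dx : is_derive (a + t *: x) x u (\sum_i x ord0 i * u1 i (a + t *: x)).
    have H i y : [set y | enorm (a - y) < r] y ->
        is_derive y (delta_mx ord0 i) u (u1 i y) /\ {for y, continuous (u1 i)}.
      by move=> Oy; have [_ /(_ i)] := hd Oy.
    exact: (@is_derive_dir R m _ u u1 (@open_enorm_lt R m a r) H _ x Ox).
  have d1 := is_derive_slice dx.
  rewrite (_ : (fun _ => _) = bump x \*: (fun t : R => u (a + t *: x))); last first.
    by apply/funext => ?; rewrite /= mulrC.
  exact: is_deriveZ.
have [||t ts E] := @MVT R h h' 0 s s0.
- by move=> t; rewrite in_itv/= => /andP[t0 t1]; apply: dh; rewrite !ltW.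
- apply: derivable_within_continuous => t; rewrite in_itv/= => ts.
  by have [] := dh t ts.
have -> : \sum_(k : {ffun 'I_m -> 'I_n})
      (u (a + s *: gpt b eta k) - u a) * bump (gpt b eta k) = h s - h 0.
  rewrite /h -sumrB; apply: eq_bigr => k _.
  by rewrite scale0r addr0 mulrBl.
rewrite E subr0 normrM (gtr0_norm s0) -ler_pdivlMr//.
rewrite /h' exchange_big/= (le_trans (ler_norm_sum _ _ _))//.
have {}ts : 0 <= t <= s by move: ts; rewrite in_itv/= => /andP[? ?]; rewrite !ltW.
apply: (@le_trans _ _ (\sum_(i < m) (e / (s * (m%:R + 1)) * n%:R ^+ m))).
  apply: ler_sum => i _; apply: (@sum_grid_derivative _ _ n b eta _ (G i t) _ i) => //.
  - by move=> x; exact: dG.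
  - by move=> x y xy; exact: Deta.
  - move=> x x1; rewrite /G bump_eq0 ?expr0n/= ?mulr0//.
    exact: le_trans x1 (coord_le_enorm _ _).
rewrite sumr_const card_ord -[leLHS]mulr_natr.
have -> : e * n%:R ^+ m / s = e / (s * (m%:R + 1)) * n%:R ^+ m * (m%:R + 1).
  by field; rewrite !gt_eqF// ltr_wpDl.
by rewrite ler_wpM2l// ?lerDl// mulr_ge0 ?(ltW e1)// exprn_ge0.
Qed.

End mean_value.

(** [(24 * m) ^ - m] is the proportion of nodes used in [sum_grid_bump_ge], one half is the value of
    [bump] there, and one quarter is lost when the weights at the two centres are compared. *)
Definition harnack_constant (R : realType) (m : nat) : R :=
  8^-1 * ((24 * m)%:R ^- m).

(* [24 * m * q] steps from [-6] to [6]; at least [q ^ m] nodes have all their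
   coordinates in [[0, 1 / (2 * m)]], where [bump >= 1 / 2]. *)
Lemma sum_grid_bump_ge (R : realType) (m q : nat) : (0 < m)%N -> (0 < q)%N ->
  (q ^ m)%:R / 2 <= \sum_(k : {ffun 'I_m -> 'I_(24 * m * q)})
     bump (gpt (const_mx (- 6) : 'rV[R]_m) ((2 * m * q)%:R^-1) k).
Proof.
move=> m0 q0.
have lt_f (j : 'I_q) : (12 * m * q + j < 24 * m * q)%N.
  by have := ltn_ord j; nia.
pose f (k : {ffun 'I_m -> 'I_q}) : {ffun 'I_m -> 'I_(24 * m * q)} :=
  [ffun i => Ordinal (lt_f (k i))].
have fI : injective f.
  move=> k k' /ffunP kk'; apply/ffunP => i; have := kk' i; rewrite !ffunE.
  by move=> [] /addnI; exact: val_inj.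
pose A := f @: [set: {ffun 'I_m -> 'I_q}]%SET.
rewrite (bigID (fun k => k \in A))/= ler_wpDr//.
  by apply: sumr_ge0 => k _; exact: bump_ge0.
have -> : (q ^ m)%:R / 2 = \sum_(k in A) (2^-1 : R).
  by rewrite sumr_const card_imset// cardsT card_ffun !card_ord mulr_natl.
apply: ler_sum => _ /imsetP[k _ ->].
have mq : (2 * m * q)%:R != 0 :> R by rewrite pnatr_eq0; nia.
have E i : (gpt (const_mx (- 6) : 'rV[R]_m) ((2 * m * q)%:R^-1) (f k)) ord0 i
   = (k i)%:R / (2 * m * q)%:R.
  rewrite !mxE ffunE /= natrD mulrDl addrA.
  rewrite (_ : (12 * m * q)%:R = 6 * (2 * m * q)%:R); last by rewrite -natrM; congr _%:R; nia.
  by rewrite mulfK// addNr add0r.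
set x := gpt _ _ _; rewrite /bump le_max; apply/orP; right.
have : enorm x ^+ 2 <= \sum_(i < m) (4^-1 * m%:R ^- 2).
  rewrite sqr_enorm; apply: ler_sum => i _; rewrite E.
  have m0' : (m%:R : R) != 0 by rewrite pnatr_eq0 -lt0n.
  have -> : 4^-1 * m%:R ^- 2 = ((2 * m%:R)^-1 : R) ^+ 2 by field.
  rewrite lerXn2r ?nnegrE ?divr_ge0 ?invr_ge0 ?mulr_ge0//.
  rewrite ler_pdivrMr ?lt0r ?mq ?ler0n//.
  have -> : (2 * m%:R)^-1 * (2 * m * q)%:R = q%:R :> R by rewrite !natrM; field.
  by rewrite ler_nat ltnW.
rewrite sumr_const card_ord -(mulr_natr (_ * _)).
have m1 : (m%:R : R) != 0 by rewrite pnatr_eq0 -lt0n.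
have -> : 4^-1 / m%:R ^+ 2 * m%:R = 4^-1 / m%:R :> R by field.
have : 4^-1 / m%:R <= 4^-1 :> R by rewrite ler_piMr// invf_le1 ?ltr0n// ler1n.
lra.
Qed.

(** The weighted mean of [u] on the ball of radius [r / 8] around [a] is compared with that on the
    larger ball of radius [r / 2] around [x]. Both Riemann sums use the same points, so the
    comparison is term by term. *)
Lemma harnack (R : realType) (m : nat) (u : 'rV[R]_m -> R) (a x : 'rV[R]_m) (r : R) :
  (0 < m)%N -> 0 < r -> harmonic_on [set y | enorm (a - y) < r] u ->
  (forall y, enorm (a - y) < r -> 0 < u y) ->
  enorm (a - x) <= r / 4 -> harnack_constant R m * u a <= u x.
Proof.
move=> m0 r0 hu up ax.
have hux : harmonic_on [set y | enorm (x - y) < 3 / 4 * r] u.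
  apply: harmonic_on_subset hu => y /= xy.
  by have := enorm_triangleB a x y; lra.
have s10 : 0 < r / 2 by lra.
have s20 : 0 < r / 8 by lra.
have sr1 : r / 2 < 3 / 4 * r by lra.
have sr2 : r / 8 < r by lra.
(* One error [e] comes from the sum around [x], a quarter of another from the sum around [a]. *)
suff key e : 0 < e -> harnack_constant R m * u a <= u x + e * (5 / 4).
  apply/ler_addgt0Pr => e e0; apply: (le_trans (key (e * (4 / 5)) _)); first by lra.
  by lra.
move=> e0.
have Hx := grid_mean_value s10 sr1 hux e0.
have Ha := grid_mean_value s20 sr2 hu e0.
have [d /= d0 Hd] := filterI Hx Ha.
have c0 : 0 < (2 * m)%:R :> R by rewrite ltr0n muln_gt0.
have [q q0 qd] : exists2 q : nat, (0 < q)%N & (2 * m * q)%:R^-1 < d.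
  exists (Num.bound ((2 * m)%:R^-1 / d)).+1 => //.
  rewrite natrM invfM ltr_pdivrMr ?ltr0n// mulrC -ltr_pdivrMr//.
  apply: (@lt_le_trans _ _ (Num.bound ((2 * m)%:R^-1 / d))%:R).
    by rewrite archi_boundP// divr_ge0 ?(ltW d0)// invr_ge0 ltW.
  by rewrite ler_nat.
have Bq' := @sum_grid_bump_ge R m q m0 q0.
move: qd Bq'; set eta : R := (2 * m * q)%:R^-1; set n := (24 * m * q)%N => qd Bq'.
have eta0 : 0 < eta by rewrite invr_gt0 ltr0n !muln_gt0 m0.
have neta : n%:R * eta = 12.
  rewrite /n /eta -[24%N]/(12 * 2)%N -2!mulnA natrM mulnA mulfK//.
  by rewrite pnatr_eq0 -lt0n !muln_gt0 m0.
have nX : n%:R ^+ m = (24 * m)%:R ^+ m * (q ^ m)%:R :> R.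
  by rewrite /n natrM exprMn natrX.
have n0 : (0 < n)%N by rewrite !muln_gt0 m0.
move: n n0 eta eta0 neta nX qd Bq' => n n0 eta eta0 neta nX eta_d Bq'.
(* In units of the ball around [x] the grid is shrunk by 4 and shifted by at most [1 / 2] per
   coordinate. It must still cover [[-1, 1]], and [6 / 4 - 1 / 2 = 1]. *)
pose b : 'rV[R]_m := const_mx (- 6).
pose b' : 'rV[R]_m := (2 / r) *: (a - x) + 4^-1 *: b.
have ptE k : gpt b' (eta / 4) k = (2 / r) *: (a - x) + 4^-1 *: gpt b eta k :> 'rV[R]_m.
  by apply/rowP => i; rewrite !mxE; ring.
have yE (k : {ffun 'I_m -> 'I_n}) : x + (r / 2) *: gpt b' (eta / 4) k =
    a + (r / 8) *: gpt b eta k.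
  rewrite ptE scalerDr !scalerA addrA; congr (_ + _ *: _); last by field.
  rewrite (_ : r / 2 * (2 / r) = 1) ?scale1r; last by field; rewrite gt_eqF.
  by rewrite addrC subrK.
have bi i : `|(2 / r) * (a ord0 i - x ord0 i)| <= 2^-1.
  have := coord_le_enorm (a - x) i; rewrite !mxE => axi.
  have rr : 2 / r * (r / 4) = 2^-1 by field; rewrite gt_eqF.
  rewrite normrM gtr0_norm ?divr_gt0// -rr ler_wpM2l ?divr_ge0 ?(ltW r0)//.
  exact: le_trans ax.
have ball_eta eta' : 0 < eta' -> eta' <= eta -> ball 0 d eta'.
  move=> h1 h2; rewrite /ball/= sub0r normrN gtr0_norm//.
  exact: le_lt_trans eta_d.
have [_ Ea] := Hd eta (ball_eta _ eta0 (lexx _)) eta0.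
have eta40 : 0 < eta / 4 by rewrite divr_gt0.
have eta4 : eta / 4 <= eta by lra.
have [Ex _] := Hd (eta / 4) (ball_eta _ eta40 eta4) eta40.
have {}Ea := Ea n b (ltac:(by move=> i; rewrite mxE; lra)) (ltac:(by move=> i; rewrite mxE
  neta; lra)).
have {}Ex : `|\sum_(k : {ffun 'I_m -> 'I_n}) (u (x + (r / 2) *: gpt b' (eta / 4) k) - u x) *
             bump (gpt b' (eta / 4) k)| <= e * n%:R ^+ m.
  apply: Ex => i.
    by rewrite !mxE; have := bi i; rewrite ler_norml; lra.
  by rewrite !mxE mulrA neta; have := bi i; rewrite ler_norml; lra.
have Bq : harnack_constant R m * n%:R ^+ m <= 4^-1 * \sum_(k : {ffun 'I_m -> 'I_n}) bump (gpt b
  eta k).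
  rewrite nX /harnack_constant.
  have nz : (24 * m)%:R ^+ m != 0 :> R by rewrite expf_neq0// pnatr_eq0 -lt0n muln_gt0.
  rewrite -mulrA mulKf//; lra.
have sumux : \sum_(k : {ffun 'I_m -> 'I_n}) bump (gpt b' (eta / 4) k) <= n%:R ^+ m.
  apply: (@le_trans _ _ (\sum_(k : {ffun 'I_m -> 'I_n}) 1)).
    by apply: ler_sum => k _; exact: bump_le1.
  by rewrite sumr_const card_ffun !card_ord -natrX.
have ux : 0 < u x by apply: up; apply: le_lt_trans ax _; lra.
have ua : 0 < u a by apply: up; rewrite subrr enorm0.
have cmp : 4^-1 * \sum_(k : {ffun 'I_m -> 'I_n}) u (a + (r / 8) *: gpt b eta k) * bump (gpt b eta k)
    <= \sum_(k : {ffun 'I_m -> 'I_n}) u (x + (r / 2) *: gpt b' (eta / 4) k) * bump (gpt b' (eta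
      / 4) k).
  rewrite big_distrr/=; apply: ler_sum => k _; rewrite yE ptE.
  set p := gpt b eta k; set p' := (2 / r) *: (a - x) + 4^-1 *: p.
  have [p1|p1] := ltrP (enorm p) 1.
    have uy : 0 < u (a + (r / 8) *: p).
      apply: up; rewrite opprD addNKr enormN enormZ gtr0_norm; last lra.
      nra.
    rewrite mulrCA ler_pM2l//.
    (* Hence [bump p' >= 1 - 9 / 16], more than a quarter of [bump p <= 1]. *)
    have p'1 : enorm p' <= 3 / 4.
      apply: (le_trans (enorm_triangle _ _)); rewrite !enormZ !gtr0_norm ?divr_gt0//.
      have : 2 / r * enorm (a - x) <= 2 / r * (r / 4).
        by rewrite ler_wpM2l// divr_ge0// ltW.
      have -> : 2 / r * (r / 4) = 2^-1 by field; rewrite gt_eqF.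
      lra.
    apply: (@le_trans _ _ (1 - enorm p' ^+ 2)); last by rewrite /bump le_max lexx orbT.
    have : enorm p' ^+ 2 <= (3 / 4) ^+ 2 by rewrite lerXn2r ?nnegrE ?enorm_ge0.
    by have := bump_le1 p; lra.
  (* Nodes that only the larger ball sees are discarded by positivity of [u]; they lie within
     [3 / 4 * r] of [a]. *)
  rewrite (bump_eq0 p1) !mulr0.
  have [p'1|p'1] := ltrP (enorm p') 1; last by rewrite (bump_eq0 p'1) mulr0.
  rewrite mulr_ge0 ?bump_ge0// ltW//; apply: up.
  rewrite -yE ptE -/p -/p' (_ : a - _ = (a - x) - (r / 2) *: p'); last first.
    by rewrite opprD addrA.
  apply: (le_lt_trans (enorm_triangle _ _)); rewrite enormN enormZ gtr0_norm//.
  have : r / 2 * enorm p' <= r / 2 * 1 by rewrite ler_pM2l// ltW.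
  lra.
have split_sum (c : 'rV[R]_m) (s' : R) (b0 : 'rV[R]_m) (eta' : R) (z : 'rV[R]_m) :
   \sum_(k : {ffun 'I_m -> 'I_n}) (u (c + s' *: gpt b0 eta' k) - u z) * bump (gpt b0 eta' k)
   = \sum_(k : {ffun 'I_m -> 'I_n}) u (c + s' *: gpt b0 eta' k) * bump (gpt b0 eta' k)
     - u z * \sum_(k : {ffun 'I_m -> 'I_n}) bump (gpt b0 eta' k).
  by rewrite big_distrr/= -sumrB; apply: eq_bigr => k _; rewrite mulrBl.
move: Ea Ex; rewrite !split_sum !ler_norml => /andP[Ea _] /andP[_ Ex].
have N0 : 0 < (n%:R ^+ m : R) by rewrite exprn_gt0// ltr0n.
rewrite -(ler_pM2r N0).
have H1 := ler_wpM2l (ltW ux) sumux.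
have H2 := ler_wpM2l (ltW ua) Bq.
have -> : harnack_constant R m * u a * n%:R ^+ m =
  u a * (harnack_constant R m * n%:R ^+ m) by ring.
move: Ea Ex cmp H1 H2.
set S1 := \sum_k _; set S2 := \sum_k _; set S3 := \sum_k _; set S4 := \sum_k _.
move: (harnack_constant R m * n%:R ^+ m) (n%:R ^+ m) => C N.
move=> Ea Ex cmp H1 H2.
have : u a * (4^-1 * S2) = 4^-1 * (u a * S2) by ring.
rewrite mulrDl; lra.
Qed.

(** * Part (a) *)

Lemma harnack_constant_gt0 (R : realType) (m : nat) : (0 < m)%N ->
  0 < harnack_constant R m.
Proof.
by move=> m0; rewrite mulr_gt0// invr_gt0 exprn_gt0// ltr0n muln_gt0.
Qed.

(** * Comparison of a positive harmonic function with a sum of kernels *)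

Section comparison.
Variables (R : realType) (p : nat) (I : finType).
Local Notation m := p.+1.
Variables (u : 'rV[R]_m -> R) (y : I -> 'rV[R]_m) (t V w : I -> R) (A kappa : R).
Hypotheses (p0 : (0 < p)%N).
Hypotheses (hu : harmonic_on (@unit_ball R m) u) (up : positive_on (@unit_ball R m) u).
Hypotheses (y1 : forall j, enorm (y j) = 1) (t0 : forall j, 0 < t j)
  (t1 : forall j, t j <= 2^-1) (w0 : forall j, 0 <= w j) (V0 : forall j, 0 < V j).
Hypotheses (A0 : 0 <= A) (kappa0 : 0 < kappa).
Let X j := (1 - t j) *: y j.
Hypothesis uX : forall j, kappa * V j <= u (X j).
Hypothesis packing : forall i x l, enorm (x - X i) <= t i / 4 ->
  \sum_(j | enorm (x - X j) <= 2 ^+ l * (t i / 8)) w j <=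
  A * (t i ^+ p * V i) * 2 ^+ (l * p).

(** [5 / 2 * t i] bounds the numerators of the kernels, [A * 2 ^ (p + 2)] comes from the dyadic
    summation, and [8 ^ (p + 1)] from the least distance [t i / 8]. The denominator converts [V i]
    into a value of [u] near [X i]. *)
Definition comparison_constant : R :=
  (5 / 2) * A * 2 ^+ p.+2 * 8 ^+ p.+1 / (harnack_constant R m * kappa).

Let cH0 : 0 < harnack_constant R m. Proof. exact: harnack_constant_gt0. Qed.

Let C0 : 0 <= comparison_constant.
Proof.
apply: divr_ge0; last by rewrite ltW// mulr_gt0.
apply: mulr_ge0; last exact: exprn_ge0.
apply: mulr_ge0; last exact: exprn_ge0.
by rewrite mulr_ge0// divr_ge0.
Qed.

Let enormX j : enorm (X j) = 1 - t j.
Proof. by rewrite enormZ y1 mulr1 ger0_norm//; have := t1 j; lra. Qed.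

Let W x := \sum_j w j * poisson (X j) x.

(* On the sphere of radius [t i / 4] around [X i], outside the other balls, all
   poles are at distance at least [t i / 8]: a pole of height [t j <= t i / 2]
   is much closer to the unit sphere than [x], and otherwise [t j / 4 >= t i / 8]. *)
Let W_le i x : enorm x < 1 -> enorm (x - X i) = t i / 4 ->
  (forall j, t j / 4 <= enorm (x - X j)) ->
  W x <= comparison_constant * u x.
Proof.
move=> x1 xi xj.
have xlo : 1 - 5 / 4 * t i <= enorm x.
  by have := enorm_dist (X i) x; rewrite enormX enormB xi ler_norml; lra.
have xhi : enorm x <= 1 - 3 / 4 * t i.
  by have := enorm_dist x (X i); rewrite enormX xi ler_norml; lra.
have d8 j : t i / 8 <= enorm (x - X j).
  have [tji|tji] := lerP (t j) (t i / 2); last by have := xj j; lra.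
  by have := enorm_dist x (X j); rewrite enormX ler_norml; have := t0 i; lra.
have xi' : enorm (x - X i) <= t i / 4 by rewrite xi.
have ti8 : 0 < t i / 8 by rewrite divr_gt0.
have K := @kernel_sum_le R I w (fun j => enorm (x - X j)) (t i / 8)
  (A * (t i ^+ p * V i)) p ti8 w0 d8 (fun l => packing l xi').
have ux : harnack_constant R m * (kappa * V i) <= u x.
  apply: (@le_trans _ _ (harnack_constant R m * u (X i))).
    by rewrite ler_wpM2l// ltW.
  have sub : [set z | enorm (X i - z) < t i] `<=` @unit_ball R m.
    move=> z /= Xz; rewrite /unit_ball/=.
    by have := enorm_dist (X i) z; rewrite enormX ler_norml; lra.
  apply: (@harnack R m u (X i) x (t i)) => //.
  - exact: harmonic_on_subset hu.
  - by move=> z /sub; exact: up.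
  - by rewrite enormB xi.
(* The numerator is [(1 - t j - |x|) (1 - t j + |x|)]: the first factor is at most
   [1 - |x| <= 5 / 4 * t i], the second at most 2. *)
apply: (@le_trans _ _ (5 / 2 * t i * \sum_j w j / enorm (x - X j) ^+ p.+1)).
  rewrite big_distrr/=; apply: ler_sum => j _; rewrite /poisson /invdist.
  rewrite exprVn [leRHS]mulrCA ler_wpM2l//.
  rewrite ler_wpM2r ?invr_ge0 ?exprn_ge0 ?enorm_ge0// enormX.
  have := t0 j; have := t1 j; have := enorm_ge0 x => x0 h1 h2.
  have -> : (1 - t j) ^+ 2 - enorm x ^+ 2 = (1 - t j - enorm x) * (1 - t j + enorm x) by ring.
  have [s0|s0] := lerP (1 - t j - enorm x) 0.
    apply: (@le_trans _ _ 0); last by rewrite mulr_ge0// ltW.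
    by rewrite mulr_le0_ge0//; lra.
  apply: (@le_trans _ _ ((5 / 4 * t i) * 2)); last lra.
  by apply: ler_pM; lra.
apply: (@le_trans _ _ (5 / 2 * t i *
    (A * (t i ^+ p * V i) * 2 ^+ p.+2 / (t i / 8) ^+ p.+1))).
  by rewrite ler_wpM2l// mulr_ge0// ltW.
have -> : 5 / 2 * t i * (A * (t i ^+ p * V i) * 2 ^+ p.+2 / (t i / 8) ^+ p.+1) =
    comparison_constant * (harnack_constant R m * (kappa * V i)).
  rewrite /comparison_constant expr_div_n [t i ^+ p.+1]exprS.
  by field; rewrite !gt_eqF// exprn_gt0.
by rewrite ler_wpM2l.
Qed.

Lemma weight_total_le : \sum_j w j <= comparison_constant * u 0.
Proof.
have [rho [rho0 rho1 rhot]] : exists rho : R, [/\ 0 < rho, rho < 1 & forall j, 1 - rho <= t j].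
  pose T := \big[Num.min/2^-1]_j t j.
  have T0 : 0 < T by rewrite /T; elim/big_ind : _ => // a b a0 b0; rewrite lt_min a0.
  exists (1 - T); split; last first.
  - by move=> j; rewrite opprB addrCA subrr addr0; exact: bigmin_le_cond.
  - by rewrite gtrBl.
  - have : T <= 2^-1 by exact: bigmin_le_id.
    lra.
(* A point of [K] with norm [rho] has only nonpositive kernels, because [1 - t j <= rho]. One at
   distance [t i / 4] from a pole falls under [W_le]. Every other point is interior to [K]. *)
pose K := [set x | enorm x <= rho /\ forall j, t j / 4 <= enorm (x - X j)].
pose O := [set x | enorm x < 1 /\ forall j, x != X j].
have oO : open O.
  rewrite openE => x [/= x1 xX]; rewrite /interior.
  have n1 : \forall z \near x, enorm z < 1 by have := @open_unit_ball R m; rewrite openE; exact.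
  have n2 : \forall z \near x, forall j, z != X j.
    apply: (@filter_forall _ _ (fun j z => z != X j) _ (nbhs_filter x)) => j.
    have n0 := enorm_sub_gt0 (xX j).
    apply: (@filterS _ _ (nbhs_filter x) _ _ _ (enorm_ball_nbhs x n0)) => z /= xz.
    by apply: contraTneq xz => ->; rewrite ltxx.
  by apply: (@filterS _ _ (nbhs_filter x) _ _ _ (@filterI _ _ (nbhs_filter x) _ _ n1 n2)).
have KO : K `<=` O.
  move=> x [/= xr xX]; split => [|j]; first exact: le_lt_trans rho1.
  apply/eqP => xXj; have := xX j; rewrite xXj subrr enorm0.
  by have := t0 j; lra.
have cK : compact K.
  apply: (@compact_enorm_le _ _ 0 rho); last by move=> x [/= xr _]; rewrite sub0r enormN.
  rewrite (_ : K = [set x | enorm (0 - x) <= rho] `&`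
      \bigcap_j ~` [set x | enorm (X j - x) < t j / 4]).
    apply: closedI; first exact: closed_enorm_le.
    by apply: closed_bigI => j _; apply: open_closedC; exact: open_enorm_lt.
  apply/seteqP; split=> x; rewrite /K/= sub0r enormN.
    by move=> [xr xX]; split=> // j _ /=; apply/negP; rewrite -leNgt enormB.
  move=> [xr xX]; split=> // j; have /= := xX j Logic.I.
  by move/negP; rewrite -leNgt enormB.
have hf : harmonic_on O (fun x => W x + (- comparison_constant) * u x).
  apply: harmonic_onD => //; last first.
    apply: harmonic_onZ => //; apply: harmonic_on_subset hu => z [z1 _]; exact: z1.
  apply: harmonic_on_sum => // j _; apply: harmonic_onZ => //.
  by apply: harmonic_on_subset (@harmonic_poisson R m (X j)) => z [_ /(_ j)].
have bd x : K x -> W x + (- comparison_constant) * u x <= 0 \/ \forall z \near x, K z.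
  move=> [xr xX]; rewrite mulNr subr_le0.
  have x1 : enorm x < 1 := le_lt_trans xr rho1.
  have [xe|xlt] := eqVneq (enorm x) rho.
    left; apply: (@le_trans _ _ 0); last by rewrite mulr_ge0// ltW// up.
    rewrite /W; apply: sumr_le0 => j _; rewrite mulr_ge0_le0//.
    rewrite mulr_le0_ge0 ?exprn_ge0 ?invr_ge0 ?enorm_ge0//.
    rewrite enormX xe subr_le0 lerXn2r ?nnegrE//; [|lra|].
      by have := t1 j; lra.
    by have := rhot j; lra.
  have {xlt}xlt : enorm x < rho by rewrite lt_neqAle xlt.
  have [[i xi]|nx] := pselect (exists i, enorm (x - X i) = t i / 4).
    by left; apply: W_le xi xX.
  right.
  have n1 : \forall z \near x, enorm z <= rho.
    have r0 : 0 < rho - enorm x by rewrite subr_gt0.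
    apply: (@filterS _ _ (nbhs_filter x) _ _ _ (enorm_ball_nbhs x r0)) => z /= xz.
    by have := enorm_dist x z; rewrite ler_norml; lra.
  have n2 : \forall z \near x, forall j, t j / 4 <= enorm (z - X j).
    apply: (@filter_forall _ _ (fun j z => t j / 4 <= enorm (z - X j)) _ (nbhs_filter x)) => j.
    have r0 : 0 < enorm (x - X j) - t j / 4.
      rewrite subr_gt0 lt_neqAle xX andbT; apply/eqP => xj; apply: nx.
      by exists j.
    apply: (@filterS _ _ (nbhs_filter x) _ _ _ (enorm_ball_nbhs x r0)) => z /= xz.
    by have := enorm_triangleB x z (X j); lra.
  exact: (@filterS _ _ (nbhs_filter x) _ _ _ (@filterI _ _ (nbhs_filter x) _ _ n1 n2)).
have K0 : K 0.
  split=> /=; first by rewrite enorm0 ltW.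
  by move=> j; rewrite sub0r enormN enormX; have := t1 j; lra.
have := @maximum_principle R m O K _ isT oO KO cK hf bd 0 K0.
rewrite mulNr subr_le0; apply: le_trans; apply: ler_sum => j _.
(* At the origin the kernel equals [(1 - t j) ^ 2 / (1 - t j) ^ (p + 1)], at least 1 since
   [p >= 1]. *)
rewrite ler_peMr// /poisson /invdist sub0r enormN enorm0 expr0n/= subr0 enormX.
have h1 : 0 < 1 - t j by have := t1 j; lra.
rewrite exprVn -ler_pdivrMr ?invr_gt0 ?exprn_gt0// invrK mul1r.
by rewrite ler_wiXn2l//; have := t0 j; lra.
Qed.

End comparison.

(* Leaf [k] lies in the cells [anc k n] of all levels [n0 <= n <= N k], and a
   cell of level [n] has capacity [cap n]. *)
Section greedy_weights.
Variables (R : realType) (T : eqType) (act : nat -> bool) (N : nat -> nat)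
  (anc : nat -> nat -> T) (cap : nat -> R) (n0 : nat).
Hypothesis n0N : forall k, act k -> (n0 <= N k)%N.
Hypothesis cap0 : forall n, 0 <= cap n.

Definition under (n : nat) (c : T) (i : nat) : bool :=
  [&& act i, (n <= N i)%N & anc i n == c].

Definition load (w : nat -> R) (K n : nat) (c : T) : R :=
  \sum_(0 <= i < K | under n c i) w i.

Definition room (w : nat -> R) (k n : nat) : R := cap n - load w k n (anc k n).

(* Each leaf receives in turn the largest weight that no cell forbids. *)
Definition next_weight (w : nat -> R) (k : nat) : R :=
  if act k then
    room w k [arg min_(i < (ord_max : 'I_(N k).+1) | (n0 <= i)%N) room w k i]%O
  else 0.

(** Course-of-values recursion: each weight depends on all earlier ones, so a stage carries the
    whole function built so far. *)
Fixpoint weights_upto (k : nat) : nat -> R :=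
  if k is k'.+1 then
    fun i => if i == k' then next_weight (weights_upto k') k' else weights_upto k' i
  else fun=> 0.

Definition greedy_weight (k : nat) : R := weights_upto k.+1 k.
Local Notation w := greedy_weight.

Lemma weights_uptoE k i : (i < k)%N -> weights_upto k i = w i.
Proof.
elim: k => // k IH ik /=; case: eqP => [->|/eqP ne].
  by rewrite /greedy_weight /= eqxx.
by apply: IH; rewrite ltn_neqAle ne -ltnS.
Qed.

Lemma load_upto k n c : load (weights_upto k) k n c = load w k n c.
Proof.
rewrite /load big_nat_cond [RHS]big_nat_cond; apply: eq_bigr => i /andP[/andP[_ ik] _].
exact: weights_uptoE.
Qed.

Lemma greedy_weightP k : act k ->
  (forall n, (n0 <= n <= N k)%N -> w k <= room w k n) /\
  exists2 n, (n0 <= n <= N k)%N & w k = room w k n.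
Proof.
move=> ak; rewrite {1 3}/greedy_weight /= eqxx /next_weight ak.
case: Order.TotalTheory.arg_minP => /=; first exact: n0N.
move=> i n0i imin; split.
  move=> n /andP[n0n nN]; have nN' : (n < (N k).+1)%N by [].
  by have := imin (Ordinal nN') n0n; rewrite /room /= !load_upto.
exists i; first by rewrite n0i -ltnS ltn_ord.
by rewrite /room load_upto.
Qed.

Lemma greedy_weight_inactive k : ~~ act k -> w k = 0.
Proof. by move=> /negbTE ak; rewrite /greedy_weight /= eqxx /next_weight ak. Qed.

Lemma loadS K n c : load w K.+1 n c = load w K n c + (if under n c K then w K else 0).
Proof. by rewrite /load big_mkcond big_nat_recr//= -big_mkcond. Qed.

Lemma load_le_cap K n c : (n0 <= n)%N -> load w K n c <= cap n.
Proof.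
move=> n0n; elim: K => [|K IH]; first by rewrite /load big_geq.
rewrite loadS; case: ifP => [/and3P[aK nN /eqP <-]|_]; last by rewrite addr0.
have [/(_ n) H _] := greedy_weightP aK.
by have := H (introT andP (conj n0n nN)); rewrite /room lerBrDl.
Qed.

Lemma greedy_weight_ge0 k : 0 <= w k.
Proof.
case: (boolP (act k)) => [ak|/greedy_weight_inactive -> //].
have [_ [n /andP[n0n _] ->]] := greedy_weightP ak.
by rewrite subr_ge0 load_le_cap.
Qed.

Definition saturated (n : nat) (c : T) : Prop := exists K, load w K n c = cap n.

(** The weight of [k] equals the least room among its cells, so it fills the cell attaining that
    minimum. *)
Lemma ex_saturated k : act k ->
  exists2 n, (n0 <= n <= N k)%N & saturated n (anc k n).
Proof.
move=> ak; have [_ [n n0n wk]] := greedy_weightP ak; exists n => //.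
exists k.+1; rewrite loadS /under ak eqxx; case/andP: (n0n) => _ -> /=.
by rewrite wk /room addrC subrK.
Qed.

Lemma load_mono K K' n c : (K <= K')%N -> load w K n c <= load w K' n c.
Proof.
move=> KK'; rewrite /load (big_cat_nat _ KK')//= lerDl.
by apply: sumr_ge0 => i _; exact: greedy_weight_ge0.
Qed.

Hypothesis anc_tree : forall i j n n', (n0 <= n')%N -> (n' <= n)%N ->
  anc i n = anc j n -> anc i n' = anc j n'.

(* The selected cells are the maximal saturated ones, hence pairwise disjoint. *)
Lemma saturated_cover (M : R) : (forall K, \sum_(0 <= i < K) w i <= M) ->
  exists (s : nat -> nat) (sel : nat -> bool),
  [/\ forall k, sel k -> act k /\ (n0 <= s k <= N k)%N,
      forall k, act k -> exists j,
        [/\ sel j, (s j <= N k)%N & anc k (s j) = anc j (s j)] &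
      forall K, \sum_(0 <= k < K | sel k) cap (s k) <= M].
Proof.
move=> wM.
(* The least saturated level of leaf [k] gives the largest saturated cell around it. *)
have /choice[s sP] : forall k, exists n, act k ->
    [/\ (n0 <= n <= N k)%N, saturated n (anc k n) &
      forall n', (n0 <= n' <= N k)%N -> saturated n' (anc k n') -> (n <= n')%N].
  move=> k; case: (boolP (act k)) => [ak|_]; last by exists 0%N.
  pose Q n := `[< (n0 <= n <= N k)%N /\ saturated n (anc k n) >].
  have exQ : exists n, Q n.
    by have [n h1 h2] := ex_saturated ak; exists n; apply/asboolP.
  have [n /asboolP[h1 h2] nmin] := ex_minnP exQ; exists n => _; split=> // n' h1' h2'.
  by apply: nmin; apply/asboolP.
pose same j k := (s j == s k) && (anc j (s j) == anc k (s k)).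
(* Each maximal saturated cell is represented by its first leaf. *)
pose sel k := act k && [forall j : 'I_k, act j ==> ~~ same j k].
exists s, sel; split.
- by move=> k /andP[ak _]; have [] := sP k ak.
- move=> k ak.
  have exj : exists j, act j && same j k by exists k; rewrite ak /same !eqxx.
  have [j /andP[aj /andP[/eqP sjk /eqP ajk]] jmin] := ex_minnP exj.
  have [/andP[_ sN] _ _] := sP k ak.
  exists j; split; rewrite ?sjk//; last by rewrite -ajk sjk.
  rewrite /sel aj; apply/forallP => i; apply/implyP => ai; apply/negP.
  move=> /andP[/eqP sij /eqP aij].
  have : (j <= i)%N by apply: jmin; rewrite ai /same aij ajk sij sjk !eqxx.
  by rewrite leqNgt ltn_ord.
- move=> K.
  (* Loads are monotone and capped, so finitely many selected cells are full at a common stage. *)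
  have [K' HK'] : exists K', forall k, (k < K)%N -> sel k ->
      load w K' (s k) (anc k (s k)) = cap (s k).
    elim: K => [|K [K' IH]]; first by exists 0%N.
    case: (boolP (sel K)) => [selK|nsel]; last first.
      exists K' => k; rewrite ltnS leq_eqVlt => /orP[/eqP ->|/IH//].
      by rewrite (negbTE nsel).
    have aK : act K by case/andP: selK.
    have [/andP[n0s _] [K1 HK1] _] := sP K aK.
    exists (maxn K' K1) => k; rewrite ltnS leq_eqVlt => /orP[/eqP ->|kK] selk.
      apply/eqP; rewrite eq_le load_le_cap//= -HK1 load_mono//.
      exact: leq_maxr.
    have ak : act k by case/andP: selk.
    have [/andP[n0k _] _ _] := sP k ak.
    apply/eqP; rewrite eq_le load_le_cap//= -(IH k kK selk) load_mono//.
    exact: leq_maxl.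
  have -> : \sum_(0 <= k < K | sel k) cap (s k) =
      \sum_(0 <= k < K | sel k) \sum_(0 <= i < K' | under (s k) (anc k (s k)) i) w i.
    rewrite big_nat_cond [RHS]big_nat_cond; apply: eq_bigr => k /andP[/andP[_ kK] selk].
    by rewrite -HK'.
  apply: le_trans (wM K').
  rewrite (exchange_big_dep xpredT)//=; apply: ler_sum => i _.
  rewrite (big_mkord (fun k => sel k && under (s k) (anc k (s k)) i)).
  (* Two selected cells sharing leaf [i] are nested. The larger one is saturated and contains [k'],
     so minimality of [s k'] makes them equal, and then so are their representatives. *)
  have uniq_k k k' : sel k && under (s k) (anc k (s k)) i ->
     sel k' && under (s k') (anc k' (s k')) i -> (s k <= s k')%N -> k = k'.
    move=> /andP[selk /and3P[ai skN /eqP aik]] /andP[selk' /and3P[_ sk'N /eqP aik']] ss.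
    have ak : act k by case/andP: selk. have ak' : act k' by case/andP: selk'.
    have [/andP[n0k _] satk _] := sP k ak.
    have [/andP[n0k' kN'] _ mink'] := sP k' ak'.
    have E : anc k' (s k) = anc k (s k) by rewrite -aik; apply/esym/(anc_tree n0k ss).
    have ss' : s k' = s k.
      apply/eqP; rewrite eqn_leq ss andbT mink' ?n0k ?(leq_trans ss)//.
      by rewrite E.
    have same1 : same k k' by rewrite /same ss' E !eqxx.
    have same2 : same k' k by rewrite /same ss' E !eqxx.
    case: (ltngtP k k') => // kk'.
      move: selk' => /andP[_ /forallP /(_ (Ordinal kk'))].
      by rewrite ak /= same1.
    move: selk => /andP[_ /forallP /(_ (Ordinal kk'))].
    by rewrite ak' /= same2.
  have [k0 k0P|none] := pickP (fun k : 'I_K => sel k && under (s k) (anc k (s k)) i); last first.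
    by rewrite big_pred0// greedy_weight_ge0.
  rewrite (bigD1 k0)//= big_pred0 ?addr0// => k; apply/negP => /andP[kP /eqP]; apply.
  apply: val_inj; case: (leqP (s k) (s k0)) => ss; first exact: uniq_k ss.
  by apply/esym; exact: uniq_k (ltnW ss).
Qed.

End greedy_weights.

(** * Growth of the gauge and monotonicity of the Hausdorff measure *)

Section gauge_theory.
Variables (R : realType) (p : nat) (v : R -> R).
Hypothesis (v_pos : forall r : R, 0 <= r < 1 -> 0 < v r).
Hypothesis (v_incr : forall r s : R, 0 <= r -> r <= s -> s < 1 -> v r <= v s).
Hypothesis (lambda_incr : forall s t : R, 0 <= s -> s <= t -> t <= 1 ->
     gauge p.+1 v s <= gauge p.+1 v t).
Local Notation lam := (gauge p.+1 v).

Lemma gaugeE t : 0 < t -> lam t = t ^+ p * v (1 - t).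
Proof. by move=> t0; rewrite /gauge gt_eqF// subn1. Qed.

Lemma gauge0 : lam 0 = 0.
Proof. by rewrite /gauge eqxx. Qed.

Lemma gauge_gt0 t : 0 < t <= 1 -> 0 < lam t.
Proof.
move=> /andP[t0 t1]; rewrite gaugeE// mulr_gt0 ?exprn_gt0// v_pos//.
by rewrite subr_ge0 t1 gtrBl.
Qed.

Lemma gauge_ge0 t : 0 <= t <= 1 -> 0 <= lam t.
Proof.
rewrite le_eqVlt => /andP[/predU1P[<-|t0] t1]; first by rewrite gauge0.
by rewrite ltW// gauge_gt0// t0.
Qed.

(** Doubling property: for [s > t] the factor [v (1 - s)] is at most [v (1 - t)], so only the power
    grows. *)
Lemma gauge_le_scale (s t c : R) : 0 < t -> t <= 1 -> 0 <= s -> s <= 1 ->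
  1 <= c -> s <= c * t -> lam s <= c ^+ p * lam t.
Proof.
move=> t0 t1 s0 s1 c1 sct.
have lt0 : 0 <= lam t by rewrite gauge_ge0// t1 ltW.
have [st|ts] := lerP s t.
  apply: (@le_trans _ _ (lam t)); first exact: lambda_incr.
  by rewrite ler_peMl// exprn_ege1.
have s_gt0 : 0 < s by exact: lt_trans ts.
rewrite !gaugeE// mulrA -exprMn; apply: ler_pM.
- by rewrite exprn_ge0.
- by rewrite ltW// v_pos// subr_ge0 s1 gtrBl.
- by rewrite lerXn2r ?nnegrE// (le_trans s0).
- by apply: v_incr; lra.
Qed.

End gauge_theory.

Section hausdorff.
Variables (R : realType) (m : nat) (lam : R -> R).
Implicit Types A B : set 'rV[R]_m.

Lemma hausdorff_pre_mono A (d d' : R) : d <= d' ->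
  (hausdorff_pre lam A d' <= hausdorff_pre lam A d)%E.
Proof.
move=> dd'; apply: ereal_inf_le_tmp => _ [F [AF Fd ->]]; exists F; split => // j.
by apply: (lt_le_trans (Fd j)); rewrite lee_fin.
Qed.

(** Smaller [delta] admits fewer covers, so the [lim] in [hausdorff_measure] is a genuine limit. *)
Lemma hausdorff_measure_cvg A :
  cvg (hausdorff_pre lam A delta @[delta --> (0 : R)^'+]).
Proof.
apply: nonincreasing_at_right_is_cvge; near=> x => a b _ _ ab.
exact: hausdorff_pre_mono.
Unshelve. all: by end_near. Qed.

Lemma hausdorff_measure_le A (M : \bar R) :
  (\forall d \near (0 : R)^'+, (hausdorff_pre lam A d <= M)%E) ->
  (hausdorff_measure lam A <= M)%E.
Proof. by move=> H; apply: lime_le => //; exact: hausdorff_measure_cvg. Qed.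

Lemma hausdorff_measure_ge A (M : \bar R) :
  (\forall d \near (0 : R)^'+, (M <= hausdorff_pre lam A d)%E) ->
  (M <= hausdorff_measure lam A)%E.
Proof. by move=> H; apply: lime_ge => //; exact: hausdorff_measure_cvg. Qed.

Lemma ediam_ge0 A : (0 <= ediam A)%E.
Proof. by apply: ereal_sup_ubound; left. Qed.

Lemma ediam_le A (d : R) : 0 <= d ->
  (forall x y, A x -> A y -> enorm (x - y) <= d) -> (ediam A <= d%:E)%E.
Proof.
move=> d0 Ad; apply: ge_ereal_sup => _ [->|[x [y [Ax Ay ->]]]]; rewrite lee_fin//.
exact: Ad.
Qed.

Lemma ediam_ge A x y : A x -> A y -> ((enorm (x - y))%:E <= ediam A)%E.
Proof. by move=> Ax Ay; apply: ereal_sup_ubound; right; exists x, y. Qed.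

Lemma hausdorff_pre_subset A B (d : R) : A `<=` B ->
  (hausdorff_pre lam A d <= hausdorff_pre lam B d)%E.
Proof.
move=> AB; apply: ereal_inf_le_tmp => _ [F [BF Fd ->]]; exists F; split => //.
exact: subset_trans BF.
Qed.

Lemma hausdorff_measure_subset A B : A `<=` B ->
  (hausdorff_measure lam A <= hausdorff_measure lam B)%E.
Proof.
move=> AB; apply: lee_lim; [exact: hausdorff_measure_cvg..|].
by near=> d; exact: hausdorff_pre_subset.
Unshelve. all: by end_near. Qed.

End hausdorff.

Lemma nneseries_le (R : realType) (f : nat -> R) (M : R) : (forall n, 0 <= f n) ->
  (forall K, \sum_(0 <= k < K) f k <= M) ->
  (\sum_(0 <= k <oo) (f k)%:E <= M%:E)%E.
Proof.
move=> f0 fM; apply: lime_le.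
  by apply: is_cvg_nneseries => n _ _; rewrite lee_fin.
by near=> n; rewrite sumEFin lee_fin.
Unshelve. all: by end_near. Qed.

(** * Dyadic cells *)

Section dyadic_cells.
Variables (R : realType) (m : nat).
Implicit Types x y : 'rV[R]_m.

(** A half-open cube of side [2 ^ (- n)] is coded by its integer corner; the codes form a countable
    type, so cells can be enumerated. *)
Definition cell (n : nat) (x : 'rV[R]_m) : 'rV[int]_m :=
  \row_i Num.floor (2 ^+ n * x ord0 i).

(** An integer [f] is below [2 ^ n' * z] iff [2 ^ (n - n') * f] is below [2 ^ n * z], which the
    finer floor decides. *)
Lemma cell_tree x y (n n' : nat) : (n' <= n)%N -> cell n x = cell n y ->
  cell n' x = cell n' y.
Proof.
move=> nn' xy.
suff H z z' : cell n z = cell n z' -> forall i,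
    Num.floor (2 ^+ n' * z ord0 i) <= Num.floor (2 ^+ n' * z' ord0 i).
  apply/rowP => i; rewrite !mxE; apply/eqP; rewrite eq_le H//; exact: H.
move=> zz' i; have /rowP /(_ i) := zz'; rewrite !mxE => E.
rewrite floor_ge_int; set f := Num.floor _.
have c0 : 0 < (2 ^+ (n - n') : R) by rewrite exprn_gt0.
have e2 w : 2 ^+ n * w = 2 ^+ (n - n') * (2 ^+ n' * w) :> R.
  by rewrite mulrA -exprD subnK.
rewrite -(ler_pM2l c0) -e2.
have -> : 2 ^+ (n - n') * f%:~R = ((2 ^+ (n - n')) * f)%:~R :> R.
  by rewrite intrM rmorphXn.
rewrite -floor_ge_int -E floor_ge_int intrM rmorphXn/= e2 ler_pM2l//.
exact: floor_le.
Qed.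

Lemma cell_dist x y n : cell n x = cell n y -> enorm (x - y) <= m%:R * 2^-1 ^+ n.
Proof.
move=> xy; apply: enorm_le_coord => [|i]; first by rewrite exprn_ge0.
have /rowP /(_ i) := xy; rewrite !mxE => E.
have c0 : 0 < (2 ^+ n : R) by rewrite exprn_gt0.
have : `|2 ^+ n * x ord0 i - 2 ^+ n * y ord0 i| <= 1.
  have := floor_itv (2 ^+ n * x ord0 i); have := floor_itv (2 ^+ n * y ord0 i).
  by rewrite E intrD ler_norml; lra.
by rewrite -mulrBr normrM gtr0_norm// mulrC -ler_pdivlMr// div1r exprVn.
Qed.

Lemma card_near_cells x (n D : nat) : exists c : {ffun 'I_m -> 'I_(2 * D).+1} -> 'rV[int]_m,
  forall y, (forall i, `|y ord0 i - x ord0 i| <= D%:R * 2^-1 ^+ n) ->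
    exists f, cell n y = c f.
Proof.
exists (fun f : {ffun 'I_m -> 'I_(2 * D).+1} => \row_i (Num.floor (2 ^+ n * x ord0 i) - D%:Z +
  (f i : nat)%:Z)) => y xy.
have c0 : 0 < (2 ^+ n : R) by rewrite exprn_gt0.
pose k i := Num.floor (2 ^+ n * y ord0 i) - (Num.floor (2 ^+ n * x ord0 i) - D%:Z).
have kP i : 0 <= k i < (2 * D).+1.
  have yx : `|2 ^+ n * y ord0 i - 2 ^+ n * x ord0 i| <= D%:R.
    rewrite -mulrBr normrM gtr0_norm// mulrC -ler_pdivlMr//.
    by rewrite -exprVn.
  have := floor_itv (2 ^+ n * x ord0 i); have := floor_itv (2 ^+ n * y ord0 i).
  move: yx; rewrite ler_norml /k; move: (Num.floor _) (Num.floor _) => a b yx.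
  rewrite !intrD => h1 h2.
  have DE : (D%:Z)%:~R = D%:R :> R by [].
  have : (a - (b - D%:Z))%:~R > -1 :> R by rewrite !rmorphB/= DE; lra.
  have : (a - (b - D%:Z))%:~R < (2 * D).+1%:R :> R.
    by rewrite !rmorphB/= DE -natr1 natrM; lra.
  rewrite -[(2 * D).+1%:R]/(((2 * D).+1%:Z)%:~R) ltr_int.
  rewrite -[-1]/((-1)%:~R) ltr_int; lia.
have kb i : (`|k i| < (2 * D).+1)%N by have := kP i; lia.
exists [ffun i => Ordinal (kb i)]; apply/rowP => i; rewrite !mxE ffunE/=.
by have := kP i; rewrite /k; lia.
Qed.

End dyadic_cells.

Section weight_near.
Variables (R : realType) (m : nat) (act : nat -> bool) (N : nat -> nat)
  (y : nat -> 'rV[R]_m) (cap : nat -> R) (n0 : nat).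
Hypothesis n0N : forall k, act k -> (n0 <= N k)%N.
Hypothesis cap0 : forall n, 0 <= cap n.
Local Notation w := (greedy_weight act N (fun k n => cell n (y k)) cap n0).

Lemma sum_weight_near (K n D : nat) (x : 'rV[R]_m) (P : pred nat) : (n0 <= n)%N ->
  (forall j, act j -> P j -> (n <= N j)%N /\
     forall i, `|y j ord0 i - x ord0 i| <= D%:R * 2^-1 ^+ n) ->
  \sum_(j < K | P j) w j <= ((2 * D).+1 ^ m)%:R * cap n.
Proof.
move=> n0n H; have [c cP] := card_near_cells x n D.
have w0 : forall k, 0 <= w k by exact: greedy_weight_ge0.
apply: (@le_trans _ _ (\sum_(j < K | P j) \sum_(f : {ffun 'I_m -> 'I_(2 * D).+1} |
    under act N (fun k n => cell n (y k)) n (c f) j) w j)).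
  apply: ler_sum => j Pj; case: (boolP (act j)) => [aj|naj]; last first.
    by rewrite greedy_weight_inactive// sumr_ge0.
  have [nN yx] := H j aj Pj; have [f fE] := cP _ yx.
  rewrite (bigD1 f)/=; last by rewrite /under aj nN fE eqxx.
  by rewrite lerDl sumr_ge0.
rewrite (exchange_big_dep xpredT)//=.
apply: (@le_trans _ _ (\sum_(f : {ffun 'I_m -> 'I_(2 * D).+1}) cap n)); last first.
  by rewrite sumr_const card_ffun !card_ord mulr_natl.
apply: ler_sum => f _; apply: (le_trans _ (load_le_cap (fun k n => cell n (y k)) n0N cap0 K (c
  f) n0n)).
rewrite /load big_mkord [leRHS](bigID (fun j : 'I_K => P j))/=.
rewrite (eq_bigl (fun j : 'I_K => under act N (fun k n => cell n (y k)) n (c f) j && P j)).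
  by rewrite lerDl sumr_ge0.
by move=> j; rewrite andbC.
Qed.

End weight_near.

Lemma invr_pow2_small (R : realType) (e : R) : 0 < e ->
  exists n0 : nat, forall n, (n0 <= n)%N -> 2^-1 ^+ n < e.
Proof.
move=> e0; exists (Num.bound e^-1) => n n0n.
have h : e^-1 < (Num.bound e^-1)%:R by rewrite archi_boundP// invr_ge0 ltW.
rewrite exprVn -[e]invrK ltf_pV2 ?posrE ?invr_gt0// ?exprn_gt0//.
apply: (lt_le_trans h); rewrite -natrX ler_nat.
by apply: (leq_trans n0n); exact/ltnW/ltn_expl.
Qed.

Lemma fine_ediam (R : realType) (m : nat) (F : set 'rV[R]_m) (d : R) :
  (ediam F <= d%:E)%E -> 0 <= fine (ediam F) <= d.
Proof.
move=> Fd; have F0 := ediam_ge0 F.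
have Ff : ediam F \is a fin_num.
  by rewrite ge0_fin_numE// (le_lt_trans Fd)// ltry.
by rewrite fine_ge0//= -lee_fin fineK.
Qed.

(** * Covering the set of large radial values *)

Section part_a.
Variables (R : realType) (p : nat) (v : R -> R).
Local Notation m := p.+1.
Hypothesis (p0 : (0 < p)%N).
Hypothesis (v_pos : forall r : R, 0 <= r < 1 -> 0 < v r).
Hypothesis (v_incr : forall r s : R, 0 <= r -> r <= s -> s < 1 -> v r <= v s).
Hypothesis (v_lim : v r @[r --> (1 : R)^'-] --> +oo).
Hypothesis (lambda_incr : forall s t : R, 0 <= s -> s <= t -> t <= 1 ->
     gauge m v s <= gauge m v t).
Local Notation lam := (gauge m v).
Variable u : 'rV[R]_m -> R.
Hypotheses (hu : harmonic_on (@unit_ball R m) u) (up : positive_on (@unit_ball R m) u).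

(** The level sets whose union over [kappa = 1 / (n + 1)] is [F_plus]. The height [t = 1 - r] later
    fixes the size of the cell attached to [y]. *)
Definition often_large (kappa : R) : set 'rV[R]_m :=
  [set y | enorm y = 1 /\ forall tau : R, 0 < tau -> exists2 t, 0 < t < tau &
     kappa * v (1 - t) <= u ((1 - t) *: y)].

(** [3 ^ m] cells meet a ball of comparable size, and [3 ^ p] is the gauge growth from [t i] to
    their side, at most [3 * 2 ^ l * t i]. *)
Let packing_constant : R := 3 ^+ m * 3 ^+ p.

Let packing_constant_ge0 : 0 <= packing_constant.
Proof. by rewrite mulr_ge0// exprn_ge0. Qed.

Let total_bound kappa := comparison_constant p packing_constant kappa * u 0.

Section fixed_scale.
Variables (kappa : R) (n0 : nat).
Hypothesis kappa0 : 0 < kappa.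
(** Bounds the total capacity of the level-[n0] cells meeting the cube [[-1, 1]^m], hence the whole
    weight. *)
Let B : R := ((2 * 2 ^ n0).+1 ^ m)%:R * lam (2^-1 ^+ n0).
Variables (y : nat -> 'rV[R]_m) (t : nat -> R) (N : nat -> nat) (act : nat -> bool).
Hypotheses (y1 : forall k, enorm (y k) = 1) (t0 : forall k, 0 < t k)
  (t2 : forall k, t k <= 2^-1) (n0N : forall k, (n0 <= N k)%N)
  (Nt : forall k, 2^-1 ^+ N k <= t k)
  (vB : forall k, B * (2 * 2 ^+ n0) ^+ p <= v (1 - t k))
  (uy : forall k, kappa * v (1 - t k) <= u ((1 - t k) *: y k)).
Let cap n := lam (2^-1 ^+ n).
Local Notation w := (greedy_weight act N (fun k n => cell n (y k)) cap n0).
Let X k := (1 - t k) *: y k.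

Let half_le1 n : 0 < (2^-1 : R) ^+ n <= 1.
Proof.
have h : (2^-1 : R) <= 1 by lra.
by rewrite exprn_gt0//= exprn_ile1.
Qed.

Let cap0 n : 0 <= cap n.
Proof. by apply: ltW; apply: gauge_gt0. Qed.

Let w0 k : 0 <= w k.
Proof. by apply: greedy_weight_ge0 => //. Qed.

Let enormX k : enorm (X k) = 1 - t k.
Proof. by rewrite enormZ y1 mulr1 ger0_norm//; have := t2 k; lra. Qed.

Let v1 k : 0 < v (1 - t k).
Proof. by apply: v_pos; have := t0 k; have := t2 k; lra. Qed.

Let B0 : 0 <= B.
Proof. by rewrite mulr_ge0// cap0. Qed.

(* Small balls meet boundedly many cells of comparable size. For large balls the
   total capacity [B] of the top level suffices, since [vB] makes [v] huge. *)
Lemma greedy_packing (K : nat) (i : nat) (x : 'rV[R]_m) (l : nat) :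
  enorm (x - X i) <= t i / 4 ->
  \sum_(j < K | enorm (x - X j) <= 2 ^+ l * (t i / 8)) w j <=
  packing_constant * (t i ^+ p * v (1 - t i)) * 2 ^+ (l * p).
Proof.
move=> xi; set s := 2 ^+ l * (t i / 8).
have s0 : 0 < s by rewrite mulr_gt0 ?exprn_gt0// divr_gt0.
have tis : t i <= 8 * s.
  have : 1 <= (2 : R) ^+ l by rewrite exprn_ege1// ler1n.
  by rewrite /s; have := t0 i; nra.
have s8 : 8 * s = 2 ^+ l * t i by rewrite /s; field.
have lami : lam (t i) = t i ^+ p * v (1 - t i) by rewrite gaugeE.
(* [1 - |x| <= 5 / 4 * t i <= 10 * s], and [X j] is within [s] of [x]. Then [y j] is within
   [t j + s <= 12 * s] of [x], the origin of the 12 below. *)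
have tj j : enorm (x - X j) <= s -> t j <= 11 * s.
  move=> xj; have := enorm_dist x (X i); have := enorm_dist x (X j).
  by rewrite !enormX !ler_norml; lra.
have [near|far] := lerP (12 * s) (2^-1 ^+ n0).
  (* The least such [n] is the finest level whose side is still at least [12 * s]; the leaves [j]
     concerned have [t j < 2 ^ (- n)], so they reach level [n]. *)
  have exn : exists n, (n0 <= n)%N && (2^-1 ^+ n.+1 < 12 * s).
    have s12 : 0 < 12 * s by rewrite mulr_gt0.
    have [n1 n1P] := invr_pow2_small s12.
    exists (maxn n0 n1); rewrite leq_maxl /=; apply: n1P.
    by apply: leqW; exact: leq_maxr.
  have [n /andP[n0n ns] nmin] := ex_minnP exn.
  have sn : 12 * s <= 2^-1 ^+ n.
    move: n0n nmin; rewrite leq_eqVlt => /predU1P[<- //|n0n nmin].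
    rewrite leNgt; apply/negP => h.
    have n1 : n.-1.+1 = n by rewrite prednK// (leq_ltn_trans _ n0n).
    have n0n1 : (n0 <= n.-1)%N by rewrite -ltnS n1.
    by have := nmin n.-1; rewrite n1 h n0n1 -ltnS n1 ltnn => /(_ isT).
  have ns24 : 2^-1 ^+ n <= 3 * 2 ^+ l * t i.
    by move: ns; rewrite exprS -mulrA -s8; lra.
  apply: (@le_trans _ _ (((2 * 1).+1 ^ m)%:R * cap n)).
    apply: (@sum_weight_near R m act N y cap n0 (fun k _ => n0N k) cap0 K n 1 x
      (fun j => enorm (x - X j) <= s)) => // j aj xj; split.
      rewrite leqNgt; apply/negP => nN.
      have : 2^-1 ^+ n <= 2^-1 ^+ N j :> R by rewrite ler_wiXn2l ?(ltnW nN)//; lra.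
      by have := tj j xj; have := Nt j; lra.
    move=> k; rewrite mul1r; apply: le_trans sn.
    have -> : y j ord0 k - x ord0 k = (y j - x) ord0 k by rewrite !mxE.
    apply: (le_trans (coord_le_enorm _ _)).
    apply: (le_trans (enorm_triangleB (y j) (X j) x)).
    have -> : y j - X j = t j *: y j by rewrite /X scalerBl scale1r opprB addrC subrK.
    rewrite enormZ y1 mulr1 gtr0_norm// (enormB (X j)).
    by have := tj j xj; lra.
  have h := half_le1 n.
  have c1 : 1 <= 3 * 2 ^+ l :> R.
    have : 1 <= (2 : R) ^+ l by rewrite exprn_ege1// ler1n.
    by lra.
  have ti1 : t i <= 1 by have := t2 i; lra.
  case/andP: h => h0 h1.
  have := gauge_le_scale v_pos v_incr lambda_incr (t0 i) ti1 (ltW h0) h1 c1 ns24.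
  rewrite -/(cap n) lami exprMn -exprM => H.
  apply: (@le_trans _ _ (3 ^+ m * (3 ^+ p * 2 ^+ (l * p) * (t i ^+ p * v (1 - t i))))).
    by rewrite natrX ler_wpM2l// exprn_ge0.
  by rewrite /packing_constant le_eqVlt; apply/orP; left; apply/eqP; ring.
apply: (@le_trans _ _ B).
  apply: (@sum_weight_near R m act N y cap n0 (fun k _ => n0N k) cap0 K n0 (2 ^ n0) 0
    (fun j => enorm (x - X j) <= s)) => // j aj xj; split => // k.
  rewrite mxE subr0 natrX exprVn mulfV ?expf_neq0//.
  by rewrite -(y1 j); exact: coord_le_enorm.
(* [q = 16 * s * 2 ^ n0 > 16 / 12] in this case, so [B <= q ^ p * B], which [vB] turns into a
   multiple of [v (1 - t i)]. *)
set q : R := (2 ^+ l * t i) * (2 * 2 ^+ n0).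
have q1 : 1 <= q.
  rewrite /q -s8.
  have : 2^-1 ^+ n0 * 2 ^+ n0 = 1 :> R by rewrite exprVn mulVf// expf_neq0.
  have : 0 < 2 ^+ n0 :> R by rewrite exprn_gt0.
  move: (2^-1 ^+ n0) (2 ^+ n0) far => a b far b0 ab.
  have : a * b < 12 * s * b by rewrite ltr_pM2r.
  by lra.
have P1 : 1 <= packing_constant by rewrite /packing_constant mulr_ege1// exprn_ege1// ler1n.
apply: (@le_trans _ _ (q ^+ p * B)).
  by rewrite ler_peMl// exprn_ege1.
apply: (@le_trans _ _ ((2 ^+ l * t i) ^+ p * v (1 - t i))).
  rewrite /q [X in X * B]exprMn -mulrA ler_wpM2l ?exprn_ge0 ?mulr_ge0 ?exprn_ge0// ?(ltW (t0 i))//.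
  by rewrite mulrC.
have -> : packing_constant * (t i ^+ p * v (1 - t i)) * 2 ^+ (l * p) =
    packing_constant * ((2 ^+ l * t i) ^+ p * v (1 - t i)).
  by rewrite exprMn exprM; ring.
rewrite ler_peMl// mulr_ge0// ?(ltW (v1 i))// exprn_ge0// mulr_ge0 ?exprn_ge0//.
exact: ltW.
Qed.

Lemma greedy_total K : \sum_(0 <= i < K) w i <= total_bound kappa.
Proof.
rewrite big_mkord.
apply: (@weight_total_le R p 'I_K u y t (fun k => v (1 - t k)) w
  packing_constant kappa) => //.
by move=> i x l xi; exact: greedy_packing.
Qed.

End fixed_scale.
Let total_bound_ge0 kappa : 0 < kappa -> 0 <= total_bound kappa.
Proof.
move=> k0; rewrite mulr_ge0//; last first.
  by rewrite ltW// up// /unit_ball/= enorm0 ltr01.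
rewrite /comparison_constant divr_ge0//; last first.
  by rewrite ltW// mulr_gt0// harnack_constant_gt0.
apply: mulr_ge0; last exact: exprn_ge0.
apply: mulr_ge0; last exact: exprn_ge0.
by apply: mulr_ge0; [rewrite divr_ge0|exact: packing_constant_ge0].
Qed.

(** The bound is free of [d]: the coarsest level [n0] and the height limit [tau0] depend on [d], but
    [greedy_total] does not see them. The factor [m ^ p] accounts for the diameter of a cell
    exceeding its side. *)
Lemma often_large_pre (kappa d : R) : 0 < kappa -> 0 < d ->
  (hausdorff_pre lam (often_large kappa) d <=
    (m%:R ^+ p * total_bound kappa)%:E)%E.
Proof.
move=> kappa0 d0.
have tb0 := total_bound_ge0 kappa0.
have mR0 : 0 < m%:R :> R by rewrite ltr0n.
have dm0 : 0 < Num.min d 1 / m%:R by rewrite divr_gt0// lt_min d0 ltr01.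
have [n0 n0P] := invr_pow2_small dm0.
have small n : (n0 <= n)%N -> m%:R * 2^-1 ^+ n < d /\ m%:R * 2^-1 ^+ n < 1 :> R.
  by move=> /n0P; rewrite ltr_pdivlMr// lt_min => /andP[h1 h2]; rewrite mulrC.
pose B : R := ((2 * 2 ^ n0).+1 ^ m)%:R * lam (2^-1 ^+ n0).
have [tau0 tau00 tauP] : exists2 tau0 : R, 0 < tau0 &
    forall t, 0 < t < tau0 -> B * (2 * 2 ^+ n0) ^+ p <= v (1 - t).
  have /cvgryPge /(_ (B * (2 * 2 ^+ n0) ^+ p)) [e /= e0 eP] := v_lim.
  exists e => // t /andP[t0 te]; apply: (eP (1 - t)).
    by rewrite /ball/= opprB addrCA subrr addr0 gtr0_norm.
  by rewrite gtrBl.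
have half0 n : 0 < 2^-1 ^+ n :> R by rewrite exprn_gt0.
pose good (y : 'rV[R]_m) (t : R) (N : nat) := [/\ 0 < t < tau0, t <= 2^-1, (n0 <= N)%N,
   2^-1 ^+ N <= t & kappa * v (1 - t) <= u ((1 - t) *: y)].
have /choice[tN tNP] : forall y, exists tN : R * nat, often_large kappa y -> good y tN.1 tN.2.
  move=> y; have [[_ yk]|ny] := pselect (often_large kappa y); last by exists (0, 0%N).
  have tau1 : 0 < Num.min tau0 2^-1 by rewrite lt_min tau00 invr_gt0 ltr0n.
  have [t /andP[t0]] := yk _ tau1; rewrite lt_min => /andP[tt0 t2] tu.
  have [N NP] := invr_pow2_small t0.
  exists (t, maxn n0 N) => _; split => //=; first by rewrite t0.
  - exact: ltW.
  - exact: leq_maxl.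
  - by rewrite ltW// NP// leq_maxr.
have [[y0 y0A]|empty] := pselect (often_large kappa !=set0); last first.
  apply: (@le_trans _ _ 0%E); last by rewrite lee_fin mulr_ge0// exprn_ge0.
  have e0 : ediam (set0 : set 'rV[R]_m) = 0%E.
    by apply/eqP; rewrite eq_le ediam_ge0 andbT; exact: ediam_le.
  apply: ereal_inf_lbound; exists (fun=> set0); split.
  - by move=> x xA; case: empty; exists x.
  - by move=> j; rewrite e0 lte_fin.
  - by rewrite eseries0// => k _ _; rewrite e0 gauge0.
(* The set may be uncountable, but the pairs (level, cell) are countable: leaf [k] is the pair with
   code [k], and one point [y k] represents it. Inactive codes get a dummy point of the set, so that
   the estimates hold for every [k]. *)
pose leaf (k : nat) (y : 'rV[R]_m) := often_large kappa y /\
  unpickle k = Some ((tN y).2, cell (tN y).2 y).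
pose act k := `[< exists y, leaf k y >].
have /choice[y yP] : forall k, exists y, often_large kappa y /\ (act k -> leaf k y).
  move=> k; case: (boolP (act k)) => [/asboolP[y yl]|_]; last by exists y0.
  by exists y; split => //; case: yl.
pose t k := (tN (y k)).1; pose N k := (tN (y k)).2.
have gd k : good (y k) (t k) (N k) by apply: tNP; case: (yP k).
have y1 k : enorm (y k) = 1 by case: (yP k) => -[].
have t0 k : 0 < t k by case: (gd k) => /andP[].
have t2 k : t k <= 2^-1 by case: (gd k).
have n0N k : (n0 <= N k)%N by case: (gd k).
have Nt k : 2^-1 ^+ N k <= t k by case: (gd k).
have vB k : B * (2 * 2 ^+ n0) ^+ p <= v (1 - t k) by apply: tauP; case: (gd k).
have uy k : kappa * v (1 - t k) <= u ((1 - t k) *: y k) by case: (gd k).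
have half1 n : 2^-1 ^+ n <= 1 :> R by rewrite exprn_ile1//; lra.
have cap0 n : 0 <= lam (2^-1 ^+ n).
  by apply/ltW/gauge_gt0 => //; rewrite half0 half1.
have tot := greedy_total kappa0 act y1 t0 t2 n0N Nt vB uy.
have [s [sel [selP cover sumcap]]] := @saturated_cover R _ act N _ _ n0
  (fun k _ => n0N k) cap0 (fun i j n n' _ n'n => @cell_tree _ _ (y i) (y j) n n' n'n) _ tot.
pose F k : set 'rV[R]_m := [set x | sel k /\ cell (s k) x = cell (s k) (y k)].
have Fd k : (ediam (F k) <= (if sel k then m%:R * 2^-1 ^+ s k else 0)%:E)%E.
  apply: ediam_le; first by case: ifP => // _; rewrite mulr_ge0// ltW.
  by move=> x x' [-> xc] [_ x'c]; apply: cell_dist; rewrite xc x'c.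
have n0s k : sel k -> (n0 <= s k)%N by move=> /selP[_ /andP[]].
have lF0 k : 0 <= lam (fine (ediam (F k))).
  have := fine_ediam (Fd k); case: ifP => [selk|_] /andP[f0 f1]; apply: gauge_ge0 => //.
    by rewrite f0 (le_trans f1)// ltW//; case: (small _ (n0s k selk)).
  by rewrite f0 (le_trans f1).
have lF k : lam (fine (ediam (F k))) <= if sel k then m%:R ^+ p * lam (2^-1 ^+ s k) else 0.
  have := fine_ediam (Fd k); case: ifP => [selk|_] /andP[f0 f1]; last first.
    by rewrite (_ : fine _ = 0) ?gauge0//; apply/eqP; rewrite eq_le f1.
  have [_ s1] := small _ (n0s k selk).
  apply: gauge_le_scale => //; last by rewrite ler1n.
  exact: le_trans f1 (ltW s1).
apply: (@le_trans _ _ (\sum_(0 <= k <oo) (lam (fine (ediam (F k))))%:E)%E).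
  apply: ereal_inf_lbound; exists F; split => //.
    (* [x] shares the cell of level [N k] with the representative of its leaf, hence also the
       coarser selected cell. *)
    move=> x xA; have [_ _ _ _ _] := tNP x xA.
    pose k := pickle ((tN x).2, cell (tN x).2 x).
    have ak : act k by apply/asboolP; exists x; split => //; rewrite pickleK.
    have [_ /(_ ak)[_]] := yP k; rewrite pickleK => -[NE cE].
    have [j [selj sN aj]] := cover k ak.
    exists j => //; split => //; apply: etrans aj.
    by apply: (@cell_tree _ _ x (y k) (N k)) => //; rewrite -cE /N -NE.
  move=> k; apply: (le_lt_trans (Fd k)); rewrite lte_fin; case: ifP => // selk.
  by case: (small _ (n0s k selk)).
apply: nneseries_le => // K; apply: (@le_trans _ _ (\sum_(0 <= k < K | sel k) m%:R ^+ p * lam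
  (2^-1 ^+ s k))).
  by rewrite [leRHS]big_mkcond; apply: ler_sum => k _.
by rewrite -big_distrr/= ler_wpM2l ?exprn_ge0.
Qed.

Lemma F_plusE : F_plus v u = \bigcup_n often_large (n.+1%:R^-1).
Proof.
apply/seteqP; split=> y.
  move=> [y1 ylim].
  (* The upper limit may be [+oo]; half of it, or 1, is a positive real below it. *)
  have [kappa kappa0 kl] : exists2 kappa : R, 0 < kappa &
      (kappa%:E < limf_esup (fun r : R => (u (r *: y) / v r)%:E) (1 : R)^'-)%E.
    move: ylim; case: (limf_esup _ _) => [l|_|//]; last by exists 1; rewrite ?ltry.
    rewrite lte_fin => l0; exists (l / 2); rewrite ?divr_gt0// lte_fin.
    by rewrite ltr_pdivrMr// mulr_natr mulr2n ltrDl.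
  have kV : 0 <= kappa^-1 by rewrite invr_ge0 ltW.
  exists (Num.bound kappa^-1) => //; split => // tau tau0.
  have kk : (Num.bound kappa^-1).+1%:R^-1 <= kappa :> R.
    rewrite -[leRHS]invrK lef_pV2 ?posrE ?invr_gt0// ltW//.
    by apply: (lt_le_trans (archi_boundP kV)); rewrite ler_nat.
  pose V := [set r : R | 1 - Num.min tau 1 < r /\ r < 1].
  have V1 : (1 : R)^'- V.
    have tau1 : 0 < Num.min tau 1 by rewrite lt_min tau0 ltr01.
    exists (Num.min tau 1) => //= r; rewrite /ball/= => r1 lt1; split => //.
    by move: r1; rewrite gtr0_norm ?subr_gt0//; lra.
  have : (kappa%:E < ereal_sup ((fun r : R => (u (r *: y) / v r)%:E) @` V))%E.
    by apply: (lt_le_trans kl); apply: ereal_inf_lbound; exists V.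
  move=> /ereal_sup_gt[_ [r [rV r1] <-]]; rewrite lte_fin => kr.
  have mt : Num.min tau 1 <= tau by rewrite ge_min lexx.
  have m1 : Num.min tau 1 <= 1 by rewrite ge_min lexx orbT.
  have vr : 0 < v r by apply: v_pos; lra.
  exists (1 - r); first by lra.
  rewrite opprB addrCA subrr addr0.
  apply: (@le_trans _ _ (kappa * v r)); first by rewrite ler_pM2r.
  by rewrite -ler_pdivlMr// ltW.
move=> [n _ [y1 yl]]; split => //.
apply: (@lt_le_trans _ _ (n.+1%:R^-1)%:E); first by rewrite lte_fin invr_gt0.
apply: le_ereal_inf_tmp => _ [V [e /= e0 eV] <-].
have e1 : 0 < Num.min e 1 by rewrite lt_min e0 ltr01.
have [t /andP[t0]] := yl _ e1; rewrite lt_min => /andP[te t1] tu.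
have vr : 0 < v (1 - t) by apply: v_pos; lra.
apply: (@le_trans _ _ (u ((1 - t) *: y) / v (1 - t))%:E).
  by rewrite lee_fin ler_pdivlMr.
apply: ereal_sup_ubound; exists (1 - t) => //; apply: eV; last by rewrite /= gtrBl.
by rewrite /ball/= opprB addrCA subrr addr0 gtr0_norm.
Qed.

Lemma part_a : exists A : nat -> set 'rV[R]_m,
  F_plus v u = \bigcup_n A n /\
  forall n, (hausdorff_measure lam (A n) < +oo)%E.
Proof.
exists (fun n => often_large (n.+1%:R^-1)); split; first exact: F_plusE.
move=> n; have n0 : 0 < n.+1%:R^-1 :> R by rewrite invr_gt0.
apply: (@le_lt_trans _ _ (m%:R ^+ p * total_bound (n.+1%:R^-1))%:E); last exact: ltry.
apply: hausdorff_measure_le; near=> d; apply: often_large_pre => //.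
Unshelve. all: by end_near. Qed.

End part_a.

(** * Part (b) *)

(** The image of an ultrafilter is an ultrafilter, and in the compact [[- M, M]] it converges. A
    single [U] serves all bounded sequences, which makes the limit linear. *)
Lemma ultrafilter_bounded_cvg (R : realType) : exists U : set_system nat,
  [/\ ProperFilter U, forall A, (\oo)%classic A -> U A &
    forall (a : nat -> R) (M : R), (forall n, `|a n| <= M) -> cvg (a @ U)].
Proof.
have [U [UU sU]] := ultraFilterLemma (_ : ProperFilter (\oo : set_system nat)).
exists U; split => // [|a M aM]; first exact: ultra_proper.
have UP : ProperFilter U by exact: ultra_proper.
have ultra : UltraFilter (a @ U).
  split; first exact: fmap_proper_filter.
  move=> G PG aG; apply/seteqP; split=> // A GA.
  have [//|nA] := in_ultra_setVsetC (a @^-1` A) UU.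
  have GnA : G (~` A) by apply: aG.
  have [x [Ax nAx]] := filter_ex (filterI GA GnA).
  by case: nAx.
have cpt := @segment_compact R (- M) M; rewrite compact_ultra in cpt.
have [|x [_ ax]] := cpt _ ultra.
  apply: (@filterS _ U _ setT) => [n _ /=|]; last exact: filterT.
  by rewrite in_itv/= -ler_norml.
exact: (cvgP x).
Qed.

(** * Differentiation under a bounded functional *)

Section bounded_functional.
Variables (R : realType) (m : nat) (Z : set 'rV[R]_m) (Lam : ('rV[R]_m -> R) -> R).
Implicit Types f g : 'rV[R]_m -> R.

Definition bounded_on f : Prop := exists M : R, forall z, Z z -> `|f z| <= M.

Hypothesis LamD : forall f g, bounded_on f -> bounded_on g ->
  Lam (fun z => f z + g z) = Lam f + Lam g.
Hypothesis LamZ : forall (c : R) f, bounded_on f ->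
  Lam (fun z => c * f z) = c * Lam f.
Hypothesis Lam_le : forall f (M : R), bounded_on f -> (forall z, Z z -> f z <= M) ->
  Lam f <= M.

Lemma bounded_onD f g : bounded_on f -> bounded_on g ->
  bounded_on (fun z => f z + g z).
Proof.
move=> [M fM] [N gN]; exists (M + N) => z Zz; apply: (le_trans (ler_normD _ _)).
by apply: lerD; [exact: fM|exact: gN].
Qed.

Lemma bounded_onZ (c : R) f : bounded_on f -> bounded_on (fun z => c * f z).
Proof.
by move=> [M fM]; exists (`|c| * M) => z Zz; rewrite normrM ler_wpM2l// fM.
Qed.

Lemma Lam_norm_le f (M : R) : (forall z, Z z -> `|f z| <= M) -> `|Lam f| <= M.
Proof.
move=> fM; have bf : bounded_on f by exists M.
rewrite ler_norml; apply/andP; split; last first.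
  by apply: Lam_le => // z Zz; exact: le_trans (ler_norm _) (fM z Zz).
rewrite lerNl -mulN1r -LamZ//; apply: Lam_le; first exact: bounded_onZ.
by move=> z Zz; rewrite mulN1r (le_trans (ler_norm _))// normrN fM.
Qed.

Lemma LamB f g : bounded_on f -> bounded_on g ->
  Lam (fun z => f z - g z) = Lam f - Lam g.
Proof.
move=> bf bg; rewrite -[- Lam g]mulN1r -LamZ// -LamD//; last exact: bounded_onZ.
by congr Lam; apply/funext => z; rewrite mulN1r.
Qed.

Lemma Lam_sum (I : eqType) (s : seq I) (F : I -> 'rV[R]_m -> R) :
  (forall i, bounded_on (F i)) ->
  bounded_on (fun z => \sum_(i <- s) F i z) /\
  Lam (fun z => \sum_(i <- s) F i z) = \sum_(i <- s) Lam (F i).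
Proof.
move=> bF; elim: s => [|i s [IHb IH]].
  have E : (fun z : 'rV[R]_m => \sum_(i <- [::]) F i z) = (fun=> 0).
    by apply/funext => z; rewrite big_nil.
  rewrite big_nil; split; first by exists 0 => z _; rewrite big_nil normr0.
  by apply/eqP; rewrite -normr_le0 E; apply: Lam_norm_le => z _; rewrite normr0.
have E : (fun z => \sum_(j <- i :: s) F j z) = (fun z => F i z + \sum_(j <- s) F j z).
  by apply/funext => z; rewrite big_cons.
by rewrite E big_cons; split; [exact: bounded_onD|rewrite LamD// IH].
Qed.

Lemma ucont_bounded (x : 'rV[R]_m) (F : 'rV[R]_m -> 'rV[R]_m -> R) :
  ucont Z x F -> bounded_on (fun z => F z x).
Proof. by case. Qed.

Lemma Lam_continuous (x : 'rV[R]_m) (F : 'rV[R]_m -> 'rV[R]_m -> R) :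
  ucont Z x F -> (\forall y \near x, bounded_on (fun z => F z y)) ->
  {for x, continuous (fun y => Lam (fun z => F z y))}.
Proof.
move=> ucF bF; have [_ cF] := ucF.
apply/(@cvgrPdist_le _ _ _ _ (nbhs_filter x)) => e e0.
apply: (@filterS _ _ (nbhs_filter x) _ _ _ (@filterI _ _ (nbhs_filter x) _ _ bF (cF e e0))).
move=> y [by_ Fe]; rewrite distrC -LamB//; last exact: ucont_bounded ucF.
exact: Lam_norm_le.
Qed.

(** For each pole the difference quotient is [G z] at an intermediate point. [ucont] makes it close
    to [G z x] uniformly in [z], and [Lam] preserves uniform bounds. *)
Lemma Lam_is_derive (x v : 'rV[R]_m) (F G : 'rV[R]_m -> 'rV[R]_m -> R) :
  (\forall y \near x, bounded_on (fun z => F z y) /\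
     forall z, Z z -> is_derive y v (F z) (G z y)) ->
  ucont Z x G ->
  is_derive x v (fun y => Lam (fun z => F z y)) (Lam (fun z => G z x)).
Proof.
move=> dF ucG; have [bG cG] := ucG.
have [bFx _] := @nbhs_singleton _ _ _ dF.
have L : (fun h : R => h^-1 *: (Lam (fun z => F z (h *: v + x)) - Lam (fun z => F z x)))
    @ 0^' --> Lam (fun z => G z x).
  apply/cvgrPdist_le => e e0.
  have /near_enorm[d d0 dP] := @filterI _ _ (nbhs_filter x) _ _ dF (cG e e0).
  have v1 : 0 < enorm v + 1 by rewrite ltr_wpDl// enorm_ge0.
  apply/nbhs_ballP; exists (d / (enorm v + 1)); first exact: divr_gt0.
  move=> h; rewrite /ball/= sub0r normrN ltr_pdivlMr// => hd h0.
  have near_t (t : R) : 0 <= t <= 1 -> enorm (x - (x + (t * h) *: v)) < d.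
    move=> /andP[t0 t1]; rewrite opprD addNKr enormN enormZ.
    apply: le_lt_trans hd; rewrite normrM (ger0_norm t0) -mulrA.
    apply: (@le_trans _ _ (`|h| * enorm v)).
      by rewrite ler_piMl// mulr_ge0// enorm_ge0.
    by rewrite ler_wpM2l// lerDl.
  have [[bFh _] _] := dP _ (near_t 1 (ltac:(by rewrite ler01 lexx))).
  move: bFh; rewrite mul1r => bFh.
  rewrite [h *: v + x]addrC -LamB// -[_ *: _]LamZ; last first.
    by apply: bounded_onD => //; rewrite (_ : (fun _ => _) = (fun z => -1 * F z x));
      [exact: bounded_onZ|apply/funext => z; rewrite mulN1r].
  rewrite -LamB//; last first.
    apply: bounded_onZ; apply: bounded_onD => //.
    by rewrite (_ : (fun _ => _) = (fun z => -1 * F z x));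
      [exact: bounded_onZ|apply/funext => z; rewrite mulN1r].
  apply: Lam_norm_le => z Zz.
  pose phi (t : R) := F z (x + (t * h) *: v).
  have dphi (t : R) : 0 <= t <= 1 -> is_derive t 1 phi (G z (x + (t * h) *: v) * h).
    move=> t01; have [[_ /(_ z Zz) d1] _] := dP _ (near_t t t01).
    have d2 := is_derive_slice d1.
    have d3 : is_derive t 1 (fun s : R => s * h) h.
      rewrite (_ : (fun _ => _) = h \*: id); last first.
        by apply/funext => s; rewrite /= mulrC.
      by apply: is_derive_eq; rewrite [LHS]mulr1.
    exact: (@is_derive1_comp R _ (fun s : R => s * h) t _ _ d2 d3).
  have [||t t01 E] := @MVT R phi (fun t => G z (x + (t * h) *: v) * h) 0 1 ltr01.
  - by move=> t; rewrite in_itv/= => /andP[t0 t1]; apply: dphi; rewrite !ltW.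
  - apply: derivable_within_continuous => t; rewrite in_itv/= => t01.
    by have [] := dphi t t01.
  have {}t01 : 0 <= t <= 1 by move: t01; rewrite in_itv/= => /andP[? ?]; rewrite !ltW.
  have -> : F z (x + h *: v) - F z x = phi 1 - phi 0.
    by rewrite /phi mul1r mul0r scale0r addr0.
  rewrite E subr0 mulr1 mulrCA mulVf// mulr1 distrC.
  by have [_ /(_ z Zz)] := dP _ (near_t t t01).
by apply: DeriveDef; [exact: cvgP L | exact: cvg_lim L].
Qed.

End bounded_functional.

Section poisson_integral.
Variables (R : realType) (m : nat) (Lam : ('rV[R]_m -> R) -> R).
Local Notation Z := (@unit_sphere R m).
Hypothesis LamD : forall f g, bounded_on Z f -> bounded_on Z g ->
  Lam (fun z => f z + g z) = Lam f + Lam g.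
Hypothesis LamZ : forall (c : R) f, bounded_on Z f ->
  Lam (fun z => c * f z) = c * Lam f.
Hypothesis Lam_le : forall f (M : R), bounded_on Z f -> (forall z, Z z -> f z <= M) ->
  Lam f <= M.

Lemma harmonic_poisson_integral :
  harmonic_on (@unit_ball R m) (fun x => Lam (fun z => poisson z x)).
Proof.
have oB := @open_unit_ball R m.
have nB (x : 'rV[R]_m) : unit_ball x -> \forall y \near x, unit_ball y by move=> Bx; move: oB;
  rewrite openE => /(_ x Bx).
have zB (z : 'rV[R]_m) : Z z -> enorm z <= 1 by move=> ->.
have d0 (x : 'rV[R]_m) : unit_ball x -> 0 < 1 - enorm x by rewrite subr_gt0.
have dZ (x z : 'rV[R]_m) : Z z -> 1 - enorm x <= enorm (x - z).
  by move=> Zz; have := enorm_dist x z; rewrite Zz ler_norml; lra.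
have u0 (x : 'rV[R]_m) (Bx : unit_ball x) := ucont_poisson zB (d0 x Bx) (dZ x).
have u1 (x : 'rV[R]_m) (Bx : unit_ball x) := ucont_dpoisson zB (d0 x Bx) (dZ x).
have u2 (x : 'rV[R]_m) (Bx : unit_ball x) := ucont_d2poisson zB (d0 x Bx) (dZ x).
have neq (y z : 'rV[R]_m) : unit_ball y -> Z z -> y != z.
  move=> By Zz; apply: contraTneq By => ->.
  by rewrite /unit_ball/= Zz ltxx.
have near_of (P : set 'rV[R]_m) x : unit_ball x -> (forall y, unit_ball y -> P y) ->
    \forall y \near x, P y.
  by move=> Bx BP; apply: (@filterS _ _ (nbhs_filter x) _ _ _ (nB x Bx)).
apply: (@harmonic_data_on _ _ _ oB _
  (fun i x => Lam (fun z => dpoisson z i x))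
  (fun i j x => Lam (fun z => d2poisson z i j x))) => x Bx; split.
- apply: (Lam_continuous LamD LamZ Lam_le (u0 x Bx)); apply: near_of => // y By.
  exact: ucont_bounded (u0 y By).
- move=> i; split.
    apply: (Lam_is_derive LamD LamZ Lam_le _ (u1 x Bx i)); apply: near_of => // y By.
    split; first exact: ucont_bounded (u0 y By).
    by move=> z Zz; apply: is_derive_poisson; exact: neq.
  apply: (Lam_continuous LamD LamZ Lam_le (u1 x Bx i)); apply: near_of => // y By.
  exact: ucont_bounded (u1 y By i).
- move=> i j; split.
    apply: (Lam_is_derive LamD LamZ Lam_le _ (u2 x Bx i j)); apply: near_of => // y By.
    split; first exact: ucont_bounded (u1 y By i).
    by move=> z Zz; apply: is_derive_dpoisson; exact: neq.
  apply: (Lam_continuous LamD LamZ Lam_le (u2 x Bx i j)); apply: near_of => // y By.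
  exact: ucont_bounded (u2 y By i j).
- have [_ <-] := Lam_sum LamD LamZ Lam_le (index_enum 'I_m)
    (fun i => ucont_bounded (u2 x Bx i i)).
  apply/eqP; rewrite -normr_le0; apply: (Lam_norm_le LamZ Lam_le) => z Zz.
  by rewrite lap_poisson ?normr0//; exact: neq.
Qed.

End poisson_integral.

Lemma card_ord_interval (n a c : nat) (A : pred 'I_n) :
  (forall j, A j -> (a <= j < a + c)%N) -> (#|A| <= c)%N.
Proof.
move=> Aac; case: c Aac => [|c] Aac.
  rewrite leqn0; apply/eqP/eq_card0 => j; apply/negP => /Aac.
  by rewrite addn0 => /andP[h1 h2]; have := leq_ltn_trans h1 h2; rewrite ltnn.
pose f (j : 'I_n) : 'I_c.+1 := inord (j - a).
have fI : {in A &, injective f}.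
  move=> i j /Aac/andP[ai ic] /Aac/andP[aj jc] /(congr1 (@nat_of_ord _)).
  by rewrite !inordK; try lia; move=> ?; apply: val_inj => /=; lia.
by rewrite -(card_in_image fI) -[leqRHS]card_ord max_card.
Qed.

Lemma card_ffun_le (p n c : nat) (A : 'I_p -> pred 'I_n)
    (B : pred {ffun 'I_p -> 'I_n}) : (forall i, #|A i| <= c)%N ->
  (forall J, B J -> forall i, A i (J i)) -> (#|B| <= c ^ p)%N.
Proof.
move=> Ac BA; apply: (@leq_trans #|family A|).
  by apply/subset_leq_card/fintype.subsetP => J /BA JA; apply/familyP => i; exact: JA.
rewrite card_family.
suff H (s : seq 'I_p) : (foldr muln 1 [seq #|A x| | x <- s] <= c ^ size s)%N.
  by apply: leq_trans (H _) _; rewrite -cardE card_ord.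
by elim: s => //= i s IH; rewrite expnS leq_mul.
Qed.

(** * Counting points of a Cantor set *)

Section cantor.
Variables (R : realType) (rho : nat -> R).
Hypothesis rho0 : forall k, 0 < rho k.
Hypothesis rhoS : forall k, rho k.+1 <= rho k / 2.

(* The point with binary digits [j]: the [i]-th digit is weighted by [rho i]. *)
Fixpoint cantor_pt (k j : nat) : R :=
  if k is k'.+1 then cantor_pt k' (j./2) + (odd j)%:R * rho k else 0.

Lemma rho_le_pow k : rho k <= rho 0 / 2 ^+ k.
Proof.
elim: k => [|k IH]; first by rewrite expr0 divr1.
apply: (le_trans (rhoS k)); rewrite exprSr invfM mulrA ler_pM2r//.
Qed.

Lemma rho_anti k n : (k <= n)%N -> rho n <= rho k.
Proof.
move=> /subnKC <-; elim: (n - k)%N => [|d IH]; first by rewrite addn0.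
by rewrite addnS; have := rhoS (k + d); have := rho0 (k + d); lra.
Qed.

(** Induction on digits: one unit of [j./2] is worth [rho k >= 2 * rho k.+1], enough to pay for the
    two units of [j] it stands for. *)
Lemma cantor_gap k j j' : (j <= j')%N -> (j' < 2 ^ k)%N ->
  (j' - j)%:R * rho k <= cantor_pt k j' - cantor_pt k j.
Proof.
elim: k j j' => [|k IH] j j' jj' j'k /=.
  have -> : (j' - j = 0)%N by move: j'k; rewrite expn0; lia.
  by rewrite mul0r subrr.
have hj : (j'./2 < 2 ^ k)%N by move: j'k; rewrite expnS; lia.
have hh : (j./2 <= j'./2)%N by lia.
have := IH _ _ hh hj.
have E : (j' - j)%:R = 2 * (j'./2 - j./2)%:R + (odd j')%:R - (odd j)%:R :> R.
  rewrite !natrB//.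
  have -> : j'%:R = (odd j')%:R + 2 * (j'./2)%:R :> R.
    by rewrite -[in LHS](odd_double_half j') natrD -mul2n natrM.
  have -> : j%:R = (odd j)%:R + 2 * (j./2)%:R :> R.
    by rewrite -[in LHS](odd_double_half j) natrD -mul2n natrM.
  by ring.
have : (j'./2 - j./2)%:R * (2 * rho k.+1) <= (j'./2 - j./2)%:R * rho k.
  by rewrite ler_wpM2l//; have := rhoS k; lra.
rewrite E; move: (j'./2 - j./2)%:R (odd j')%:R (odd j)%:R => a b c h1 h2.
by rewrite mulrBl mulrDl -mulrA mulrCA; lra.
Qed.

(** The digits after the first [k] add at most [rho k.+1 + ... + rho (k + d)], which telescopes
    because [rho i.+1 <= rho i - rho i.+1]. *)
Lemma cantor_prefix k d j :
  0 <= cantor_pt (k + d) j - cantor_pt k (j %/ 2 ^ d) <= rho k - rho (k + d).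
Proof.
elim: d j => [|d IH] j; first by rewrite addn0 expn0 divn1 !subrr lexx.
rewrite addnS /= expnS.
have -> : (j %/ (2 * 2 ^ d) = j./2 %/ 2 ^ d)%N by rewrite divnMA divn2.
have /andP[h1 h2] := IH (j./2).
have := rhoS (k + d); have := rho0 (k + d).+1.
have o1 : (odd j)%:R <= 1 :> R by case: (odd j); rewrite ?lexx ?ler01.
move=> r0 r1.
have : 0 <= (odd j)%:R * rho (k + d).+1 by rewrite mulr_ge0// ltW.
have : (odd j)%:R * rho (k + d).+1 <= rho (k + d).+1 by rewrite ler_piMl// ltW.
by move=> h3 h4; apply/andP; split; lra.
Qed.

Lemma cantor_itv n j : 0 <= cantor_pt n j <= rho 0.
Proof.
have := cantor_prefix 0 n j; rewrite add0n /= subr0 => /andP[-> h].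
by have := rho0 n; lra.
Qed.

Lemma cantor_pad k d j : cantor_pt (k + d) (j * 2 ^ d) = cantor_pt k j.
Proof.
elim: d => [|d IH]; first by rewrite addn0 expn0 muln1.
rewrite addnS /= expnS mulnCA mul2n odd_double doubleK mul0r addr0.
exact: IH.
Qed.

(** Two such points differ by at most [2 * rho k], their prefixes of length [k] by at most
    [3 * rho k]. By [cantor_gap] at most 4 prefixes occur, each with [2 ^ (n - k)] extensions. *)
Lemma card_cantor_near (k n : nat) (a : R) : (k <= n)%N ->
  (#|[pred j : 'I_(2 ^ n) | (`|cantor_pt n j - a| <= rho k)%R]| <= 4 * 2 ^ (n - k))%N.
Proof.
move=> kn; set A := [pred j : 'I_(2 ^ n) | _].
have [j0 Aj0|none] := pickP A; last by rewrite eq_card0.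
have [i Ai imin] := @arg_minnP _ j0 A (@nat_of_ord _) Aj0.
set d := (n - k)%N; have nE : n = (k + d)%N by rewrite subnKC.
apply: (@card_ord_interval _ (i %/ 2 ^ d * 2 ^ d) _ A) => j Aj.
have ij : (i <= j)%N := imin j Aj.
have d0 : (0 < 2 ^ d)%N by rewrite expn_gt0.
rewrite (leq_trans (leq_trunc_div _ _) ij)/= -mulnDl -ltn_divLR//.
have qq : (i %/ 2 ^ d <= j %/ 2 ^ d)%N by rewrite leq_div2r.
have qk : (j %/ 2 ^ d < 2 ^ k)%N by rewrite ltn_divLR// -expnD -nE ltn_ord.
have := cantor_gap qq qk.
have := cantor_prefix k d i; have := cantor_prefix k d j; rewrite -nE.
move: Ai Aj; rewrite /A/= !ler_norml => /andP[a1 a2] /andP[a3 a4] /andP[b1 b2] /andP[b3 b4] g.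
have : (j %/ 2 ^ d - i %/ 2 ^ d)%:R * rho k < 4%:R * rho k.
  by have := rho0 k; have := rho0 n; lra.
by rewrite ltr_pM2r// ltr_nat ltn_subLR.
Qed.

Lemma card_prefix (p k d : nat) (q : {ffun 'I_p -> 'I_(2 ^ k)}) :
  ((2 ^ d) ^ p <= #|[pred J : {ffun 'I_p -> 'I_(2 ^ (k + d))} |
     [forall i, (J i %/ 2 ^ d == q i)%N]]|)%N.
Proof.
have lt_f i (j : 'I_(2 ^ d)) : (q i * 2 ^ d + j < 2 ^ (k + d))%N.
  have := ltn_ord (q i); have := ltn_ord j; rewrite expnD; nia.
pose f (J : {ffun 'I_p -> 'I_(2 ^ d)}) : {ffun 'I_p -> 'I_(2 ^ (k + d))} :=
  [ffun i => Ordinal (lt_f i (J i))].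
have fI : injective f.
  move=> J J' /ffunP E; apply/ffunP => i; have := E i; rewrite !ffunE => -[].
  by move=> /addnI; exact: val_inj.
have -> : ((2 ^ d) ^ p = #|{ffun 'I_p -> 'I_(2 ^ d)}|)%N by rewrite card_ffun !card_ord.
rewrite -(card_codom fI); apply/subset_leq_card/fintype.subsetP => _ /codomP[J ->].
rewrite inE; apply/forallP => i; rewrite ffunE/=.
by rewrite divnMDl ?expn_gt0// divn_small ?addn0.
Qed.

End cantor.

(** * Lifting a small cube to the sphere *)

Section sphere_graph.
Variables (R : realType) (p : nat).
Implicit Types c : 'I_p -> R.

Definition sphere_graph c : 'rV[R]_p.+1 :=
  \row_j (if unlift ord0 j is Some i then c i else Num.sqrt (1 - \sum_i c i ^+ 2)).

Lemma sphere_graph0 c : sphere_graph c ord0 ord0 = Num.sqrt (1 - \sum_i c i ^+ 2).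
Proof. by rewrite mxE unlift_none. Qed.

Lemma sphere_graph_lift c i : sphere_graph c ord0 (lift ord0 i) = c i.
Proof. by rewrite mxE liftK. Qed.

Let bound : R := (2 * p.+1%:R)^-1.

Lemma sum_sqr_le c : (forall i, 0 <= c i <= bound) -> \sum_i c i ^+ 2 <= 4^-1.
Proof.
move=> cb; apply: (@le_trans _ _ (\sum_(i < p) bound ^+ 2)).
  by apply: ler_sum => i _; case/andP: (cb i) => ? ?; rewrite lerXn2r ?nnegrE// invr_ge0 mulr_ge0.
rewrite sumr_const card_ord -(mulr_natr (bound ^+ 2)).
have P0 : 0 < p.+1%:R :> R by rewrite ltr0n.
have pP : p%:R <= p.+1%:R :> R by rewrite ler_nat.
apply: (@le_trans _ _ (bound ^+ 2 * p.+1%:R)); first by rewrite ler_wpM2l// sqr_ge0.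
have -> : bound ^+ 2 * p.+1%:R = 4^-1 * p.+1%:R^-1 by rewrite /bound; field; rewrite gt_eqF.
by rewrite ler_piMr// invf_le1// ler1n.
Qed.

Lemma enorm_sphere_graph c : (forall i, 0 <= c i <= bound) ->
  enorm (sphere_graph c) = 1.
Proof.
move=> cb; have := sum_sqr_le cb => s4.
apply/eqP; rewrite -(@eqrXn2 _ 2) ?enorm_ge0//; apply/eqP.
rewrite sqr_enorm big_ord_recl sphere_graph0 sqr_sqrtr; last lra.
rewrite [X in _ + X](eq_bigr (fun i => c i ^+ 2)) ?subrK ?expr1n// => i _.
by rewrite sphere_graph_lift.
Qed.

(** On the small cube both roots are at least [1 / 2], so their difference is at most that of their
    squares; the latter is at most [r], since [c i + c' i <= 1 / (p + 1)] and there are [p]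
    terms. *)
Lemma sphere_graph_dist c c' (r : R) : (forall i, 0 <= c i <= bound) ->
  (forall i, 0 <= c' i <= bound) -> 0 <= r -> (forall i, `|c i - c' i| <= r) ->
  enorm (sphere_graph c - sphere_graph c') <= p.+1%:R * r.
Proof.
move=> cb c'b r0 cr; apply: enorm_le_coord => // j; rewrite !mxE.
case: unliftP => [i _|_]; first exact: cr.
have P0 : 0 < p.+1%:R :> R by rewrite ltr0n.
have sq e : (forall i, 0 <= e i <= bound) -> 2^-1 <= Num.sqrt (1 - \sum_(i < p) e i ^+ 2).
  move=> eb; have := sum_sqr_le eb => e4.
  have -> : 2^-1 = Num.sqrt (2^-1 ^+ 2) :> R by rewrite sqrtr_sqr ger0_norm.
  by rewrite ler_sqrt; lra.
have := sq _ cb; have := sq _ c'b.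
have := sum_sqr_le cb; have := sum_sqr_le c'b => s1 s2.
have E1 : Num.sqrt (1 - \sum_i c i ^+ 2) ^+ 2 = 1 - \sum_i c i ^+ 2 by rewrite sqr_sqrtr; lra.
have E2 : Num.sqrt (1 - \sum_i c' i ^+ 2) ^+ 2 = 1 - \sum_i c' i ^+ 2 by rewrite sqr_sqrtr; lra.
have D : `|\sum_i c i ^+ 2 - \sum_i c' i ^+ 2| <= r.
  rewrite -sumrB; apply: (le_trans (ler_norm_sum _ _ _)).
  apply: (@le_trans _ _ (\sum_(i < p) r / p.+1%:R)).
    apply: ler_sum => i _.
    have -> : c i ^+ 2 - c' i ^+ 2 = (c i - c' i) * (c i + c' i) by ring.
    have bE : bound = 2^-1 * p.+1%:R^-1 by rewrite /bound invfM.
    rewrite normrM ler_pM ?cr//.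
    have := cb i; have := c'b i; rewrite bE; move: (p.+1%:R^-1) => e.
    by move=> /andP[? ?] /andP[? ?]; rewrite ger0_norm; lra.
  rewrite sumr_const card_ord -(mulr_natr (r / _)) -mulrA ler_piMr//.
  by rewrite mulrC ler_pdivrMr// mul1r ler_nat.
move: E1 E2 D; set a := Num.sqrt _; set b := Num.sqrt _ => E1 E2 D b2 a2.
have ab : (a - b) * (a + b) = - (\sum_i c i ^+ 2 - \sum_i c' i ^+ 2).
  by rewrite -subr_sqr E1 E2; ring.
apply: le_trans D; rewrite -[leRHS]normrN -ab normrM ler_peMr//.
by rewrite ger0_norm; lra.
Qed.

End sphere_graph.

(** * The Cantor set on the sphere and its Poisson integral *)

Section part_b.
Variables (R : realType) (p : nat) (v : R -> R).
Local Notation m := p.+1.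
Hypothesis (p0 : (0 < p)%N).
Hypothesis (v_pos : forall r : R, 0 <= r < 1 -> 0 < v r).
Hypothesis (v_incr : forall r s : R, 0 <= r -> r <= s -> s < 1 -> v r <= v s).
Hypothesis (lambda_incr : forall s t : R, 0 <= s -> s <= t -> t <= 1 ->
     gauge m v s <= gauge m v t).
Hypothesis (lambda_cont : {within `[(0 : R), 1], continuous (gauge m v)}).
Local Notation lam := (gauge m v).

(** As [v] increases, [lam (r / 2) >= lam r / 2 ^ p], and [lam 0 = 0]; the intermediate value
    theorem on [[0, r / 2]] applies. *)
Lemma gauge_halving (r : R) : 0 < r <= 1 ->
  exists r', [/\ 0 < r', r' <= r / 2 & lam r' = lam r / 2 ^+ p].
Proof.
move=> /andP[r0 r1].
have r20 : 0 < r / 2 by rewrite divr_gt0.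
have lr : 0 < lam r by apply: gauge_gt0; rewrite ?r0.
have P0 : 0 < (2 : R) ^+ p by rewrite exprn_gt0.
have hi : lam r / 2 ^+ p <= lam (r / 2).
  rewrite !gaugeE// expr_div_n mulrAC ler_pM2l; last by rewrite divr_gt0// exprn_gt0.
  by apply: v_incr; lra.
have cont : {within `[0, r / 2], continuous lam}.
  apply: continuous_subspaceW lambda_cont => x /=; rewrite !in_itv/= => /andP[-> h]/=.
  by apply: (le_trans h); lra.
have [|c] := @IVT R lam 0 (r / 2) (lam r / 2 ^+ p) (ltW r20) cont.
  by rewrite gauge0 ge_min le_max hi divr_ge0 ?orbT// ltW.
rewrite in_itv/= => /andP[c0 cr] cE; exists c; split => //.
rewrite lt_neqAle c0 andbT; apply/eqP => c0'.
by move: cE; rewrite -c0' gauge0 => /esym/eqP; rewrite gt_eqF// divr_gt0.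
Qed.

Lemma exists_scales : exists rho : nat -> R,
  [/\ rho 0 = (2 * m%:R)^-1, forall k, 0 < rho k, forall k, rho k.+1 <= rho k / 2 &
      forall k, lam (rho k) = lam (rho 0) / 2 ^+ (k * p)].
Proof.
have /choice[g gP] : forall r, exists r', 0 < r <= 1 ->
    [/\ 0 < r', r' <= r / 2 & lam r' = lam r / 2 ^+ p].
  move=> r; have [r01|nr] := pselect (0 < r <= 1); last by exists 0.
  by have [r' r'P] := gauge_halving r01; exists r'.
pose rho k := iter k g (2 * m%:R)^-1.
have rho01 k : 0 < rho k <= 1.
  elim: k => [|k IH].
    rewrite /rho/= invr_gt0 mulr_gt0 ?ltr0n//= invf_le1 ?mulr_gt0 ?ltr0n//.
    by rewrite -natrM ler1n.
  have [h1 h2 _] := gP _ IH; rewrite /rho/= -/(rho k) h1/=.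
  by have /andP[? ?] := IH; lra.
exists rho; split => // k; first by case/andP: (rho01 k).
  by have [] := gP _ (rho01 k).
elim: k => [|k IH]; first by rewrite mul0n expr0 divr1.
have [_ _] := gP _ (rho01 k); rewrite -/(rho k) IH => E.
by rewrite [LHS]E mulSn exprD invfM; ring.
Qed.

Section scales.
Variable rho : nat -> R.
Hypothesis rho_init : rho 0 = (2 * m%:R)^-1.
Hypothesis rho0 : forall k, 0 < rho k.
Hypothesis rhoS : forall k, rho k.+1 <= rho k / 2.
Hypothesis lam_rho : forall k, lam (rho k) = lam (rho 0) / 2 ^+ (k * p).

Let rho1 k : rho k <= 2^-1.
Proof.
apply: (le_trans (rho_anti rho0 rhoS (leq0n k))); rewrite rho_init.
by rewrite lef_pV2 ?posrE ?mulr_gt0 ?ltr0n// ler_pMr// ler1n.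
Qed.

Let c0 : R := lam (rho 0).
Let c0_gt0 : 0 < c0.
Proof. by apply: gauge_gt0 => //; rewrite rho0 (le_trans (rho1 0))//; lra. Qed.

Let rho_small (t : R) : 0 < t -> exists k, rho k <= t.
Proof.
move=> t0; have t0' : 0 < t / rho 0 by rewrite divr_gt0.
have [k kP] := invr_pow2_small t0'; exists k.
apply: (le_trans (rho_le_pow rhoS k)); have := kP k (leqnn k).
by rewrite ltr_pdivlMr// mulrC exprVn => /ltW.
Qed.

Definition cantor_sphere (n : nat) (J : {ffun 'I_p -> 'I_(2 ^ n)}) : 'rV[R]_m :=
  sphere_graph (fun i => cantor_pt rho n (J i)).
Local Notation zp := cantor_sphere.

Let coord_itv n (J : {ffun 'I_p -> 'I_(2 ^ n)}) i :
  0 <= cantor_pt rho n (J i) <= (2 * m%:R)^-1.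
Proof. by rewrite -rho_init cantor_itv. Qed.

Lemma enorm_cantor_sphere n J : enorm (@zp n J) = 1.
Proof. by apply: enorm_sphere_graph; exact: coord_itv. Qed.

(** [4 ^ p] comes from the count of near points in [p] coordinates, [2 ^ p] from passing from
    [rho k] to [rho k.+1]. *)
Let mass_constant : R := 8 ^+ p / c0.

Let mass_constant_gt0 : 0 < mass_constant.
Proof. by rewrite divr_gt0// exprn_gt0. Qed.

(** If [rho k.+1 <= s <= rho k], each of the last [p] coordinates of a near node lies within [rho k]
    of that of [x]. The threshold only ensures [k <= n], so it depends on the lower bound [t]
    alone. *)
Lemma cantor_mass_le (t : R) : 0 < t -> exists n1, forall n, (n1 <= n)%N ->
  forall s x, t <= s -> s <= 1 ->
  #|[pred J | enorm (x - @zp n J) <= s]|%:R <= mass_constant * lam s * 2 ^+ (n * p).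
Proof.
move=> t0; have [n1 n1t] := rho_small t0; exists n1 => n n1n s x ts s1.
have s0 : 0 < s := lt_le_trans t0 ts.
set B := [pred J | _].
have [rs|sr] := lerP (rho 0) s.
  apply: (@le_trans _ _ (2 ^+ (n * p))).
    by rewrite -natrX ler_nat (leq_trans (max_card _))// card_ffun !card_ord expnM.
  rewrite ler_peMl ?exprn_ge0//.
  have c0s : c0 <= lam s by apply: lambda_incr => //; exact: ltW.
  apply: (@le_trans _ _ (mass_constant * c0)); last by rewrite ler_wpM2l// ltW.
  by rewrite /mass_constant divfK ?gt_eqF// exprn_ege1// ler1n.
have exk : exists k, rho k.+1 <= s.
  by have [[|k] kP] := rho_small s0; [exists 0%N; have := rhoS 0; have := rho0 0; lra|exists k].
have [k ks kmin] := ex_minnP exk.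
have sk : s <= rho k.
  case: k ks kmin => [|k] ks kmin; first exact: ltW.
  by rewrite leNgt; apply/negP => /ltW /kmin; rewrite ltnn.
have kn : (k <= n)%N.
  apply: leq_trans n1n; apply: kmin; apply: le_trans ts; apply: le_trans n1t.
  exact: rho_anti.
have cardB : (#|B| <= (4 * 2 ^ (n - k)) ^ p)%N.
  apply: (@card_ffun_le _ _ _ (fun i => [pred j : 'I_(2 ^ n) |
     (`|cantor_pt rho n j - x ord0 (lift ord0 i)| <= rho k)%R])).
    by move=> i; exact: card_cantor_near.
  move=> J /= xJ i; apply: le_trans sk; apply: le_trans xJ.
  have := coord_le_enorm (x - zp J) (lift ord0 i).
  by rewrite mxE mxE sphere_graph_lift distrC.
apply: (@le_trans _ _ ((4 * 2 ^ (n - k)) ^ p)%:R); first by rewrite ler_nat.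
have lks : lam (rho k.+1) <= lam s by apply: lambda_incr => //; exact: ltW.
have mc := ltW mass_constant_gt0.
apply: (@le_trans _ _ (mass_constant * lam (rho k.+1) * 2 ^+ (n * p))); last first.
  by rewrite ler_wpM2r ?exprn_ge0// ler_wpM2l.
rewrite lam_rho -/c0 /mass_constant natrX natrM natrX.
have -> : 8 ^+ p / c0 * (c0 / 2 ^+ (k.+1 * p)) * 2 ^+ (n * p) =
   8 ^+ p / 2 ^+ (k.+1 * p) * 2 ^+ (n * p) :> R by rewrite mulrA divfK ?gt_eqF.
rewrite -[in leRHS](subnK kn) mulnDl exprD mulSn [2 ^+ (p + _)]exprD exprMn -exprM.
rewrite le_eqVlt; apply/orP; left; apply/eqP.
have -> : 8 ^+ p = 4 ^+ p * 2 ^+ p :> R by rewrite -exprMn; congr (_ ^+ _); ring.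
by field; rewrite !expf_neq0.
Qed.

Lemma cantor_near_prefix k d (q : {ffun 'I_p -> 'I_(2 ^ k)})
    (J : {ffun 'I_p -> 'I_(2 ^ (k + d))}) :
  (forall i, (J i %/ 2 ^ d = q i)%N) -> enorm (zp J - zp q) <= m%:R * rho k.
Proof.
move=> Jq; apply: sphere_graph_dist; [exact: coord_itv|exact: coord_itv|exact: ltW|].
move=> i; have /andP[h1 h2] := cantor_prefix rho0 rhoS k d (J i).
rewrite -Jq ger0_norm//; apply: (le_trans h2).
by rewrite gerBl ltW.
Qed.

(** Described by approximation at every level, not by infinite digit sequences: it is an
    intersection of finite unions of closed balls, so compactness is immediate. *)
Definition cantor_set : set 'rV[R]_m :=
  [set y | forall k, exists q : {ffun 'I_p -> 'I_(2 ^ k)}, enorm (zp q - y) <= m%:R * rho k].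

Lemma cantor_sphere_in_set n (J : {ffun 'I_p -> 'I_(2 ^ n)}) : cantor_set (zp J).
Proof.
move=> k; have [kn|nk] := leqP k n.
  move: J; rewrite -(subnKC kn); set d := (n - k)%N => J.
  have qlt i : (J i %/ 2 ^ d < 2 ^ k)%N by rewrite ltn_divLR ?expn_gt0// -expnD ltn_ord.
  exists [ffun i => Ordinal (qlt i)]; rewrite enormB.
  by apply: cantor_near_prefix => i; rewrite ffunE.
have nk' := ltnW nk; rewrite -(subnKC nk'); set d := (k - n)%N.
have qlt i : (J i * 2 ^ d < 2 ^ (n + d))%N by rewrite expnD ltn_pmul2r ?expn_gt0.
exists [ffun i => Ordinal (qlt i)].
have -> : zp [ffun i => Ordinal (qlt i)] = zp J.
  congr sphere_graph; apply/funext => i; rewrite ffunE/=; exact: cantor_pad.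
by rewrite subrr enorm0 mulr_ge0// ltW.
Qed.

Lemma cantor_set_sphere y : cantor_set y -> enorm y = 1.
Proof.
move=> yE; apply/eqP; rewrite -subr_eq0 -normr_le0; apply/ler_addgt0Pr => e e0.
have e1 : 0 < e / m%:R by rewrite divr_gt0// ltr0n.
have [k kP] := rho_small e1; have [q qy] := yE k; rewrite add0r.
rewrite -(enorm_cantor_sphere q) distrC (le_trans (enorm_dist _ _))//.
by apply: (le_trans qy); rewrite mulrC -ler_pdivlMr// ltr0n.
Qed.

Lemma compact_cantor_set : compact cantor_set.
Proof.
apply: (@compact_enorm_le _ _ 0 1); last first.
  by move=> y /cantor_set_sphere /= yE; rewrite sub0r enormN yE.
rewrite (_ : cantor_set = \bigcap_k \bigcup_(q in [set: {ffun 'I_p -> 'I_(2 ^ k)}])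
    [set y | enorm (zp q - y) <= m%:R * rho k]).
  apply: closed_bigI => k _; apply: closed_bigcup; first exact: finite_finset.
  by move=> q _; exact: closed_enorm_le.
apply/seteqP; split=> y yE k; first by have [q qy] := yE k; exists q.
by have [q _ qy] := yE k Logic.I; exists q.
Qed.


(* Mass distribution principle: the normalized counting measures of the points
   [zp J] give mass at most [mass_constant * lam s] to every ball of radius [s]. *)
Lemma hausdorff_cantor_set : (0 < hausdorff_measure lam cantor_set)%E.
Proof.
pose c := (2 * mass_constant)^-1.
have c_gt0 : 0 < c by rewrite invr_gt0 mulr_gt0.
apply: (@lt_le_trans _ _ c%:E); first by rewrite lte_fin.
apply: hausdorff_measure_ge.
have half0 : 0 < 2^-1 :> R by rewrite invr_gt0.
near=> delta.
have delta_half : delta < 2^-1 by near: delta; exact: nbhs_right_lt.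
apply: le_ereal_inf_tmp => _ [F [EF Fd ->]].
have dF j : 0 <= fine (ediam (F j)) <= delta by apply: fine_ediam; exact: ltW.
have fE j : (ediam (F j) = (fine (ediam (F j)))%:E)%E.
  by rewrite fineK// ge0_fin_numE ?ediam_ge0// (lt_trans (Fd j))// ltry.
set d := fun j => fine (ediam (F j)).
have d0 j : 0 <= d j by case/andP: (dF j).
have d1 j : d j < 2^-1 by case/andP: (dF j) => _ h; exact: le_lt_trans delta_half.
have lam_d j : 0 <= lam (d j) by apply: gauge_ge0 => //; rewrite d0/=; have := d1 j; lra.
(* Open balls are needed for a finite subcover, and positive radii for [cantor_mass_le]. Continuity
   of [lam] keeps the total cost of the enlargement below [c], half of the lower bound
   [1 / mass_constant]. *)
have /choice[s sP] : forall j, exists s, [/\ d j < s, s <= 1 &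
    lam s <= lam (d j) + c / (2 ^ j.+1)%:R].
  move=> j; have ej : 0 < c / (2 ^ j.+1)%:R by rewrite divr_gt0// ltr0n expn_gt0.
  have dj : d j \in `[(0 : R), 1]%classic.
    by rewrite inE/= in_itv/= d0/=; have := d1 j; lra.
  have dj' : `[(0 : R), 1]%classic (d j) by rewrite inE in dj.
  have /subspace_continuousP /(_ _ dj') /cvgrPdist_le /(_ _ ej) := lambda_cont.
  move=> /nbhs_ballP[r /= r0 rP].
  exists (d j + Num.min r 2^-1 / 2).
  have m0 : 0 < Num.min r 2^-1 by rewrite lt_min r0.
  have mr : Num.min r 2^-1 <= r by rewrite ge_min lexx.
  have m2 : Num.min r 2^-1 <= 2^-1 by rewrite ge_min lexx orbT.
  have dj1 := d1 j; have dj0 := d0 j; split; [by lra|by lra|].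
  have := rP (d j + Num.min r 2^-1 / 2).
  rewrite /ball/= opprD addNKr normrN gtr0_norm ?divr_gt0// in_itv/=.
  move=> /(_ ltac:(lra) ltac:(apply/andP; split; lra)).
  move=> h; have {h} : `|lam (d j) - lam (d j + Num.min r 2^-1 / 2)| <=
    c / (2 ^ j.+1)%:R := h.
  by rewrite ler_norml; lra.
have /choice[a aP] : forall j, exists a, F j `<=` [set y | enorm (a - y) < s j].
  move=> j; have [[a Fa]|Fe] := pselect (F j !=set0); last first.
    by exists 0 => y Fy; case: Fe; exists y.
  exists a => y Fy /=; have [ds _ _] := sP j; apply: le_lt_trans ds.
  by rewrite -lee_fin -fE; exact: ediam_ge.
have := compact_cantor_set; rewrite compact_cover.
move=> /(_ nat setT (fun j => [set y | enorm (a j - y) < s j])) [].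
- by move=> j _; exact: open_enorm_lt.
- by move=> y /EF[j _ Fy]; exists j => //; exact: aP.
move=> D _ ED.
have [N DN] : exists N : nat, forall j, j \in finmap.enum_fset D -> (j < N)%N.
  exists (\max_(j <- finmap.enum_fset D) j).+1 => j jD; rewrite ltnS.
  by apply: (@leq_bigmax_seq _ (finmap.enum_fset D) xpredT id).
have s_gt0 j : 0 < s j by case: (sP j) => h _ _; exact: le_lt_trans h.
have [n nP] : exists n, forall j, (j < N)%N -> forall x,
    #|[pred J | enorm (x - @cantor_sphere n J) <= s j]|%:R <=
      mass_constant * lam (s j) * 2 ^+ (n * p).
  have /choice[n1 n1P] := fun j => cantor_mass_le (s_gt0 j).
  exists (\max_(j < N) n1 j) => j jN x; apply: n1P => //; last by case: (sP j).
  exact: (leq_bigmax (Ordinal jN)).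
have cover : (2 ^ (n * p))%:R <= \sum_(j < N) mass_constant * lam (s j) * 2 ^+ (n * p) :> R.
  apply: (@le_trans _ _ (\sum_(j < N) #|[pred J | enorm (a j - @cantor_sphere n J) <= s j]|%:R)).
    rewrite -natr_sum ler_nat.
    have -> : (2 ^ (n * p) = #|{ffun 'I_p -> 'I_(2 ^ n)}|)%N by rewrite card_ffun !card_ord expnM.
    rewrite -sum1_card.
    apply: (@leq_trans (\sum_(J : {ffun 'I_p -> 'I_(2 ^ n)})
       \sum_(j < N | (enorm (a j - cantor_sphere J) <= s j)%R) 1)%N).
      apply: leq_sum => J _.
      have [j jD /= jJ] := ED _ (cantor_sphere_in_set J).
      by rewrite (bigD1 (Ordinal (DN j jD)))//= ltW.
    rewrite (exchange_big_dep xpredT)//=; apply: leq_sum => j _.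
    by rewrite sum1_card.
  by apply: ler_sum => j _; exact: nP.
rewrite natrX -big_distrl/= -{1}[2 ^+ _]mul1r ler_pM2r ?exprn_gt0// -big_distrr/= in cover.
apply: (@le_trans _ _ (\sum_(0 <= j < N) (lam (d j))%:E)%E); last first.
  by apply: nneseries_lim_ge => j _; rewrite lee_fin.
rewrite sumEFin lee_fin big_mkord.
have : \sum_(j < N) lam (s j) <= \sum_(j < N) lam (d j) + c.
  apply: (@le_trans _ _ (\sum_(j < N) (lam (d j) + c / (2 ^ j.+1)%:R))).
    by apply: ler_sum => j _; case: (sP j).
  rewrite big_split/= lerD2l -(big_mkord xpredT (fun j => c / (2 ^ j.+1)%:R)).
  rewrite -lee_fin -sumEFin; apply: le_trans (epsilon_trick0 xpredT (ltW c_gt0)).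
  by apply: nneseries_lim_ge => j _; rewrite lee_fin divr_ge0// ltW.
move: cover; move: (\sum_(j < N) lam (s j)) (\sum_(j < N) lam (d j)) => S T h1 h2.
have : c + c <= S.
  have -> : c + c = mass_constant^-1 by rewrite /c invfM; lra.
  by rewrite -div1r ler_pdivrMr// mulrC.
by lra.
Unshelve. all: by end_near. Qed.

(** The ultrafilter limit of averages over generation [n]. Bounds on late generations suffice, so
    thresholds depending on the evaluation point are harmless. *)
Lemma cantor_functional : exists Lam : ('rV[R]_m -> R) -> R,
  [/\ forall f g, bounded_on (@unit_sphere R m) f -> bounded_on (@unit_sphere R m) g ->
        Lam (fun z => f z + g z) = Lam f + Lam g,
      forall (c : R) f, bounded_on (@unit_sphere R m) f ->
        Lam (fun z => c * f z) = c * Lam f,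
      forall f (M : R), bounded_on (@unit_sphere R m) f ->
        (exists n1, forall n, (n1 <= n)%N ->
           \sum_J f (@cantor_sphere n J) <= M * 2 ^+ (n * p)) -> Lam f <= M &
      forall f (M : R), bounded_on (@unit_sphere R m) f ->
        (exists n1, forall n, (n1 <= n)%N ->
           M * 2 ^+ (n * p) <= \sum_J f (@cantor_sphere n J)) -> M <= Lam f].
Proof.
have [U [UP Uoo Ucvg]] := @ultrafilter_bounded_cvg R.
pose avg n (f : 'rV[R]_m -> R) := (\sum_J f (@cantor_sphere n J)) / 2 ^+ (n * p).
have N0 n : 0 < 2 ^+ (n * p) :> R by rewrite exprn_gt0.
have avg_cvg f : bounded_on (@unit_sphere R m) f -> cvg (avg n f @[n --> U]).
  move=> [M fM]; apply: (Ucvg _ M) => n.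
  rewrite /avg normrM normfV (gtr0_norm (N0 n)) ler_pdivrMr//.
  apply: (le_trans (ler_norm_sum _ _ _)).
  apply: (@le_trans _ _ (\sum_(J : {ffun 'I_p -> 'I_(2 ^ n)}) M)).
    by apply: ler_sum => J _; apply: fM; exact: enorm_cantor_sphere.
  by rewrite sumr_const card_ffun !card_ord -expnM -(mulr_natr M) natrX.
exists (fun f => lim (avg n f @[n --> U])); split.
- move=> f g bf bg; apply/cvg_lim => //.
  rewrite (_ : (fun n => _) = (fun n => avg n f + avg n g)).
    by apply: cvgD; exact: avg_cvg.
  by apply/funext => n; rewrite /avg big_split/= mulrDl.
- move=> c f bf; apply/cvg_lim => //.
  rewrite (_ : (fun n => _) = (fun n => c * avg n f)).
    by apply: cvgMr; exact: avg_cvg.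
  by apply/funext => n; rewrite /avg -big_distrr/= mulrA.
- move=> f M bf [n1 n1P]; apply: limr_le; first exact: avg_cvg.
  apply: Uoo; exists n1 => // n /= n1n; rewrite /avg ler_pdivrMr//.
  exact: n1P.
- move=> f M bf [n1 n1P]; apply: limr_ge; first exact: avg_cvg.
  apply: Uoo; exists n1 => // n /= n1n; rewrite /avg ler_pdivlMr//.
  exact: n1P.
Qed.


Lemma bounded_on_poisson (x : 'rV[R]_m) : unit_ball x ->
  bounded_on (@unit_sphere R m) (fun z => poisson z x).
Proof.
move=> Bx; apply: (@ucont_bounded _ _ _ x (@poisson R m)).
apply: (@ucont_poisson _ _ _ _ 1 _ (1 - enorm x)).
- by move=> z ->.
- by rewrite subr_gt0.
- by move=> z Zz; have := enorm_dist x z; rewrite Zz ler_norml; lra.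
Qed.

Lemma part_b_scales : exists u : 'rV[R]_m -> R,
  [/\ growth_class v u, positive_on (@unit_ball R m) u &
      cantor_set `<=` E_plus v u].
Proof.
have [Lam [LamD LamZ Lam_avg_le Lam_avg_ge]] := cantor_functional.
have Lam_le f (M : R) : bounded_on (@unit_sphere R m) f ->
    (forall z, unit_sphere z -> f z <= M) -> Lam f <= M.
  move=> bf fM; apply: Lam_avg_le => //; exists 0%N => n _.
  apply: (@le_trans _ _ (\sum_(J : {ffun 'I_p -> 'I_(2 ^ n)}) M)).
    by apply: ler_sum => J _; apply: fM; exact: enorm_cantor_sphere.
  by rewrite sumr_const card_ffun !card_ord -expnM -(mulr_natr M) natrX.
pose u (x : 'rV[R]_m) := Lam (fun z => poisson z x).
have hu : harmonic_on (@unit_ball R m) u := harmonic_poisson_integral LamD LamZ Lam_le.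
have up : positive_on (@unit_ball R m) u.
  move=> x Bx; have t0 : 0 < 1 - enorm x by rewrite subr_gt0.
  have x0 := enorm_ge0 x.
  pose c := (1 - enorm x ^+ 2) / 2 ^+ m.
  have num0 : 0 < 1 - enorm x ^+ 2 by nra.
  have c_gt0 : 0 < c by rewrite divr_gt0// exprn_gt0.
  apply: (lt_le_trans c_gt0); apply: Lam_avg_ge; first exact: bounded_on_poisson.
  exists 0%N => n _.
  apply: (@le_trans _ _ (\sum_(J : {ffun 'I_p -> 'I_(2 ^ n)}) c)).
    by rewrite sumr_const card_ffun !card_ord -expnM -(mulr_natr c) natrX.
  apply: ler_sum => J _; rewrite /poisson enorm_cantor_sphere expr1n ler_wpM2l ?(ltW num0)//.
  have := enorm_triangle x (- cantor_sphere J); have := enorm_dist x (cantor_sphere J).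
  rewrite enormN enorm_cantor_sphere ler_norml => /andP[h1 _] h2.
  have d0 : 0 < enorm (x - cantor_sphere J) by lra.
  rewrite /invdist exprVn lef_pV2 ?posrE ?exprn_gt0//.
  by rewrite lerXn2r ?nnegrE ?(ltW d0)//; lra.
exists u; split => //.
  (* The leading 2 bounds [1 - |x|^2] by [2 * t]; the rest is [kernel_sum_le] combined with
     [lam t = t ^ p * v (1 - t)]. *)
  split=> //; exists (2 * (mass_constant * 2 ^+ p.+2)) => x Bx.
  rewrite gtr0_norm ?up//; apply: Lam_avg_le; first exact: bounded_on_poisson.
  set t := 1 - enorm x.
  have x0 := enorm_ge0 x.
  have t0 : 0 < t by rewrite subr_gt0.
  have t1 : t <= 1 by rewrite /t; lra.
  have [n1 n1P] := cantor_mass_le t0; exists n1 => n n1n.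
  set N : R := 2 ^+ (n * p).
  have N0 : 0 < N by rewrite exprn_gt0.
  have mc := ltW mass_constant_gt0.
  have lt0 : 0 <= lam t by apply: gauge_ge0 => //; rewrite t1 ltW.
  have dJ (J : {ffun 'I_p -> 'I_(2 ^ n)}) : t <= enorm (x - cantor_sphere J).
    have := enorm_dist x (cantor_sphere J).
    by rewrite enorm_cantor_sphere ler_norml /t; lra.
  have massle l : \sum_(J : {ffun 'I_p -> 'I_(2 ^ n)} |
      enorm (x - cantor_sphere J) <= 2 ^+ l * t) (1 : R) <=
      (mass_constant * lam t * N) * 2 ^+ (l * p).
    have l1 : 1 <= 2 ^+ l :> R by rewrite exprn_ege1// ler1n.
    have tl : t <= 2 ^+ l * t by rewrite ler_peMl// ltW.
    (* The gauge is controlled only up to 1; beyond it the total mass suffices. *)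
    pose s := Num.min 1 (2 ^+ l * t).
    have ts : t <= s by rewrite le_min t1.
    have s1 : s <= 1 by rewrite ge_min lexx.
    have sl : s <= 2 ^+ l * t by rewrite ge_min lexx orbT.
    have s0 : 0 <= s by rewrite (le_trans (ltW t0)).
    have lams : lam s <= 2 ^+ (l * p) * lam t.
      rewrite exprM; exact: gauge_le_scale.
    have mle : \sum_(J : {ffun 'I_p -> 'I_(2 ^ n)} |
      enorm (x - cantor_sphere J) <= 2 ^+ l * t) (1 : R) <= mass_constant * lam s * N.
      have [sE|sE] : s = 1 \/ s = 2 ^+ l * t.
        by rewrite /s /Order.min; case: ifP; [left|right].
      - apply: (@le_trans _ _ N).
          apply: (@le_trans _ _ (\sum_(J : {ffun 'I_p -> 'I_(2 ^ n)}) 1)).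
            by rewrite [leLHS]big_mkcond; apply: ler_sum => J _; case: ifP.
          by rewrite sumr_const card_ffun !card_ord -expnM natrX.
        rewrite ler_peMl ?(ltW N0)//.
        apply: (@le_trans _ _ (mass_constant * c0)).
          by rewrite /mass_constant divfK ?gt_eqF// exprn_ege1// ler1n.
        rewrite ler_wpM2l// sE; apply: lambda_incr => //; first exact: ltW.
        by apply: (le_trans (rho1 0)); lra.
      - rewrite -sE; apply: le_trans (n1P n n1n s x ts s1).
        by rewrite sumr_const.
    apply: (le_trans mle).
    have -> : mass_constant * lam t * N * 2 ^+ (l * p) =
      mass_constant * (2 ^+ (l * p) * lam t) * N by ring.
    by rewrite ler_wpM2r ?(ltW N0)// ler_wpM2l.
  have K := @kernel_sum_le R _ (fun=> 1) (fun J : {ffun 'I_p -> 'I_(2 ^ n)} =>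
    enorm (x - cantor_sphere J)) t _ p t0 (fun=> ler01) dJ massle.
  apply: (@le_trans _ _ (2 * t *
    \sum_(J : {ffun 'I_p -> 'I_(2 ^ n)}) 1 / enorm (x - cantor_sphere J) ^+ p.+1)).
    rewrite big_distrr/=; apply: ler_sum => J _.
    rewrite /poisson /invdist exprVn enorm_cantor_sphere expr1n mul1r.
    rewrite ler_wpM2r ?invr_ge0 ?exprn_ge0 ?enorm_ge0//.
    by have := sqr_ge0 (1 - enorm x); rewrite /t; lra.
  apply: (le_trans (ler_wpM2l _ K)); first by rewrite mulr_ge0// ltW.
  rewrite gaugeE// (_ : 1 - t = enorm x); last by rewrite /t; lra.
  rewrite le_eqVlt; apply/orP; left; apply/eqP.
  rewrite [t ^+ p.+1]exprS; field; rewrite ?gt_eqF ?exprn_gt0//.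
move=> y yE; split; first exact: cantor_set_sphere.
(* From [(1 - t) *: y] to [y], to the node of its prefix, to a node with that prefix:
   [t + m * rho k + m * rho k <= M2 * t]. *)
pose M2 : R := 2 * m%:R + 1.
have M20 : 0 < M2 by rewrite ltr_wpDl// mulr_ge0.
(* Nodes sharing the prefix have a share at least [2 ^ (- k p)] and kernel at least
   [t / (M2 * t) ^ m], whereas [lam t <= c0 * 2 ^ p / 2 ^ (k p)]. *)
pose c := (2 ^+ p * c0 * M2 ^+ m)^-1.
have c_gt0 : 0 < c by rewrite invr_gt0 !mulr_gt0 ?exprn_gt0.
have key (t : R) : 0 < t < rho 0 -> c * v (1 - t) <= u ((1 - t) *: y).
  move=> /andP[t0 tr].
  have t2 : t < 2^-1 by apply: lt_le_trans tr (rho1 0).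
  have y1 := cantor_set_sphere yE.
  have Bx : unit_ball ((1 - t) *: y).
    by rewrite /unit_ball/= enormZ y1 mulr1 ger0_norm; lra.
  have exk := rho_small t0.
  (* The generation matching the height: [rho k <= t <= rho k.-1], with [k > 0] because
     [t < rho 0]. *)
  have [k kt kmin] := ex_minnP exk.
  have k0 : (0 < k)%N.
    by case: k kt {kmin} => // kt; move: tr; rewrite ltNge kt.
  have tk : t <= rho k.-1.
    rewrite leNgt; apply/negP => /ltW /kmin; rewrite -ltnS prednK// ltnn //.
  have lamt : lam t <= c0 * 2 ^+ p / 2 ^+ (k * p).
    apply: (@le_trans _ _ (lam (rho k.-1))).
      by apply: lambda_incr => //; [exact: ltW|have := rho1 k.-1; lra].
    rewrite lam_rho -/c0 -[in leRHS](prednK k0) mulSn exprD.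
    by rewrite le_eqVlt; apply/orP; left; apply/eqP; field; rewrite !expf_neq0.
  have [q qy] := yE k.
  apply: Lam_avg_ge; first exact: bounded_on_poisson.
  exists k => n kn; rewrite -(subnKC kn); set d := (n - k)%N.
  pose good := [pred J : {ffun 'I_p -> 'I_(2 ^ (k + d))} |
     [forall i, (J i %/ 2 ^ d == q i)%N]].
  have P0 (J : {ffun 'I_p -> 'I_(2 ^ (k + d))}) : 0 <= poisson (cantor_sphere J) ((1 - t) *: y).
    rewrite /poisson enorm_cantor_sphere mulr_ge0//; last first.
      by rewrite exprn_ge0// invr_ge0 enorm_ge0.
    by rewrite enormZ y1 mulr1 ger0_norm; nra.
  have Pgood J : good J -> t / (M2 * t) ^+ m <= poisson (cantor_sphere J) ((1 - t) *: y).
    move=> /forallP Jq; rewrite /poisson enorm_cantor_sphere expr1n enormZ y1 mulr1.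
    rewrite ger0_norm; last lra.
    have dist : enorm ((1 - t) *: y - cantor_sphere J) <= M2 * t.
      have h1 := cantor_near_prefix (fun i => eqP (Jq i)).
      have e1 := enorm_triangleB ((1 - t) *: y) y (cantor_sphere J).
      have e2 := enorm_triangleB y (cantor_sphere q) (cantor_sphere J).
      have e3 : enorm ((1 - t) *: y - y) = t.
        by rewrite scalerBl scale1r addrAC subrr add0r enormN enormZ y1 mulr1 gtr0_norm.
      have h2 : m%:R * rho k <= m%:R * t by rewrite ler_wpM2l.
      rewrite (enormB y (cantor_sphere q)) in e2.
      rewrite (enormB (cantor_sphere q) (cantor_sphere J)) in e2.
      by rewrite /M2; lra.
    have d0 : 0 < enorm ((1 - t) *: y - cantor_sphere J).
      have := enorm_dist (cantor_sphere J) ((1 - t) *: y).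
      rewrite enorm_cantor_sphere enormZ y1 mulr1 (@ger0_norm _ (1 - t)); last lra.
      by rewrite enormB ler_norml; lra.
    apply: ler_pM.
    - exact: ltW.
    - by rewrite invr_ge0 exprn_ge0// mulr_ge0// ltW.
    - by nra.
    rewrite /invdist exprVn lef_pV2 ?posrE ?exprn_gt0// ?mulr_gt0//.
    by rewrite lerXn2r ?nnegrE ?(ltW d0)// mulr_ge0// ltW.
  apply: (@le_trans _ _ (\sum_(J | good J) t / (M2 * t) ^+ m)); last first.
    rewrite [leRHS](bigID good)/= ler_wpDr//; first exact: sumr_ge0.
    exact: ler_sum.
  rewrite sumr_const -[leRHS]mulr_natr.
  have tt0 : 0 <= t / (M2 * t) ^+ m by rewrite divr_ge0 ?exprn_ge0 ?mulr_ge0// ltW.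
  apply: (@le_trans _ _ (t / (M2 * t) ^+ m * ((2 ^ d) ^ p)%:R)); last first.
    by rewrite ler_wpM2l// ler_nat; exact: card_prefix.
  have vt : v (1 - t) = lam t / t ^+ p.
    by rewrite gaugeE// mulrC mulKf// expf_neq0// gt_eqF.
  rewrite vt -expnM natrX mulnDl exprD.
  have tp0 : 0 < t ^+ p by rewrite exprn_gt0.
  apply: (@le_trans _ _ (c * (c0 * 2 ^+ p / 2 ^+ (k * p) / t ^+ p) * (2 ^+ (k * p) * 2 ^+ (d *
    p)))).
    rewrite ler_wpM2r ?mulr_ge0 ?exprn_ge0// ler_wpM2l ?(ltW c_gt0)//.
    by rewrite ler_wpM2r// invr_ge0 ltW.
  rewrite le_eqVlt; apply/orP; left; apply/eqP.
  rewrite /c exprMn [t ^+ m]exprS; field.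
  by rewrite !expf_neq0 ?gt_eqF.
apply: (@lt_le_trans _ _ c%:E); first by rewrite lte_fin.
rewrite limf_einfE.
pose V := [set r : R | 1 - rho 0 < r /\ r < 1].
apply: (@le_trans _ _ (ereal_inf ((fun r : R => (u (r *: y) / v r)%:E) @` V))).
  apply: le_ereal_inf_tmp => _ [r [rV r1] <-]; rewrite lee_fin.
  have r0 : 0 <= r by have := rho1 0; lra.
  have vr : 0 < v r by apply: v_pos; rewrite r0.
  rewrite ler_pdivlMr//.
  have := key (1 - r); rewrite opprB addrCA subrr addr0; apply.
  by apply/andP; split; lra.
apply: ereal_sup_ubound; exists V => //.
exists (rho 0) => //= r; rewrite /ball/= => r1 lt1; split => //.
by move: r1; rewrite gtr0_norm ?subr_gt0//; lra.
Qed.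

End scales.
End part_b.

Theorem theorem2 (R : realType) (m : nat) (v : R -> R)
  (hm : (2 <= m)%N)
  (v_pos : forall r : R, 0 <= r < 1 -> 0 < v r)
  (v_incr : forall r s : R, 0 <= r -> r <= s -> s < 1 -> v r <= v s)
  (v_cont : {within `[(0 : R), 1[, continuous v})
  (v_lim : v r @[r --> (1 : R)^'-] --> +oo)
  (lambda_incr : forall s t : R, 0 <= s -> s <= t -> t <= 1 ->
     gauge m v s <= gauge m v t)
  (lambda_cont : {within `[(0 : R), 1], continuous (gauge m v)}) :
  (forall u : 'rV[R]_m -> R,
     harmonic_on (@unit_ball R m) u -> positive_on (@unit_ball R m) u ->
     exists A : nat -> set 'rV[R]_m,
       F_plus v u = \bigcup_n A n /\
       forall n, (hausdorff_measure (gauge m v) (A n) < +oo)%E) /\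
  (exists u : 'rV[R]_m -> R,
     [/\ growth_class v u,
         positive_on (@unit_ball R m) u &
         (0 < hausdorff_measure (gauge m v) (E_plus v u))%E]).
Proof.
case: m hm lambda_incr lambda_cont => [//|p] hm lambda_incr lambda_cont.
split=> [u hu up|]; first exact: part_a.
have [rho [rho_init rho0 rhoS lam_rho]] := exists_scales v_pos v_incr lambda_cont.
have [u [gu up Eu]] := part_b_scales v_pos v_incr lambda_incr rho_init rho0 rhoS lam_rho.
exists u; split=> //.
apply: lt_le_trans (hausdorff_measure_subset _ Eu).
exact: hausdorff_cantor_set rho_init rho0 rhoS lam_rho.
Qed.
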